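(* Let $\varphi,\psi$ be $\mathrm{id}$-type maps. Then the spiders $S_\varphi$ and $S_\psi$ are projectively equivalent if and only if $[\varphi]=[\psi]$ in $\mathcal{T}_f$, i.e. $\varphi$ is isotopic to $\psi$ relative to $P_f$.
   Context: Rays and addresses. For an entire function $h(z)=e^z+\kappa$ let $I(h)$ be the set of points whose iterates tend to $\infty$. A ray tail of $h$ is a continuous curve $\gamma:[0,\infty)\to I(h)$ such that for every $n\ge0$ the restriction $h^n|_\gamma$ is injective with $\lim_{t\to\infty}h^n(\gamma(t))=\infty$, and $h^n(\gamma(t))\to\infty$ uniformly in $t$ as $n\to\infty$. A dynamic ray is a maximal injective curve $\gamma:(0,\infty)\to I(h)$ such that $\gamma|_{[t,\infty)}$ is a ray tail for all $t>0$. A point escapes on rays if it belongs to a dynamic ray. For $r$ such that $\mathbb{H}_r=\{\Re z>r\}$ does not contain $\kappa$, let $T_n$ be the component of $h^{-1}(\mathbb{H}_r)$ contained in the strip $2\pi(n-1/2)<\Im z<2\pi(n+1/2)$. A point $z$ escaping on rays has external address $(s_0s_1\dots)\in\mathbb{Z}^{\mathbb{N}}$ if each $h^n(z)$ belongs to a ray tail contained in $T_{s_n}$ near $\infty$. (Pre-)periodicity of an address is with respect to the shift. Captured exponential function. Let $f_0(z)=e^z+\kappa$ have non-escaping singular value $v=\kappa$. Let $\{a_n\}_{n\ge0}$ be an orbit of $f_0$ that escapes on dynamic rays $\mathcal{R}_n\ni a_n$; the external address of $a_0$ is assumed not (pre-)periodic. Let $R_n$ be the part of $\mathcal{R}_n$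 from $a_n$ to $\infty$ (the ray tail with endpoint $a_n$). Fix a bounded Jordan domain $U\subset\mathbb{C}\setminus\bigcup_{n>0}R_n$ containing $v$ and $a_0$, and an isotopy $c_u$, $u\in[0,1]$, of $\mathbb{C}$ through quasiconformal maps with $c_0=\mathrm{id}$, $c_u=\mathrm{id}$ off $U$, $c_1(v)=a_0$. Put $c=c_1$, $f=c\circ f_0$; then $P_f=\{a_n:n\ge0\}$ is the post-singular set of $f$. $\mathcal{T}_f$ is the Teichmüller space of $\mathbb{C}\setminus P_f$: quasiconformal homeomorphisms of $\mathbb{C}\setminus P_f$ (extended to $\mathbb{C}$) modulo post-composition with affine maps and isotopy relative to $P_f$. Spiders. $S_0=\bigcup_{n\ge0}R_n$ is the standard spider. A quasiconformal map $\varphi:\mathbb{C}\to\mathbb{C}$ is of $\mathrm{id}$-type if there is an isotopy $\varphi_u:\mathbb{C}\to\mathbb{C}$, $u\in[0,1]$, with $\varphi_1=\varphi$, $\varphi_0=\mathrm{id}$ and $|\varphi_u(z)-z|\to0$ uniformly in $u$ as $S_0\ni z\to\infty$. The spider of an $\mathrm{id}$-type $\varphi$ is $S_\varphi=\varphi(S_0)$, with legs $\varphi(R_n)$. The word $W(V,\gamma)$. An r-curve is a continuous curve $\gamma:[0,\infty]\to\hat{\mathbb{C}}$ with $\gamma([0,\infty))\subset\mathbb{C}$, $\gamma(\infty)=\infty$ and $\Re\gamma(t)\to+\infty$ as $t\to\infty$. Let $V\subset\mathbb{C}$ be finite and $\gamma$ an r-curve with $\gamma(0)\in V$, $\gamma((0,\infty))\subset\mathbb{C}\setminus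 V$. Choose $r\in\mathbb{R}$ smaller than the real parts of all points of $V$ and of $\gamma$, and let $H_r=(\mathbb{H}_r\setminus V)\cup\{\infty\}\subset\hat{\mathbb{C}}$. Let $[\cdot]$ denote homotopy classes of curves $(0,\infty)\to H_r$ under homotopies in $H_r$ preserving the limits at $t=0$ and $t=\infty$ (the limit at $0$ being a point of $V$). For $w\in V$ let $g_w\in\pi_1(H_r,\infty)$ be the class of the loop that comes from $\infty$ leftwards along the horizontal ray $\{w+t:t\ge0\}$, bypassing from above (along small upper half-circles) every point of $V\setminus\{w\}$ on that ray, goes once clockwise around $w$ along a small circle, and returns to $\infty$ along the same path. $\pi_1(H_r,\infty)$ is free on $\{g_w\}_{w\in V}$. Let $\gamma_{str}$ be the horizontal ray from $\gamma(0)$ to $\infty$ in the positive real direction, modified to bypass from above the other points of $V$ lying on it. Consider a loop $\gamma_{loop}\subset H_r$ with base point $\infty$ such that $[\gamma_{str}]\cdot[\gamma_{loop}]=[\gamma]$ in $H_r$; such a loop exists: for example, one can slightly homotope $\gamma$ in $H_r$ so that for some $\epsilon>0$ we have $\gamma(t)=\gamma(0)+t$ for $t\in(0,\epsilon]$, and then $[\gamma_{loop}]=[(\gamma_{str}|_{[\epsilon,\infty]})^{-1}]\cdot[\gamma|_{[\epsilon,\infty]}]$. $W(V,\gamma)\in F(V)$ is the image of $[\gamma_{loop}]$ under the isomorphism $g_w\mapsto w$ onto the free group $F(V)$ on $V$. It does not depend on $r$. Leg homotopy word: with $\mathcal{O}_n=\{a_i:i\le n\}$ put $W_n^\varphi=W(\varphi(\mathcal{O}_n),\varphi(R_n))$,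 where $\varphi(R_n)$ is parametrized as an r-curve starting at $\varphi(a_n)$. Spiders $S_\varphi,S_\psi$ are projectively equivalent if for all $n\ge0$ we have $\varphi(a_n)=\psi(a_n)$ and $W_n^\varphi=W_n^\psi$.
   Formalization: The loop defining W(V,γ) is determined only up to left multiplication by powers of the generator at γ(0), as a turn around the starting point contracts; so W(V,γ) is taken to be the set of words of all admissible loops, and equality of words means equality of these sets. *)

(* Defs.v *)
From HB Require Import structures.
From mathcomp Require Import all_boot all_order all_algebra.
From mathcomp Require Import all_classical all_reals all_analysis.
From mathcomp Require Import complex.

Set Implicit Arguments.
Unset Strict Implicit.
Unset Printing Implicit Defensive.

Import Order.TTheory GRing.Theory Num.Theory.
Import numFieldNormedType.Exports.
Import ComplexField.Normc.

Local Open Scope classical_set_scope.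
Local Open Scope ring_scope.
Local Open Scope complex_scope.

(* not the homonymous functions of [Num], valued in [R[i]] *)
Local Notation Re := complex.Re.
Local Notation Im := complex.Im.

(* MathComp-Analysis attaches the norm topology to abstract [numClosedFieldType]s
   only; this makes it available on the concrete type [R[i]]. *)
HB.instance Definition _ (R : realType) := NormedModule.copy R[i] (R[i])^o.

Notation sphere R := (one_point_compactification R[i]).

Section Plane.
Variable R : realType.
Implicit Types (z : R[i]) (phi psi : R[i] -> R[i]).

Definition cexp z : R[i] :=
  (expR (Re z) * cos (Im z)) +i* (expR (Re z) * sin (Im z)).

Definition exp_map (kappa : R[i]) z : R[i] := cexp z + kappa.

Definition half_plane (r : R) : set R[i] := [set z | r < Re z].

Definition homeomorphism phi :=
  continuous phi /\
  exists g : R[i] -> R[i], [/\ continuous g, cancel phi g & cancel g phi].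

Definition isotopy (H : R -> R[i] -> R[i]) :=
  {within `[0, 1] `*` setT, continuous (fun x : R * R[i] => H x.1 x.2)} /\
  forall u : R, 0 <= u <= 1 -> homeomorphism (H u).

Definition isotopic_rel (P : set R[i]) phi psi :=
  exists H, [/\ isotopy H, H 0 = phi, H 1 = psi &
    forall (u : R) z, 0 <= u <= 1 -> P z -> H u z = phi z].

(* The points of the Teichmueller space of the complement of [P] are the classes
   of quasiconformal homeomorphisms for the following equivalence relation. *)
Definition teichmuller_equiv (P : set R[i]) phi psi :=
  exists alpha beta : R[i], alpha != 0 /\
    isotopic_rel P (fun z => alpha * phi z + beta) psi.

Definition abs_continuous (a b : R) (g : R -> R[i]) :=
  forall e : R, 0 < e -> exists2 d : R, 0 < d &
    forall (n : nat) (x y : nat -> R),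
      (forall i, (i < n)%N -> [/\ a <= x i, x i <= y i & y i <= b]) ->
      (forall i j, (i < j < n)%N -> y i <= x j) ->
      \sum_(i < n) (y i - x i) < d ->
      \sum_(i < n) normc (g (y i) - g (x i)) < e.

(* Absolute continuity on almost all horizontal and vertical lines *)
Definition ACL phi := forall a b c d : R,
  {ae (@lebesgue_measure R), forall y : R, c <= y <= d ->
     abs_continuous a b (fun x => phi (x +i* y))} /\
  {ae (@lebesgue_measure R), forall x : R, a <= x <= b ->
     abs_continuous c d (fun y => phi (x +i* y))}.

Definition has_partials phi (x y : R) :=
  [/\ derivable (fun t => Re (phi (t +i* y))) x 1,
      derivable (fun t => Im (phi (t +i* y))) x 1,
      derivable (fun t => Re (phi (x +i* t))) y 1 &
      derivable (fun t => Im (phi (x +i* t))) y 1].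

Definition partial_x phi (x y : R) : R[i] :=
  derive1 (fun t => Re (phi (t +i* y))) x +i*
  derive1 (fun t => Im (phi (t +i* y))) x.

Definition partial_y phi (x y : R) : R[i] :=
  derive1 (fun t => Re (phi (x +i* t))) y +i*
  derive1 (fun t => Im (phi (x +i* t))) y.

Definition partial_z phi (x y : R) : R[i] :=
  (partial_x phi x y - (0 +i* 1) * partial_y phi x y) / 2.

Definition partial_zbar phi (x y : R) : R[i] :=
  (partial_x phi x y + (0 +i* 1) * partial_y phi x y) / 2.

(* The analytic definition; it forces [phi] to preserve orientation. *)
Definition quasiconformal phi :=
  [/\ homeomorphism phi, ACL phi &
    exists2 k : R, 0 <= k < 1 &
      {ae (@lebesgue_measure R \x @lebesgue_measure R)%E, forall p : R * R,
        has_partials phi p.1 p.2 /\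
        normc (partial_zbar phi p.1 p.2) <=
          k * normc (partial_z phi p.1 p.2)}].

Definition jordan_curve (J : set R[i]) :=
  exists g : R -> R[i],
    [/\ {within `[0, 1], continuous g}, g 0 = g 1,
        {in `[0, 1[ &, injective g} & J = g @` `[0, 1]].

Definition jordan_domain (U : set R[i]) :=
  exists J z, [/\ jordan_curve J, ~ J z, U = connected_component (~` J) z &
    exists M : R, forall w, U w -> normc w <= M].

End Plane.

Section Rays.
Variable R : realType.
Implicit Types (h : R[i] -> R[i]) (g : R -> R[i]) (z : R[i]).

Definition escaping h : set R[i] :=
  [set z | normc (iter n h z) @[n --> \oo] --> +oo].

Definition ray_tail h g :=
  [/\ {within `[0, +oo[, continuous g},
      forall t : R, 0 <= t -> escaping h (g t),
      forall n, {in `[0, +oo[ &, injective (fun t => iter n h (g t))} /\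
                normc (iter n h (g t)) @[t --> +oo] --> +oo &
      forall M : R, \forall n \near \oo,
        forall t : R, 0 <= t -> M < normc (iter n h (g t))].

Definition pre_dynamic_ray h g :=
  [/\ {in `]0, +oo[ &, injective g},
      forall t : R, 0 < t -> escaping h (g t) &
      forall t : R, 0 < t -> ray_tail h (fun s => g (t + s))].

Definition dynamic_ray h g :=
  pre_dynamic_ray h g /\
  forall g', pre_dynamic_ray h g' ->
    g @` `]0, +oo[ `<=` g' @` `]0, +oo[ -> g' @` `]0, +oo[ `<=` g @` `]0, +oo[.

Definition strip (n : int) : set R[i] :=
  [set z | 2 * pi * (n%:~R - 2^-1) < Im z < 2 * pi * (n%:~R + 2^-1)].

(* The connected component of the preimage of [half_plane r] contained in the
   [n]-th strip, as the set of points whose component lies in that strip. *)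
Definition tract h (r : R) (n : int) : set R[i] :=
  [set z | (h @^-1` half_plane r) z /\
           connected_component (h @^-1` half_plane r) z `<=` strip n].

Definition external_address (kappa : R[i]) (r : R) z (s : nat -> int) :=
  ~ half_plane r kappa /\
  forall n, exists g, [/\ ray_tail (exp_map kappa) g,
    exists2 t : R, 0 <= t & g t = iter n (exp_map kappa) z &
    \forall t \near +oo, tract (exp_map kappa) r (s n) (g t)].

Definition preperiodic (s : nat -> int) :=
  exists k p, (0 < p)%N /\ forall n, (k <= n)%N -> s (n + p)%N = s n.

(* [ray_part (rays n) (tau n)] parametrizes over [0, +oo[ the part R_n of the
   ray [rays n] from the point [rays n (tau n)] to infinity. *)
Definition ray_part (g : R -> R[i]) (tau t : R) : R[i] := g (tau + t).

Definition standard_spider (rays : nat -> R -> R[i]) (tau : nat -> R) :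
    set R[i] :=
  \bigcup_n (ray_part (rays n) (tau n) @` `[0, +oo[).

Definition id_type (S0 : set R[i]) (phi : R[i] -> R[i]) :=
  quasiconformal phi /\
  exists H, [/\ isotopy H, H 0 = id, H 1 = phi &
    forall e : R, 0 < e -> exists M : R, forall (u : R) z, 0 <= u <= 1 ->
      S0 z -> M < normc z -> normc (H u z - z) < e].

End Rays.

Section Words.
Variable R : realType.
Implicit Types (V : set R[i]) (w z : R[i]) (p q : R -> sphere R).

Definition path_cat p q : R -> sphere R :=
  fun t => if t <= 2^-1 then p (2 * t) else q (2 * t - 1).

Definition path_rev p : R -> sphere R := fun t => p (1 - t).

(* A curve defined on [0, +oo[ and tending to infinity, as a path on [0, 1]
   in the sphere *)
Definition path_to_infty (g : R -> R[i]) : R -> sphere R :=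
  fun t => if t < 1 then Some (g (t / (1 - t))) else None.

(* Homotopy of curves relative to their endpoints; only the open curves have
   to stay in [A]. Continuity is required on the closed square: with the limits
   at the ends preserved merely for each [u], every loop could be pushed off
   to the end at infinity. *)
Definition homotopic_in (A : set (sphere R)) p q :=
  exists H : R -> R -> sphere R,
    [/\ {within `[0, 1] `*` `[0, 1],
           continuous (fun x : R * R => H x.1 x.2)},
        forall t : R, 0 <= t <= 1 -> H 0 t = p t /\ H 1 t = q t,
        forall u : R, 0 <= u <= 1 -> H u 0 = p 0 /\ H u 1 = p 1 &
        forall u t : R, 0 <= u <= 1 -> 0 < t < 1 -> A (H u t)].

Definition punctured_half_plane V (r : R) : set (sphere R) :=
  (Some @` (half_plane r `\` V)) `|` [set None].

(* The horizontal ray [w + t], [t >= 0], bypassing from above along half-circles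
   of radius [e] the other points of [V]: [Num.sqrt] vanishes on negative
   numbers, so the summand of [z] is nonzero only within distance [e] of [z]. *)
Definition bypass_ray V (e : R) w (t : R) : R[i] :=
  (Re w + t) +i*
  (Im w + \sum_(z \in V `&` [set z | Im z = Im w /\ z <> w])
            Num.sqrt (e ^+ 2 - (Re w + t - Re z) ^+ 2)).

Definition clockwise_circle (e : R) w : R -> sphere R :=
  fun t => Some (w + (e * cos (2 * pi * t)) -i* (e * sin (2 * pi * t))).

Definition generator V (e : R) w : R -> sphere R :=
  let tail := path_to_infty (fun t => bypass_ray V e w (e + t)) in
  path_cat (path_rev tail) (path_cat (clockwise_circle e w) tail).

(* Words in the letters [w] (coded [(w, true)]) and [w^-1] ([(w, false)]);
   elements of the free group on [V] are represented by reduced words. *)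
Definition word := seq (R[i] * bool).

Definition free_group V : set word :=
  [set m | sorted (fun x y => ~~ ((x.1 == y.1) && (x.2 != y.2))) m /\
           forall x, x \in m -> V x.1].

Fixpoint word_loop V (e : R) (m : word) : R -> sphere R :=
  match m with
  | [::] => fun=> None
  | (w, b) :: m' =>
      path_cat (if b then generator V e w else path_rev (generator V e w))
               (word_loop V e m')
  end.

Definition small_radius V (r e : R) :=
  [/\ 0 < e, forall w, V w -> r + e < Re w &
      forall w z, V w -> V z -> w <> z -> 2 * e < normc (w - z)].

(* The word W(V, g), for [V] finite and [g] an r-curve on [0, +oo[ with [g 0] in [V].
   A loop with [g_str] * [loop] = [g] is determined only up to multiplication
   on the left by powers of the generator of [g 0], because a turn around the
   starting point can be contracted to it. So W(V, g) is the set of the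
   words of all such loops, a right coset in the free group on [V]. *)
Definition curve_words V (g : R -> R[i]) : set word :=
  [set m | free_group V m /\
    exists (r e : R) (loop : R -> sphere R),
      [/\ forall t : R, 0 <= t -> r < Re (g t),
          small_radius V r e,
          loop 0 = None /\ loop 1 = None,
          homotopic_in (punctured_half_plane V r)
            (path_cat (path_to_infty (bypass_ray V e (g 0))) loop)
            (path_to_infty g) &
          homotopic_in (punctured_half_plane V r) loop (word_loop V e m)]].

Definition leg_word (a : nat -> R[i]) (rays : nat -> R -> R[i])
    (tau : nat -> R) (phi : R[i] -> R[i]) (n : nat) : set word :=
  curve_words [set phi (a i) | i in `I_n.+1] (phi \o ray_part (rays n) (tau n)).

Definition projectively_equivalent (a : nat -> R[i]) (rays : nat -> R -> R[i])
    (tau : nat -> R) (phi psi : R[i] -> R[i]) :=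
  forall n, phi (a n) = psi (a n) /\
    leg_word a rays tau phi n = leg_word a rays tau psi n.

End Words.

(* Main.v *)
(* Write b_n = phi(a_n). Along an id-type map phi(a_n) - a_n tends to 0 while consecutive
   points a_n are at least 1 apart, so an affine map relating phi and psi on P_f is the
   identity. Let K_u be the isotopy from phi to psi through the identity; it moves the
   points of S_0 by a bounded amount.

   From equal words to an isotopy. If W_n is the same for phi and psi, then the legs
   phi(R_n) and psi(R_n) are homotopic in the complement of b_0, ..., b_(n-1). Sliding the
   leg by K_u shows that they differ by the loop K_u(a_n), which is therefore
   null-homotopic, and pushing points back along a null-homotopy of it corrects K so as to
   fix b_n without moving b_0, ..., b_(n-1) again. Far out all the strands K_u(a_m) are
   short and are straightened simultaneously, the null-homotopies can be retracted to a
   disc containing the remaining strands, and so finitely many corrections suffice.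

   From an isotopy to equal words. Let J_u be an isotopy from phi to psi relative to P_f,
   and L_u the loop of homeomorphisms consisting of J and the reverse of K. For a point x
   far out on R_n, the loop L_u(x) is null-homotopic in the complement of a large disc,
   because L_u(x) - L_u(a_m) never vanishes for any m. Hence J_u(x) and K_u(x) are homotopic
   there; as J slides the part of phi(R_n) before phi(x) to that of psi(R_n), and K the part
   after it, the two legs are homotopic.

   As the words of a leg are a coset, one also needs that a leg has some word: a loop in
   H_r is cut into pieces avoiding slits that start at the points of V, and crossing a slit
   amounts to inserting a generator g_w. *)

Require Import Defs.
From HB Require Import structures.
From mathcomp Require Import all_boot all_order all_algebra.
From mathcomp Require Import all_classical all_reals all_analysis.
From mathcomp Require Import complex ring lra.

Set Implicit Arguments.
Unset Strict Implicit.
Unset Printing Implicit Defensive.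

Import Order.TTheory GRing.Theory Num.Theory.
Import numFieldNormedType.Exports.
Import ComplexField.Normc.

Local Open Scope classical_set_scope.
Local Open Scope ring_scope.
Local Open Scope complex_scope.

Local Notation Re := complex.Re.
Local Notation Im := complex.Im.

(** * Topology of the complex plane *)

(** The dynamics enters through one fact: of two points on a ray, the one nearer to infinity
    eventually leads in real part by more than 10. Comparing [a 0] with a point before it on its ray
    shows that the real parts of the orbit finally grow by at least 1 per step. A leg R_n through an
    earlier [a i] would make the orbit of [a i] lead that of [a n], against this growth. So R_n
    avoids a_0, ..., a_(n-1), which allows the strands to be straightened in the order of their
    indices. The homotopies behind the words live in H_r, which contains infinity, whereas a push
    needs a null-homotopy in the plane. Radial projection to a circle has no limit at infinity, but
    a half-plane can be pulled to the right until everything far away projects near one point of the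
    circle. In the converse direction the obstacle is that J is not controlled near infinity: it
    cannot slide a whole leg continuously up to its end, and so acts on a bounded part only.
    Finally, two empty cosets would be equal without carrying any information; this is why every leg
    must be shown to have a word. *)

Section ComplexTopology.
Context {R : realType}.
Local Notation C := R[i].

Lemma norm_normc (z : C) : `|z| = (normc z)%:C.
Proof. by rewrite normc_def; case: z. Qed.

Lemma normc_ge0 (z : C) : 0 <= normc z.
Proof. by case: z => x y; rewrite sqrtr_ge0. Qed.

Lemma normcB (z w : C) : normc (z - w) = normc (w - z).
Proof. by rewrite -normcN opprB. Qed.

Lemma normc_eq0 (z : C) : (normc z == 0) = (z == 0).
Proof.
apply/eqP/eqP => [/eq0_normc //|->]; exact: normc0.
Qed.

Lemma normc_gt0 (z : C) : (0 < normc z) = (z != 0).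
Proof. by rewrite lt_neqAle normc_ge0 andbT eq_sym normc_eq0. Qed.

Lemma normc_triangle (x y z : C) : normc (x - z) <= normc (x - y) + normc (y - z).
Proof. by rewrite -[x - z](subrKA y); exact: le_normcD. Qed.

Lemma ler_dist_normc (x y : C) : normc x - normc y <= normc (x - y).
Proof. by rewrite lerBlDr -{1}(subrK y x) le_normcD. Qed.

Lemma sqr_normc_Re_Im (z : C) : normc z ^+ 2 = Re z ^+ 2 + Im z ^+ 2.
Proof. by case: z => x y /=; rewrite sqr_sqrtr // addr_ge0 ?sqr_ge0. Qed.

Lemma Re_le_normc (z : C) : `|Re z| <= normc z.
Proof.
rewrite -(ler_pXn2r (ltn0Sn 1)) ?nnegrE ?normc_ge0 //.
by rewrite real_normK ?num_real // sqr_normc_Re_Im lerDl sqr_ge0.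
Qed.

Lemma Im_le_normc (z : C) : `|Im z| <= normc z.
Proof.
rewrite -(ler_pXn2r (ltn0Sn 1)) ?nnegrE ?normc_ge0 //.
by rewrite real_normK ?num_real // sqr_normc_Re_Im lerDr sqr_ge0.
Qed.

Lemma normc_le_Re_Im (z : C) : normc z <= `|Re z| + `|Im z|.
Proof.
rewrite -(ler_pXn2r (ltn0Sn 1)) ?nnegrE ?normc_ge0 ?addr_ge0 //.
rewrite sqr_normc_Re_Im sqrrD !real_normK ?num_real //.
have : 0 <= `|Re z| * `|Im z| by rewrite mulr_ge0.
lra.
Qed.

Lemma normc_real (x : R) : normc x%:C = `|x|.
Proof. by rewrite /= expr0n addr0 sqrtr_sqr. Qed.

Lemma ReB (z w : C) : Re (z - w) = Re z - Re w. Proof. by case: z; case: w. Qed.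
Lemma ImB (z w : C) : Im (z - w) = Im z - Im w. Proof. by case: z; case: w. Qed.
Lemma ReD (z w : C) : Re (z + w) = Re z + Re w. Proof. by case: z; case: w. Qed.
Lemma ImD (z w : C) : Im (z + w) = Im z + Im w. Proof. by case: z; case: w. Qed.
Lemma ReZ (x : R) (z : C) : Re (x%:C * z) = x * Re z.
Proof. by case: z => a b /=; rewrite mul0r subr0. Qed.
Lemma ImZ (x : R) (z : C) : Im (x%:C * z) = x * Im z.
Proof. by case: z => a b /=; rewrite mul0r addr0. Qed.

(** Balls of [R[i]] have radii in [R[i]]; a positive complex number is real, so real radii and
    [normc] suffice. *)
Lemma cvg_normc (T : Type) (F : set_system T) (FF : Filter F) (f : T -> C) (z : C) :
  f @ F --> z <->
  forall e : R, 0 < e -> \forall x \near F, normc (f x - z) < e.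
Proof.
split=> [/cvgrPdist_lt h e e0|h].
  have := h e%:C; rewrite ltcR => /(_ e0); apply: filterS => x.
  by rewrite norm_normc ltcR normcB.
apply/cvgrPdist_lt => -[e e']; rewrite ltcE /= => /andP[/eqP -> e0].
move: (h e e0); apply: filterS => x.
by rewrite norm_normc ltcR normcB.
Qed.

Lemma nbhs_normc (z : C) (A : set C) :
  nbhs z A <-> exists2 e : R, 0 < e & forall w, normc (w - z) < e -> A w.
Proof.
split=> [zA|[e e0 h]].
  have /nbhs_ballP[[e e'] /= e0 h] := zA.
  move: e0; rewrite ltcE /= => /andP[/eqP e'0 e0].
  exists e => // w wz; apply: h; rewrite -ball_normE /= norm_normc.
  by rewrite normcB ltcE /= e'0 eqxx.
have /cvg_normc/(_ e e0) : id @ nbhs z --> z by apply: cvg_id.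
by apply: filterS => w; exact: h.
Qed.

Lemma continuous_normcP (T : topologicalType) (f : T -> C) :
  continuous f <->
  forall x (e : R), 0 < e -> \forall y \near x, normc (f y - f x) < e.
Proof.
by split=> h x; [move: (h x) => /cvg_normc|apply/cvg_normc; apply: h].
Qed.

Lemma continuous_disc (f : C -> R) :
  (forall z (e : R), 0 < e -> exists2 d : R, 0 < d &
     forall w, normc (w - z) < d -> `|f w - f z| < e) -> continuous f.
Proof.
move=> h z A /nbhs_ballP[e /= e0 eA].
have [d d0 hd] := h z e e0.
apply/nbhs_normc; exists d => // w wz; apply: eA.
by rewrite /ball /= distrC hd.
Qed.

Lemma Re_continuous : continuous (@complex.Re R).
Proof.
apply: continuous_disc => z e e0; exists e => // w wz.
by rewrite -ReB (le_lt_trans (Re_le_normc _)).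
Qed.

Lemma Im_continuous : continuous (@complex.Im R).
Proof.
apply: continuous_disc => z e e0; exists e => // w wz.
by rewrite -ImB (le_lt_trans (Im_le_normc _)).
Qed.

Lemma normc_continuous : continuous (@normc R).
Proof.
apply: continuous_disc => z e e0; exists e => // w wz.
rewrite ltr_norml (le_lt_trans (ler_dist_normc _ _)) // andbT.
by rewrite ltrNl opprB (le_lt_trans (ler_dist_normc _ _)) // normcB.
Qed.

Lemma cvg_complex (T : Type) (F : set_system T) (FF : Filter F) (f g : T -> R) (x y : R) :
  f @ F --> x -> g @ F --> y -> (f t +i* g t) @[t --> F] --> (x +i* y).
Proof.
move=> /cvgrPdist_lt fx /cvgrPdist_lt gy; apply/cvg_normc => e e0.
have e2 : 0 < e / 2 by rewrite divr_gt0.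
move: (fx _ e2) (gy _ e2); apply: filterS2 => t ft gt.
rewrite (le_lt_trans (normc_le_Re_Im _)) // (splitr e) ReB ImB /= ltrD //.
  by rewrite distrC.
by rewrite distrC.
Qed.

Lemma continuous_complex (T : topologicalType) (f g : T -> R) :
  continuous f -> continuous g -> continuous (fun t => f t +i* g t).
Proof. by move=> cf cg t; apply: cvg_complex; [exact: cf|exact: cg]. Qed.

Lemma continuous_comp_fun (S T U : topologicalType) (f : S -> T) (g : T -> U) :
  continuous f -> continuous g -> continuous (fun x => g (f x)).
Proof. by move=> cf cg x; apply: (@continuous_comp _ _ _ f g x); [exact: cf|exact: cg]. Qed.

Lemma continuous_pair (S T U : topologicalType) (f : S -> T) (g : S -> U) :
  continuous f -> continuous g -> continuous (fun x => (f x, g x)).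
Proof. by move=> cf cg x; apply: cvg_pair; [exact: cf|exact: cg]. Qed.

Lemma continuous_fst (T U : topologicalType) : continuous (fun x : T * U => x.1).
Proof. by move=> x; apply: cvg_fst. Qed.

Lemma continuous_snd (T U : topologicalType) : continuous (fun x : T * U => x.2).
Proof. by move=> x; apply: cvg_snd. Qed.

Lemma continuous_funD (K : numFieldType) (V : normedModType K) (T : topologicalType)
    (f g : T -> V) :
  continuous f -> continuous g -> continuous (fun x => f x + g x).
Proof. by move=> cf cg x; apply: cvgD; [exact: cf|exact: cg]. Qed.

Lemma continuous_funN (K : numFieldType) (V : normedModType K) (T : topologicalType)
    (f : T -> V) :
  continuous f -> continuous (fun x => - f x).
Proof. by move=> cf x; apply: cvgN; exact: cf. Qed.

Lemma continuous_funM (K : numFieldType) (T : topologicalType) (f g : T -> K) :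
  continuous f -> continuous g -> continuous (fun x => f x * g x).
Proof. by move=> cf cg x; apply: cvgM; [exact: cf|exact: cg]. Qed.

Lemma continuous_funV (K : numFieldType) (T : topologicalType) (f : T -> K) :
  (forall x, f x != 0) -> continuous f -> continuous (fun x => (f x)^-1).
Proof. by move=> f0 cf x; apply: cvgV; [exact: f0|exact: cf]. Qed.

Lemma continuous_addc (T : topologicalType) (f g : T -> C) :
  continuous f -> continuous g -> continuous (fun x => f x + g x).
Proof. exact: (@continuous_funD C C). Qed.

Lemma continuous_subc (T : topologicalType) (f g : T -> C) :
  continuous f -> continuous g -> continuous (fun x => f x - g x).
Proof. by move=> cf cg; exact: (continuous_addc cf (@continuous_funN C C _ _ cg)). Qed.

Lemma continuous_mulc (T : topologicalType) (f g : T -> C) :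
  continuous f -> continuous g -> continuous (fun x => f x * g x).
Proof. exact: (@continuous_funM C). Qed.

Lemma continuous_idfun (T : topologicalType) : continuous (fun x : T => x).
Proof. by move=> x; exact: cvg_id. Qed.

Lemma near_lt (T : topologicalType) (f : T -> R) (x : T) (c : R) :
  {for x, continuous f} -> f x < c -> \forall y \near x, f y < c.
Proof. move=> cf fc; exact: (@cvgr_lt _ _ _ _ f (f x) cf c fc). Qed.

Lemma near_gt (T : topologicalType) (f : T -> R) (x : T) (c : R) :
  {for x, continuous f} -> c < f x -> \forall y \near x, c < f y.
Proof. move=> cf fc; exact: (@cvgr_gt _ _ _ _ f (f x) cf c fc). Qed.

Lemma continuous_funmax (T : topologicalType) (f g : T -> R) :
  continuous f -> continuous g -> continuous (fun x => Num.max (f x) (g x)).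
Proof.
move=> cf cg.
have -> : (fun x => Num.max (f x) (g x)) = (fun x => (f x + g x + `|f x - g x|) / 2).
  by apply/funext => x; rewrite maxr_absE.
apply: continuous_funM; last exact: cst_continuous.
apply: continuous_funD; first exact: continuous_funD.
apply: (@continuous_comp_fun _ _ _ (fun x => f x - g x) (fun y : R => `|y|)).
  by apply: continuous_funD => //; apply: continuous_funN.
exact: norm_continuous.
Qed.

Lemma continuous_funmin (T : topologicalType) (f g : T -> R) :
  continuous f -> continuous g -> continuous (fun x => Num.min (f x) (g x)).
Proof.
move=> cf cg.
have -> : (fun x => Num.min (f x) (g x)) = (fun x => - Num.max (- f x) (- g x)).
  by apply/funext => x; rewrite oppr_max !opprK.
by apply: continuous_funN; apply: continuous_funmax; apply: continuous_funN.
Qed.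

Lemma continuous_real_complex : continuous (fun x : R => x%:C).
Proof. by apply: continuous_complex; [move=> x; exact: cvg_id|exact: cst_continuous]. Qed.

(** Gluing of two maps that agree on the closed set [a x = b x]; the basis of all concatenations. *)
Lemma continuous_if_le (S T : topologicalType) (f g : S -> T) (a b : S -> R) :
  continuous f -> continuous g -> continuous a -> continuous b ->
  (forall x, a x = b x -> f x = g x) ->
  continuous (fun x => if a x <= b x then f x else g x).
Proof.
move=> cf cg ca cb fg x.
have cab : continuous (fun x => b x - a x).
  by apply: continuous_funD => //; apply: continuous_funN.
have [ab|ba|e] := ltgtP (a x) (b x).
- have h : \forall y \near x, 0 < b y - a y.
    by apply: (cvgr_gt (b x - a x)); rewrite ?subr_gt0 //; exact: cab.
  move=> A hA; have hA' : nbhs (f x) A by move: hA; rewrite /= (ltW ab).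
  have hf : \forall y \near x, A (f y) by exact: cf hA'.
  rewrite /nbhs /=.
  by apply: filterS2 h hf => y /=; rewrite subr_gt0 => /ltW ->.
- have h : \forall y \near x, b y - a y < 0.
    by apply: (cvgr_lt (b x - a x)); rewrite ?subr_lt0 //; exact: cab.
  move=> A hA; have hA' : nbhs (g x) A by move: hA; rewrite /= leNgt ba.
  have hf : \forall y \near x, A (g y) by exact: cg hA'.
  rewrite /nbhs /=.
  by apply: filterS2 h hf => y /=; rewrite subr_lt0 leNgt => ->.
- move=> A hA; have h1 : nbhs (f x) A by move: hA; rewrite /= e lexx.
  have h2 : nbhs (g x) A by rewrite -fg.
  have hf : \forall y \near x, A (f y) by exact: cf h1.
  have hg : \forall y \near x, A (g y) by exact: cg h2.
  rewrite /nbhs /=.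
  by apply: filterS2 hf hg => y /=; case: ifP.
Qed.

(** Retraction of the line onto the unit interval. Composing with it turns continuity on the
    interval into global continuity, so that homotopies need no subspace topology. *)
Definition clamp (t : R) : R := Num.max 0 (Num.min 1 t).

Lemma clamp_continuous : continuous clamp.
Proof.
apply: continuous_funmax; first exact: cst_continuous.
by apply: continuous_funmin; [exact: cst_continuous|move=> x; exact: cvg_id].
Qed.

Lemma clamp_itv t : 0 <= clamp t <= 1.
Proof. by rewrite /clamp le_max lexx /= ge_max ler01 ge_min lexx. Qed.

Lemma clamp_id t : 0 <= t <= 1 -> clamp t = t.
Proof. by move=> /andP[t0 t1]; rewrite /clamp (min_idPr t1); exact/max_idPr. Qed.

Lemma clamp0 : clamp 0 = 0. Proof. by rewrite clamp_id // lexx ler01. Qed.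
Lemma clamp1 : clamp 1 = 1. Proof. by rewrite clamp_id // lexx ler01. Qed.

Lemma within_comp (S T U : topologicalType) (A : set T) (f : T -> U) (g : S -> T) :
  {within A, continuous f} -> continuous g -> (forall x, A (g x)) ->
  continuous (fun x => f (g x)).
Proof.
move=> /subspace_continuousP cf cg gA x B hB.
have h : \forall y \near g x, A y -> B (f y) by exact: cf (gA x) B hB.
have h' : \forall y \near x, A (g y) -> B (f (g y)) by exact: (cg x _ h).
rewrite /nbhs /=; apply: filterS h' => y; apply; exact: gA.
Qed.

Lemma compact_bounded_above (T : topologicalType) (K : set T) (f : T -> R) :
  compact K -> continuous f -> exists M, forall x, K x -> f x <= M.
Proof.
move=> cK cf.
have /compact_bounded [M [_ hM]] : compact (f @` K).
  by apply: continuous_compact => //; exact: continuous_subspaceT.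
exists (M + 1) => x Kx; apply: le_trans (ler_norm _) _.
by apply: (hM (M + 1)); [rewrite ltrDl|exists x].
Qed.

Lemma compact_min (T : topologicalType) (K : set T) (f : T -> R) :
  compact K -> K !=set0 -> continuous f ->
  exists2 x, K x & forall y, K y -> f x <= f y.
Proof.
move=> cK K0 cf.
have [x Kx h] := compact_EVT_min K0 cK (continuous_subspaceT cf).
by exists x; [exact: set_mem|move=> y Ky; apply: h; exact: mem_set].
Qed.

Lemma compact_closed_disc (M : R) : compact [set z : C | normc z <= M].
Proof.
have c : compact ((fun p : R * R => p.1 +i* p.2) @` (`[- M, M] `*` `[- M, M])).
  apply: continuous_compact.
    apply: continuous_subspaceT; apply: continuous_complex.
      exact: continuous_fst.
    exact: continuous_snd.
  by apply: compact_setX; exact: segment_compact.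
apply: subclosed_compact c _.
  have -> : [set z : C | normc z <= M] = @normc R @^-1` [set x | x <= M] by [].
  by apply: closed_comp; [move=> x _; exact: normc_continuous|exact: closed_le].
move=> z /= zM; exists (Re z, Im z); last by case: z {zM}.
by split; rewrite /= in_itv /= -ler_norml (le_trans _ zM) ?Re_le_normc ?Im_le_normc.
Qed.

Lemma compact_square : compact (`[0, 1] `*` `[0, 1] : set (R * R)).
Proof. by apply: compact_setX; exact: segment_compact. Qed.

Lemma closed_discE (M : R) (K : set C) : compact K -> exists N, forall z, K z -> normc z <= N.
Proof. by move=> cK; apply: compact_bounded_above => //; exact: normc_continuous. Qed.

End ComplexTopology.

(** * Homotopies of paths *)

Section Homotopy.
Context {R : realType} {T : topologicalType}.
Implicit Types (A B : set T) (p q : R -> T).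

(** The endpoints may lie outside [A], because a leg starts at a puncture. *)
Definition is_path A p :=
  continuous (fun t => p (clamp t)) /\ forall t, 0 < t < 1 -> A (p t).

(** A form of [homotopic_in] with [H] continuous on the whole plane of parameters; clamping makes
    the two equivalent ([homotopic_inP]). *)
Definition homot A p q := exists H : R * R -> T,
  [/\ continuous H,
      forall t, 0 <= t <= 1 -> H (0, t) = p t /\ H (1, t) = q t,
      forall u, 0 <= u <= 1 -> H (u, 0) = p 0 /\ H (u, 1) = p 1 &
      forall u t, 0 <= u <= 1 -> 0 < t < 1 -> A (H (u, t))].

Lemma ltW_itv (t : R) : 0 < t < 1 -> 0 <= t <= 1.
Proof. by move=> /andP[/ltW -> /ltW ->]. Qed.

Lemma one_le_half : ((1 : R) <= 2^-1) = false.
Proof. by apply/negP => ?; lra. Qed.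

Lemma two_sub1 : 2 + -1 = 1 :> R.
Proof. by lra. Qed.

Lemma itv0 : 0 <= (0 : R) <= 1. Proof. by rewrite lexx ler01. Qed.
Lemma itv1 : 0 <= (1 : R) <= 1. Proof. by rewrite lexx ler01. Qed.

Lemma homot_ends A p q : homot A p q -> p 0 = q 0 /\ p 1 = q 1.
Proof.
move=> [H [_ h1 h2 _]].
have [<- <-] := h2 1 itv1.
by have [_ <-] := h1 0 itv0; have [_ <-] := h1 1 itv1.
Qed.

Lemma homot_refl A p : is_path A p -> homot A p p.
Proof.
move=> [cp hp]; exists (fun x => p (clamp x.2)); split => //=.
- apply: (@continuous_comp_fun _ _ _ (fun x : R * R => x.2) (fun t => p (clamp t))) => //.
  exact: continuous_snd.
- by move=> t t01; rewrite clamp_id.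
- by move=> u _; rewrite clamp0 clamp1.
- by move=> u t _ t01; rewrite clamp_id ?ltW_itv //; exact: hp.
Qed.

Lemma homot_eq A p q p' q' :
  (forall t, 0 <= t <= 1 -> p t = p' t) -> (forall t, 0 <= t <= 1 -> q t = q' t) ->
  homot A p q -> homot A p' q'.
Proof.
move=> pp' qq' [H [cH h1 h2 h3]]; exists H; split => //.
- by move=> t t01; rewrite -pp' // -qq' //; exact: h1.
- by move=> u u01; rewrite -!pp' ?itv0 ?itv1 //; exact: h2.
Qed.

Lemma homot_path_l A p q : homot A p q -> is_path A p.
Proof.
move=> [H [cH h1 h2 h3]]; split.
  have -> : (fun t => p (clamp t)) = (fun t => H (0, clamp t)).
    by apply/funext => t; have [-> _] := h1 _ (clamp_itv t).
  apply: (@continuous_comp_fun _ _ _ (fun t => (0, clamp t)) H) => //.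
  by apply: continuous_pair; [exact: cst_continuous|exact: clamp_continuous].
move=> t t01; have [<- _] := h1 _ (ltW_itv t01).
by apply: h3 => //; exact: itv0.
Qed.

Lemma homot_sym A p q : homot A p q -> homot A q p.
Proof.
move=> h; have [e0 e1] := homot_ends h.
case: h => [H [cH h1 h2 h3]].
have itvB (u : R) : 0 <= u <= 1 -> 0 <= 1 - u <= 1.
  by move=> /andP[a b]; rewrite subr_ge0 b gerBl.
exists (fun x => H (1 - x.1, x.2)); split => /=.
- apply: (@continuous_comp_fun _ _ _ (fun x : R * R => (1 - x.1, x.2)) H) => //.
  apply: continuous_pair; last exact: continuous_snd.
  apply: continuous_funD; first exact: cst_continuous.
  by apply: continuous_funN; exact: continuous_fst.
- by move=> t t01; rewrite subr0 subrr; have [-> ->] := h1 _ t01.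
- by move=> u u01; rewrite -e0 -e1; apply: h2; exact: itvB.
- by move=> u t u01 t01; apply: h3 => //; exact: itvB.
Qed.

Lemma homot_path_r A p q : homot A p q -> is_path A q.
Proof. by move=> /homot_sym /homot_path_l. Qed.

Lemma continuous_clamp2 (k l : R) (H : R * R -> T) :
  continuous H -> continuous (fun x : R * R => H (clamp (k * x.1 + l), clamp x.2)).
Proof.
move=> cH.
apply: (@continuous_comp_fun _ _ _ (fun x : R * R => (clamp (k * x.1 + l), clamp x.2)) H) => //.
apply: continuous_pair.
  apply: (@continuous_comp_fun _ _ _ (fun x : R * R => k * x.1 + l)).
    apply: continuous_funD; last exact: cst_continuous.
    by apply: continuous_funM; [exact: cst_continuous|exact: continuous_fst].
  exact: clamp_continuous.
apply: (@continuous_comp_fun _ _ _ (fun x : R * R => x.2)).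
  exact: continuous_snd.
exact: clamp_continuous.
Qed.

Lemma homot_trans A p q r : homot A p q -> homot A q r -> homot A p r.
Proof.
move=> h; have [e0 e1] := homot_ends h.
case: h => [H [cH h1 h2 h3]] [K [cK k1 k2 k3]].
exists (fun x => if x.1 <= 2^-1 then H (clamp (2 * x.1 + 0), clamp x.2)
                 else K (clamp (2 * x.1 + (- 1)), clamp x.2)); split => /=.
- apply: continuous_if_le.
  + exact: continuous_clamp2.
  + exact: continuous_clamp2.
  + exact: continuous_fst.
  + exact: cst_continuous.
  + move=> x ->; rewrite divff ?pnatr_eq0 // addr0 subrr clamp0 clamp1.
    by have [_ ->] := h1 _ (clamp_itv x.2); have [-> _] := k1 _ (clamp_itv x.2).
- move=> t t01; rewrite !mulr0 addr0 clamp0 invr_ge0 ler0n.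
  rewrite one_le_half mulr1 two_sub1 clamp1 !clamp_id //.
  by have [-> _] := h1 _ t01; have [_ ->] := k1 _ t01.
- move=> u u01; rewrite clamp0 clamp1.
  have [a1 a2] := h2 _ (clamp_itv (2 * u + 0)).
  have [b1 b2] := k2 _ (clamp_itv (2 * u + -1)).
  by case: ifP => _; rewrite ?a1 ?a2 ?b1 ?b2 ?e0 ?e1.
- move=> u t u01 t01; case: ifP => _.
    by apply: h3; [exact: clamp_itv|rewrite clamp_id ?ltW_itv].
  by apply: k3; [exact: clamp_itv|rewrite clamp_id ?ltW_itv].
Qed.

Lemma homot_subset A B p q : A `<=` B -> homot A p q -> homot B p q.
Proof. by move=> AB [H [? ? ? h]]; exists H; split => // u t *; apply: AB; exact: h. Qed.

Lemma is_path_eq A p q : (forall t, 0 <= t <= 1 -> p t = q t) -> is_path A p -> is_path A q.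
Proof. by move=> pq /homot_refl h; apply: (@homot_path_l A q q); apply: homot_eq h. Qed.

Lemma homot_of_eq A p q : (forall t, 0 <= t <= 1 -> p t = q t) -> is_path A p -> homot A p q.
Proof. by move=> pq /homot_refl; apply: homot_eq. Qed.

Lemma continuous_interp (S : topologicalType) (f g h : S -> R) :
  continuous f -> continuous g -> continuous h ->
  continuous (fun x => (1 - f x) * g x + f x * h x).
Proof.
move=> cf cg ch; apply: continuous_funD; apply: continuous_funM => //.
by apply: continuous_funD; [exact: cst_continuous|exact: continuous_funN].
Qed.

Lemma itv_interp (u x y : R) : 0 <= u <= 1 -> 0 <= x <= 1 -> 0 <= y <= 1 ->
  0 <= (1 - u) * x + u * y <= 1.
Proof. by move=> /andP[? ?] /andP[? ?] /andP[? ?]; apply/andP; split; nra. Qed.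

Lemma itvo_interp (u x y : R) : 0 <= u <= 1 -> 0 < x < 1 -> 0 < y < 1 ->
  0 < (1 - u) * x + u * y < 1.
Proof.
move=> /andP[u0 u1] /andP[x0 x1] /andP[y0 y1].
apply/andP; split.
  have [->|/eqP u10] := eqVneq u 1; first by rewrite subrr mul0r add0r mul1r.
  have : 0 < (1 - u) * x by rewrite mulr_gt0 // subr_gt0 lt_neqAle u1 andbT; apply/eqP.
  have : 0 <= u * y by rewrite mulr_ge0 // ltW.
  lra.
have [->|/eqP u10] := eqVneq u 1; first by rewrite subrr mul0r add0r mul1r.
have : 0 < (1 - u) * (1 - x) by rewrite mulr_gt0 ?subr_gt0 // lt_neqAle u1 andbT; apply/eqP.
have : 0 <= u * (1 - y) by rewrite mulr_ge0 // subr_ge0 ltW.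
lra.
Qed.

(* Two parameter paths into a convex parameter domain are homotopic by linear
   interpolation; almost every homotopy below is an instance of this. *)
Lemma homot_interp2 A (Q : R * R -> T) (a1 a2 b1 b2 : R -> R) :
  continuous Q -> continuous a1 -> continuous a2 -> continuous b1 -> continuous b2 ->
  let I u t := ((1 - u) * a1 t + u * b1 t, (1 - u) * a2 t + u * b2 t) in
  (forall u, 0 <= u <= 1 -> Q (I u 0) = Q (a1 0, a2 0) /\ Q (I u 1) = Q (a1 1, a2 1)) ->
  (forall u t, 0 <= u <= 1 -> 0 < t < 1 -> A (Q (I u t))) ->
  homot A (fun t => Q (a1 t, a2 t)) (fun t => Q (b1 t, b2 t)).
Proof.
move=> cQ ca1 ca2 cb1 cb2 I hI hA.
have cS (f : R -> R) : continuous f -> continuous (fun x : R * R => f x.2).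
  by move=> cf; apply: (@continuous_comp_fun _ _ _ (fun x : R * R => x.2) f) => //; exact: continuous_snd.
exists (fun x => Q (I x.1 x.2)); split => //=.
- apply: (@continuous_comp_fun _ _ _ (fun x : R * R => I x.1 x.2) Q) => //.
  by apply: continuous_pair; apply: continuous_interp; (try exact: continuous_fst); exact: cS.
- by move=> t t01; rewrite /I !subr0 !mul1r !mul0r !addr0 !subrr !mul0r !add0r ?mul1r.
Qed.

(** Two reparametrizations of a single path: the source of the laws of associativity, unit and
    inverse below. *)
Lemma homot_interp A p (a b : R -> R) :
  continuous (fun t => p (clamp t)) -> continuous a -> continuous b ->
  (forall t, 0 <= t <= 1 -> 0 <= a t <= 1 /\ 0 <= b t <= 1) ->
  a 0 = b 0 -> a 1 = b 1 ->
  (forall u t, 0 <= u <= 1 -> 0 < t < 1 -> A (p ((1 - u) * a t + u * b t))) ->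
  homot A (fun t => p (a t)) (fun t => p (b t)).
Proof.
move=> cp ca cb ab ab0 ab1 hA.
have e u x : (1 - u) * x + u * x = x :> R by rewrite -mulrDl subrK mul1r.
have ci u t : 0 <= u <= 1 -> 0 <= t <= 1 -> 0 <= (1 - u) * a t + u * b t <= 1.
  by move=> u01 t01; have [? ?] := ab _ t01; exact: itv_interp.
have := @homot_interp2 A (fun x => p (clamp x.1)) a a b b.
have cQ : continuous (fun x : R * R => p (clamp x.1)).
  apply: (@continuous_comp_fun _ _ _ (fun x : R * R => x.1) (fun t => p (clamp t))) => //.
  exact: continuous_fst.
move=> /(_ cQ ca ca cb cb) /= h.
apply: (@homot_eq A (fun t => p (clamp (a t))) (fun t => p (clamp (b t)))).
- by move=> t /ab[at01 _] /=; rewrite clamp_id.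
- by move=> t /ab[_ bt01] /=; rewrite clamp_id.
- apply: h.
    by move=> u u01; rewrite ab0 ab1 !e.
  by move=> u t u01 t01; rewrite clamp_id; [exact: hA|exact/ci/ltW_itv].
Qed.

End Homotopy.

(** The set [B] is where [F] is under control, for instance the half-plane with infinity for the
    retraction used later; it also contains the endpoints, which may lie outside [A]. *)
Lemma homot_map {R : realType} {T T' : topologicalType} (A B : set T) (A' : set T')
    (F : T -> T') (p q : R -> T) :
  {within B, continuous F} -> A `<=` B -> B (p 0) -> B (p 1) ->
  (forall x, A x -> A' (F x)) -> homot A p q -> homot A' (F \o p) (F \o q).
Proof.
move=> cF AB B0 B1 FA [H [cH h1 h2 h3]].
exists (fun x => F (H (clamp x.1, clamp x.2))); split => /=.
- apply: (@within_comp _ _ _ B F (fun x => H (clamp x.1, clamp x.2))) => //.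
    have := @continuous_clamp2 R T 1 0 H cH.
    by under [X in continuous X -> _]eq_fun do rewrite mul1r addr0.
  move=> [u t] /=; have u01 := clamp_itv u; have := clamp_itv t.
  move: (clamp u) u01 (clamp t) => {u}u u01 {}t /andP[t0 t1].
  have [/eqP ->|tn0] := boolP (t == 0); first by have [-> _] := h2 _ u01.
  have [/eqP ->|tn1] := boolP (t == 1); first by have [_ ->] := h2 _ u01.
  by apply: AB; apply: h3 => //; rewrite !lt_neqAle t0 t1 tn1 eq_sym tn0.
- move=> t t01; rewrite clamp0 clamp1 clamp_id //.
  by have [-> ->] := h1 _ t01.
- move=> u u01; rewrite clamp0 clamp1.
  by have [-> ->] := h2 _ (clamp_itv u).
- move=> u t u01 t01; apply: FA; apply: h3; first exact: clamp_itv.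
  by rewrite clamp_id ?ltW_itv.
Qed.

(* [lra] fails on contexts containing equations between points of the sphere. *)
Ltac drop_sphere_eqs := repeat match goal with
  H : @eq (one_point_compactification _) _ _ |- _ => clear H end.
Ltac slra := drop_sphere_eqs; lra.
Ltac snra := drop_sphere_eqs; nra.

(** * Groupoid laws for concatenation of paths *)

Section PathAlgebra.
Context {R : realType}.
Implicit Types (A : set (sphere R)) (p q r : R -> sphere R).

(** The common endpoint becomes an interior point of the concatenation; hence the condition
    [A (p 1)]. *)
Lemma cat_hom A p p' q q' : homot A p p' -> homot A q q' -> p 1 = q 0 -> A (p 1) ->
  homot A (path_cat p q) (path_cat p' q').
Proof.
move=> [H [cH h1 h2 h3]] [K [cK k1 k2 k3]] pq Ap.
exists (fun x => if x.2 <= 2^-1 then H (clamp x.1, clamp (2 * x.2))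
                 else K (clamp x.1, clamp (2 * x.2 - 1))).
have cc (f : R -> R) (L : R * R -> sphere R) : continuous f -> continuous L ->
    continuous (fun x : R * R => L (clamp x.1, clamp (f x.2))).
  move=> cf cL.
  apply: (@continuous_comp_fun _ _ _ (fun x : R * R => (clamp x.1, clamp (f x.2))) L) => //.
  apply: continuous_pair.
    apply: (@continuous_comp_fun _ _ _ (fun x : R * R => x.1) clamp); first exact: continuous_fst.
    exact: clamp_continuous.
  apply: (@continuous_comp_fun _ _ _ (fun x : R * R => x.2) (fun y => clamp (f y))).
    exact: continuous_snd.
  by apply: (@continuous_comp_fun _ _ _ f clamp) => //; exact: clamp_continuous.
have cm : continuous (fun t : R => 2 * t).
  by apply: continuous_funM; [exact: cst_continuous|move=> x; exact: cvg_id].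
split => /=.
- apply: continuous_if_le.
  + by apply: (cc (fun t => 2 * t)).
  + apply: (cc (fun t => 2 * t - 1)) => //.
    by apply: continuous_funD => //; exact: cst_continuous.
  + exact: continuous_snd.
  + exact: cst_continuous.
  + move=> x ->; rewrite divff ?pnatr_eq0 // subrr clamp0 clamp1.
    have [_ ->] := h2 _ (clamp_itv x.1).
    by have [-> _] := k2 _ (clamp_itv x.1).
- move=> t /andP[t0 t1]; rewrite clamp0 clamp1 /path_cat; case: leP => tle.
    by rewrite clamp_id; [apply: h1|]; apply/andP; split; slra.
  by rewrite clamp_id; [apply: k1|]; apply/andP; split; slra.
- move=> u u01; rewrite /path_cat !mulr0 !mulr1 clamp0 invr_ge0 ler0n one_le_half.
  rewrite two_sub1 clamp1.
  by have [-> _] := h2 _ (clamp_itv u); have [_ ->] := k2 _ (clamp_itv u).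
- move=> u t u01 /andP[t0 t1]; rewrite clamp_id //; case: leP => tle.
    rewrite clamp_id; last by apply/andP; split; slra.
    have [->|t2] := eqVneq (2 * t) 1; first by have [_ ->] := h2 _ u01.
    apply: h3 => //; apply/andP; split; first slra.
    by rewrite lt_neqAle t2; slra.
  by rewrite clamp_id; [apply: k3 => //|]; apply/andP; split; slra.
Qed.

Lemma is_path_cat A p q : is_path A p -> is_path A q -> p 1 = q 0 -> A (p 1) ->
  is_path A (path_cat p q).
Proof.
by move=> /homot_refl hp /homot_refl hq e Ap; apply: homot_path_l (cat_hom hp hq e Ap).
Qed.

Lemma path_cat0 p q : path_cat p q 0 = p 0.
Proof. by rewrite /path_cat invr_ge0 ler0n mulr0. Qed.

Lemma path_cat1 p q : path_cat p q 1 = q 1.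
Proof. by rewrite /path_cat one_le_half mulr1 two_sub1. Qed.

Lemma path_rev0 p : path_rev p 0 = p 1. Proof. by rewrite /path_rev subr0. Qed.
Lemma path_rev1 p : path_rev p 1 = p 0. Proof. by rewrite /path_rev subrr. Qed.
Lemma path_revK p : path_rev (path_rev p) = p.
Proof. by apply/funext => t; rewrite /path_rev subKr. Qed.

Lemma rev_hom A p q : homot A p q -> homot A (path_rev p) (path_rev q).
Proof.
move=> h; have [e0 e1] := homot_ends h; case: h => [H [cH h1 h2 h3]].
exists (fun x => H (x.1, 1 - x.2)); split => /=.
- apply: (@continuous_comp_fun _ _ _ (fun x : R * R => (x.1, 1 - x.2)) H) => //.
  apply: continuous_pair; first exact: continuous_fst.
  apply: continuous_funD; first exact: cst_continuous.
  by apply: continuous_funN; exact: continuous_snd.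
- by move=> t /andP[? ?]; apply: h1; apply/andP; split; slra.
- by move=> u u01; rewrite path_rev0 path_rev1 subr0 subrr; have [-> ->] := h2 _ u01.
- by move=> u t u01 /andP[? ?]; apply: h3 => //; apply/andP; split; slra.
Qed.

Lemma is_path_rev A p : is_path A p -> is_path A (path_rev p).
Proof. by move=> /homot_refl /rev_hom /homot_path_l. Qed.

Lemma continuous_scale (k l : R) : continuous (fun t : R => k * t + l).
Proof.
apply: continuous_funD; last exact: cst_continuous.
by apply: continuous_funM; [exact: cst_continuous|move=> x; exact: cvg_id].
Qed.

Lemma cat_assoc A p q r : is_path A p -> is_path A q -> is_path A r ->
  p 1 = q 0 -> q 1 = r 0 -> A (p 1) -> A (q 1) ->
  homot A (path_cat (path_cat p q) r) (path_cat p (path_cat q r)).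
Proof.
move=> pp pq pr e1 e2 A1 A2.
have P : is_path A (path_cat p (path_cat q r)).
  apply: is_path_cat => //; first exact: is_path_cat.
  by rewrite path_cat0.
(* The piecewise linear change of parameter, with slopes 2, 1 and 1/2, from one bracketing to the
   other; being concave, it is a minimum of affine maps. *)
pose th (t : R) := Num.min (2 * t + 0) (Num.min (1 * t + 4^-1) (2^-1 * t + 2^-1)).
have th1 t : t <= 4^-1 -> th t = 2 * t.
  move=> t4; rewrite /th [Num.min (1 * _ + _) _]min_l; last slra.
  by rewrite min_l; slra.
have th2 t : 4^-1 <= t -> t <= 2^-1 -> th t = t + 4^-1.
  move=> t4 t2; rewrite /th [Num.min (1 * _ + _) _]min_l; last slra.
  by rewrite min_r; slra.
have th3 t : 2^-1 <= t -> th t = (t + 1) / 2.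
  move=> t2; rewrite /th [Num.min (1 * _ + _) _]min_r; last slra.
  by rewrite min_r; slra.
have cth : continuous th.
  exact: (continuous_funmin (@continuous_scale 2 0)
    (continuous_funmin (@continuous_scale 1 4^-1) (@continuous_scale 2^-1 2^-1))).
have th01 t : 0 <= t <= 1 -> 0 <= th t <= 1.
  move=> /andP[t0 t1]; have [t4|t4] := leP t 4^-1.
    by rewrite th1 //; apply/andP; split; slra.
  have [t2|t2] := leP t 2^-1; last by rewrite (th3 _ (ltW t2)); apply/andP; split; slra.
  by rewrite (th2 _ (ltW t4) t2); apply/andP; split; slra.
have th01' t : 0 < t < 1 -> 0 < th t < 1.
  move=> /andP[t0 t1]; have [t4|t4] := leP t 4^-1.
    by rewrite th1 //; apply/andP; split; slra.
  have [t2|t2] := leP t 2^-1; last by rewrite (th3 _ (ltW t2)); apply/andP; split; slra.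
  by rewrite (th2 _ (ltW t4) t2); apply/andP; split; slra.
apply: (@homot_eq _ _ _ (fun t => path_cat p (path_cat q r) (th t))
                  (fun t => path_cat p (path_cat q r) t)) => //.
  move=> t /andP[t0 t1]; rewrite /path_cat.
  have [t4|t4] := leP t 4^-1.
    rewrite th1 //; have -> : t <= 2^-1 by slra.
    by have -> : 2 * t <= 2^-1 by slra.
  have [t2|t2] := leP t 2^-1.
    rewrite (th2 _ (ltW t4) t2).
    have -> : (t + 4^-1 <= 2^-1) = false by apply/negP => ?; slra.
    have -> : (2 * t <= 2^-1) = false by apply/negP => ?; slra.
    have -> : 2 * (t + 4^-1) - 1 <= 2^-1 by slra.
    by congr q; slra.
  rewrite (th3 _ (ltW t2)).
  have -> : ((t + 1) / 2 <= 2^-1) = false by apply/negP => ?; slra.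
  have -> : (2 * ((t + 1) / 2) - 1 <= 2^-1) = false by apply/negP => ?; slra.
  by congr r; slra.
apply: homot_interp => //.
- by case: P.
- by move=> x; exact: cvg_id.
- by move=> t t01; split => //; exact: th01.
- by rewrite th1 ?mulr0 // invr_ge0 ler0n.
- by rewrite th3; slra.
- move=> u t u01 t01; apply P.2.
  by apply: itvo_interp => //; exact: th01'.
Qed.

Lemma cat_cst_r A p : is_path A p -> A (p 1) -> homot A (path_cat p (fun=> p 1)) p.
Proof.
move=> [cp hp] A1.
apply: (@homot_eq _ _ _ (fun t => p (Num.min (2 * t + 0) 1)) (fun t => p t)) => //.
  move=> t /andP[t0 t1]; rewrite /path_cat addr0; case: leP => t2.
    by rewrite min_l //; slra.
  by rewrite min_r //; slra.
apply: homot_interp => //.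
- by apply: continuous_funmin; [exact: continuous_scale|exact: cst_continuous].
- by move=> x; exact: cvg_id.
- move=> t t01; split => //; have /andP[? ?] := t01.
  by rewrite le_min ge_min ler01 lexx orbT !andbT; slra.
- by rewrite mulr0 addr0 min_l.
- by rewrite mulr1 addr0 min_r // ler1n.
- move=> u t u01 t01; have [-> //|n1] := eqVneq ((1 - u) * Num.min (2 * t + 0) 1 + u * t) 1.
  apply: hp; have [/andP[? ?] /andP[? ?]] := (t01, u01).
  have m0 : 0 < Num.min (2 * t + 0) 1 by rewrite lt_min ltr01 andbT; slra.
  have m1 : Num.min (2 * t + 0) 1 <= 1 by rewrite ge_min lexx orbT.
  rewrite [X in _ && X]lt_neqAle n1 /=; apply/andP; split; snra.
Qed.

Lemma path_rev_cat p q : p 1 = q 0 -> forall t,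
  path_rev (path_cat p q) t = path_cat (path_rev q) (path_rev p) t.
Proof.
move=> e t; rewrite /path_rev /path_cat.
have [t2|t2] := leP (1 - t) 2^-1; have [t2'|t2'] := leP t 2^-1.
- have -> : t = 2^-1 by slra.
  have -> : 2 * (1 - 2^-1) = 1 :> R by slra.
  by have -> : 1 - 2 * 2^-1 = 0 :> R by slra.
- by congr p; slra.
- by congr q; slra.
- exfalso; slra.
Qed.

Lemma cat_cst_l A p : is_path A p -> A (p 0) -> homot A (path_cat (fun=> p 0) p) p.
Proof.
move=> pp A0.
have /(_ _)/rev_hom := @cat_cst_r A (path_rev p) (is_path_rev pp).
rewrite path_rev1 path_revK => /(_ A0); apply: homot_eq => // t _.
by rewrite path_rev_cat ?path_rev1 // path_revK.
Qed.

Lemma cat_rev_r A p : is_path A p -> A (p 0) -> A (p 1) ->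
  homot A (path_cat p (path_rev p)) (fun=> p 0).
Proof.
move=> [cp hp] A0 A1.
have Ap x : 0 <= x <= 1 -> A (p x).
  move=> /andP[x0 x1].
  have [->//|xn0] := eqVneq x 0; have [->//|xn1] := eqVneq x 1.
  by apply: hp; rewrite !lt_neqAle x0 x1 xn1 eq_sym xn0.
have th01 (t : R) : 0 <= t <= 1 -> 0 <= Num.min (2 * t + 0) (- 2 * t + 2) <= 1.
  move=> /andP[? ?]; rewrite le_min ge_min; apply/andP; split.
    by apply/andP; split; slra.
  by apply/orP; have [?|?] := leP t 2^-1; [left|right]; slra.
(* Going along [p] and back is [p] composed with a tent function, which shrinks linearly to 0. *)
apply: (@homot_eq _ _ _ (fun t => p (Num.min (2 * t + 0) (- 2 * t + 2))) (fun t => p 0)) => //.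
  move=> t /andP[t0 t1]; rewrite /path_cat /path_rev; case: leP => t2.
    by rewrite min_l; [rewrite addr0|slra].
  by rewrite min_r; [congr p|]; slra.
apply: (@homot_interp _ _ _ p _ (fun=> 0)) => //.
- by apply: continuous_funmin; exact: continuous_scale.
- exact: cst_continuous.
- by move=> t t01; split; [exact: th01|exact: itv0].
- by rewrite mulr0 addr0 min_l // mulr0 add0r ler0n.
- by rewrite min_r; slra.
- by move=> u t u01 t01; apply: Ap; apply: itv_interp => //; [exact/th01/ltW_itv|exact: itv0].
Qed.

Lemma cat_rev_l A p : is_path A p -> A (p 0) -> A (p 1) ->
  homot A (path_cat (path_rev p) p) (fun=> p 1).
Proof.
move=> pp A0 A1; have := @cat_rev_r A (path_rev p) (is_path_rev pp).
by rewrite path_revK path_rev0 path_rev1 => /(_ A1 A0).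
Qed.

Definition subpath p (a b t : R) := p (a + (b - a) * t).

Lemma is_path_sub A p (a b : R) : is_path A p -> 0 <= a <= 1 -> 0 <= b <= 1 ->
  (a = 0 -> b = 0 -> A (p 0)) -> (a = 1 -> b = 1 -> A (p 1)) ->
  is_path A (subpath p a b).
Proof.
move=> [cp hp] a01 b01 h0 h1; split.
  have -> : (fun t => subpath p a b (clamp t)) =
            (fun t => p (clamp (a + (b - a) * clamp t))).
    apply/funext => t; rewrite /subpath [clamp (a + _)]clamp_id //.
    have := clamp_itv t; move: (clamp t) => x /andP[? ?].
    by have [/andP[? ?] /andP[? ?]] := (a01, b01); apply/andP; split; snra.
  apply: (@continuous_comp_fun _ _ _ (fun t => a + (b - a) * clamp t) (fun t => p (clamp t))) => //.
  apply: continuous_funD; first exact: cst_continuous.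
  by apply: continuous_funM; [exact: cst_continuous|exact: clamp_continuous].
move=> t /andP[t0 t1]; rewrite /subpath.
have [/andP[a0 a1] /andP[b0 b1]] := (a01, b01).
have e : a + (b - a) * t = (1 - t) * a + t * b by ring.
have [x0|x0] := eqVneq (a + (b - a) * t) 0.
  by rewrite x0; apply: h0; snra.
have [x1|x1] := eqVneq (a + (b - a) * t) 1.
  by rewrite x1; apply: h1; snra.
apply: hp; rewrite !lt_neqAle x1 [0 == _]eq_sym x0 /= e; apply/andP; split; snra.
Qed.

Lemma sub_cat A p (a b c : R) : is_path A p -> 0 <= a -> a < b -> b < c -> c <= 1 ->
  homot A (subpath p a c) (path_cat (subpath p a b) (subpath p b c)).
Proof.
move=> pp a0 ab bc c1.
pose th (t : R) := if t <= 2^-1 then a + (b - a) * (2 * t) else b + (c - b) * (2 * t - 1).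
have cth : continuous th.
  have -> : th = (fun t : R => if t <= 2^-1 then 2 * (b - a) * t + a
                   else 2 * (c - b) * t + (b - (c - b))).
    by apply/funext => t; rewrite /th; case: ifP => _; ring.
  apply: continuous_if_le.
  - exact: continuous_scale.
  - exact: continuous_scale.
  - by move=> x; exact: cvg_id.
  - exact: cst_continuous.
  - by move=> x ->; field.
have cs : continuous (fun t : R => (c - a) * t + a) by exact: continuous_scale.
have b1 t : 0 <= t <= 1 -> 0 <= (c - a) * t + a <= 1 /\ 0 <= th t <= 1.
  move=> /andP[t0 t1].
  have h1 : 0 <= (c - a) * t by apply: mulr_ge0; slra.
  have h2 : 0 <= (c - a) * (1 - t) by apply: mulr_ge0; slra.
  rewrite /th; case: (leP t 2^-1) => t2.
    have h3 : 0 <= (b - a) * (2 * t) by apply: mulr_ge0; slra.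
    have h4 : 0 <= (b - a) * (1 - 2 * t) by apply: mulr_ge0; slra.
    by split; apply/andP; split; snra.
  have h3 : 0 <= (c - b) * (2 * t - 1) by apply: mulr_ge0; slra.
  have h4 : 0 <= (c - b) * (1 - (2 * t - 1)) by apply: mulr_ge0; slra.
  by split; apply/andP; split; snra.
have b2 t : 0 < t < 1 -> 0 < (c - a) * t + a < 1 /\ 0 < th t < 1.
  move=> /andP[t0 t1].
  have h1 : 0 < (c - a) * t by apply: mulr_gt0; slra.
  have h2 : 0 < (c - a) * (1 - t) by apply: mulr_gt0; slra.
  rewrite /th; case: (leP t 2^-1) => t2.
    have h3 : 0 < (b - a) * (2 * t) by apply: mulr_gt0; slra.
    have h4 : 0 <= (b - a) * (1 - 2 * t) by apply: mulr_ge0; slra.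
    by split; apply/andP; split; snra.
  have h3 : 0 < (c - b) * (2 * t - 1) by apply: mulr_gt0; slra.
  have h4 : 0 < (c - b) * (1 - (2 * t - 1)) by apply: mulr_gt0; slra.
  by split; apply/andP; split; snra.
apply: (@homot_eq _ _ _ (fun t => p ((c - a) * t + a)) (fun t => p (th t))).
- by move=> t _; rewrite /subpath addrC.
- by move=> t _; rewrite /th /path_cat /subpath; case: ifP.
apply: homot_interp => //.
- by case: pp.
- by rewrite /th invr_ge0 ler0n; ring.
- by rewrite /th one_le_half; ring.
- move=> u t u01 t01; apply pp.2; have [? ?] := b2 _ t01.
  exact: itvo_interp.
Qed.

Lemma subpath01 p : subpath p 0 1 = p.
Proof. by apply/funext => t; rewrite /subpath subr0 mul1r add0r. Qed.

Lemma path_split A p (s : R) : is_path A p -> 0 < s < 1 ->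
  homot A p (path_cat (subpath p 0 s) (subpath p s 1)).
Proof. by move=> pp /andP[s0 s1]; rewrite -{1}(subpath01 p); exact: sub_cat. Qed.

Lemma cat_rev_cat A p q : is_path A p -> is_path A q -> p 1 = q 0 -> A (p 0) -> A (p 1) ->
  homot A (path_cat (path_rev p) (path_cat p q)) q.
Proof.
move=> pp pq e A0 A1.
apply: homot_trans (homot_sym _) _.
  by apply: cat_assoc => //; rewrite ?path_rev1 //; exact: is_path_rev.
apply: homot_trans (cat_hom (cat_rev_l pp A0 A1) (homot_refl pq) _ _) _.
- by rewrite path_cat1.
- by rewrite path_cat1.
by rewrite e; apply: cat_cst_l => //; rewrite -e.
Qed.

Lemma cat_cat_rev A p q : is_path A p -> is_path A q -> p 0 = q 0 -> A (p 0) -> A (p 1) ->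
  homot A (path_cat p (path_cat (path_rev p) q)) q.
Proof.
move=> pp pq e A0 A1; rewrite -{1}(path_revK p).
by apply: cat_rev_cat => //; rewrite ?path_rev1 ?path_rev0 //; exact: is_path_rev.
Qed.

End PathAlgebra.

(** * Homotopies read off a square *)

Section Squares.
Context {R : realType}.

Lemma clampl (t : R) : t <= 2^-1 -> 0 <= t -> clamp (2 * t) = 2 * t /\ clamp (2 * t - 1) = 0.
Proof.
move=> t2 t0; rewrite clamp_id; last by apply/andP; split; slra.
by split=> //; rewrite /clamp max_l // ge_min; apply/orP; right; slra.
Qed.

Lemma clampr (t : R) : 2^-1 <= t -> t <= 1 -> clamp (2 * t) = 1 /\ clamp (2 * t - 1) = 2 * t - 1.
Proof.
move=> t2 t1; rewrite [clamp (_ - _)]clamp_id; last by apply/andP; split; slra.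
by split=> //; rewrite /clamp min_l ?max_r ?ler01 //; slra.
Qed.

Lemma continuous_clamp_scale (k l : R) : continuous (fun t : R => clamp (k * t + l)).
Proof.
apply: (@continuous_comp_fun _ _ _ (fun t => k * t + l) clamp); first exact: continuous_scale.
exact: clamp_continuous.
Qed.

Lemma continuous_clamp2t : continuous (fun t : R => clamp (2 * t)).
Proof.
have -> : (fun t : R => clamp (2 * t)) = (fun t => clamp (2 * t + 0)).
  by apply/funext => t; rewrite addr0.
exact: continuous_clamp_scale.
Qed.

(** The broken line along the left and upper sides is moved linearly to the right side. The lower
    side is collapsed to the common starting point, which may be a puncture; so [A] is required only
    for [0 < y]. *)
Lemma square_start (A : set (sphere R)) (Q : R * R -> sphere R) :
  continuous Q -> (forall x, 0 <= x <= 1 -> Q (x, 0) = Q (0, 0)) ->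
  (forall x y, 0 <= x <= 1 -> 0 < y <= 1 -> A (Q (x, y))) ->
  homot A (path_cat (fun t => Q (0, t)) (fun t => Q (t, 1))) (fun t => Q (1, t)).
Proof.
move=> cQ Q0 QA.
apply: (@homot_eq _ _ _ (fun t => Q (clamp (2 * t - 1), clamp (2 * t))) (fun t => Q (1, t))) => //.
  move=> t /andP[t0 t1]; rewrite /path_cat; case: leP => t2.
    by have [-> ->] := clampl t2 t0.
  by have [-> ->] := clampr (ltW t2) t1.
apply: (@homot_interp2 _ _ _ Q (fun t => clamp (2 * t - 1)) (fun t => clamp (2 * t)) (fun=> 1) id) => //.
- exact: continuous_clamp_scale.
- exact: continuous_clamp2t.
- exact: cst_continuous.
- by move=> x; exact: cvg_id.
- move=> u u01 /=; rewrite !mulr0 clamp0 !mulr1 two_sub1.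
  have -> : clamp 2 = 1 :> R by rewrite /clamp min_l ?max_r ?ler01 ?ler1n.
  rewrite clamp1 !mulr1 subrK !addr0 !mulr0; split=> //.
  rewrite Q0; last by have := itv_interp u01 (clamp_itv (0 - 1)) itv1; rewrite mulr1.
  by rewrite Q0 //; exact: clamp_itv.
- move=> u t u01 /andP[t0 t1]; have /andP[u0 u1] := u01.
  apply: QA; first by apply: itv_interp => //; [exact: clamp_itv|exact: itv1].
  have /andP[c0 c1] := clamp_itv (2 * t).
  have ct : t <= clamp (2 * t).
    by rewrite /clamp le_max le_min (ltW t1) /=; apply/orP; right; slra.
  by rewrite /=; apply/andP; split; snra.
Qed.

(** The counterpart of [square_start] with the upper side collapsed; it is applied with this side at
    infinity. *)
Lemma square_end (A : set (sphere R)) (Q : R * R -> sphere R) :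
  continuous Q -> (forall x, 0 <= x <= 1 -> Q (x, 1) = Q (0, 1)) ->
  (forall x y, 0 <= x <= 1 -> 0 <= y <= 1 -> A (Q (x, y))) ->
  homot A (path_cat (fun t => Q (t, 0)) (fun t => Q (1, t))) (fun t => Q (0, t)).
Proof.
move=> cQ Q1 QA.
apply: (@homot_eq _ _ _ (fun t => Q (clamp (2 * t), clamp (2 * t - 1))) (fun t => Q (0, t))) => //.
  move=> t /andP[t0 t1]; rewrite /path_cat; case: leP => t2.
    by have [-> ->] := clampl t2 t0.
  by have [-> ->] := clampr (ltW t2) t1.
apply: (@homot_interp2 _ _ _ Q (fun t => clamp (2 * t)) (fun t => clamp (2 * t - 1)) (fun=> 0) id) => //.
- exact: continuous_clamp2t.
- exact: continuous_clamp_scale.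
- exact: cst_continuous.
- by move=> x; exact: cvg_id.
- move=> u u01 /=; rewrite !mulr0 clamp0 !mulr1 two_sub1.
  have cN : clamp (0 - 1) = 0 :> R.
    by rewrite /clamp max_l // ge_min; apply/orP; right; slra.
  rewrite cN clamp1 !addr0 !mulr0 mulr1 subrK; split=> //.
  rewrite Q1; last by have := itv_interp u01 (clamp_itv 2) itv0; rewrite mulr0 addr0.
  by rewrite [RHS]Q1 //; exact: clamp_itv.
- move=> u t u01 /ltW_itv t01; apply: QA; apply: itv_interp => //; try exact: clamp_itv.
  exact: itv0.
Qed.

(** In a free homotopy to a constant the base point moves. The loop is first deformed to the track
    of the base point followed by the same track backwards, and this detour is then contracted. *)
Lemma null_loop (T : topologicalType) (A : set T) (Q : R * R -> T) :
  continuous Q -> (forall y, 0 <= y <= 1 -> Q (0, y) = Q (1, y)) ->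
  (forall x, 0 <= x <= 1 -> Q (x, 1) = Q (0, 1)) ->
  (forall x y, 0 <= x <= 1 -> 0 <= y <= 1 -> A (Q (x, y))) ->
  homot A (fun t => Q (t, 0)) (fun=> Q (0, 0)).
Proof.
move=> cQ Q01 Q1 QA.
(* One third of the time for each of the left, upper and right sides of the square. *)
pose a (t : R) := clamp (3 * t - 1).
pose b (t : R) := Num.min (clamp (3 * t + 0)) (clamp (- 3 * t + 3)).
have ca : continuous a by exact: continuous_clamp_scale.
have cb : continuous b by apply: continuous_funmin; exact: continuous_clamp_scale.
have a01 t : 0 <= a t <= 1 by exact: clamp_itv.
have b01 t : 0 <= b t <= 1.
  rewrite /b le_min ge_min.
  by have /andP[-> ->] := clamp_itv (3 * t + 0); have /andP[-> _] := clamp_itv (- 3 * t + 3).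
have b0 : b 0 = 0.
  by rewrite /b !mulr0 addr0 clamp0 min_l //; have /andP[] := clamp_itv (0 + 3 : R).
have b1 : b 1 = 0.
  rewrite /b !mulr1 addNr clamp0 min_r //.
  by have /andP[] := clamp_itv (3 + 0 : R).
have a0 : a 0 = 0.
  by rewrite /a /clamp max_l // ge_min; apply/orP; right; slra.
have a1 : a 1 = 1.
  by rewrite /a /clamp min_l ?max_r //; slra.
have e : forall t, 0 <= t <= 1 -> Q (a t, b t) = Q (0, b t).
  move=> t /andP[t0 t1]; have [t3|t3] := leP (3 * t) 1.
    by rewrite (_ : a t = 0) // /a /clamp max_l // ge_min; apply/orP; right; slra.
  have [t6|t6] := leP (3 * t) 2.
    rewrite (_ : b t = 1); first by rewrite Q1.
    by rewrite /b /clamp [Num.min 1 _]min_l ?[Num.min 1 _]min_l ?max_r ?min_l //; slra.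
  rewrite (_ : a t = 1); first by rewrite Q01.
  by rewrite /a /clamp min_l ?max_r //; slra.
have step1 : homot A (fun t => Q (t, 0)) (fun t => Q (a t, b t)).
  apply: (@homot_interp2 _ _ _ Q id (fun=> 0) a b) => //.
  - by move=> x; exact: cvg_id.
  - exact: cst_continuous.
  - by move=> u _; rewrite b0 b1 a0 a1 !mulr0 !addr0 !mulr1 subrK.
  - by move=> u t u01 /ltW_itv t01; apply: QA; apply: itv_interp => //; exact: itv0.
apply: homot_trans step1 _.
apply: (@homot_eq _ _ _ (fun t => Q (0, b t)) (fun t => Q (0, 0))) => //.
  by move=> t t01; rewrite e.
apply: (@homot_interp2 _ _ _ Q (fun=> 0) b (fun=> 0) (fun=> 0)) => //; try exact: cst_continuous.
- by move=> u _; rewrite b0 b1 !mulr0 !addr0.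
- move=> u t u01 t01; apply: QA; apply: itv_interp => //; exact: itv0.
Qed.

End Squares.

(** * Dynamics on the rays *)

Section SineBound.
Context {R : realType}.

Lemma sin_le_id (y : R) : 0 <= y -> sin y <= y.
Proof.
rewrite le_eqVlt => /orP[/eqP <-|y0]; first by rewrite sin0.
have [x _] := @MVT R sin cos 0 y y0 (fun x _ => is_derive_sin x)
  (continuous_subspaceT (@continuous_sin R)).
by rewrite sin0 !subr0 => ->; rewrite ler_piMl ?cos_le1 // ltW.
Qed.

Lemma cos_half (b : R) : cos b = 1 - 2 * sin (b / 2) ^+ 2.
Proof. by rewrite {1}(splitr b) cosD -!expr2 cos2sin2; ring. Qed.

(** The constant is crude: on [0, 1] the mean value theorem gives [y / 2], and between 1 and
    [pi / 2 < 2] the sine is at least [sin 1 >= 1 / 2]. *)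
Lemma sin_ge_quarter (y : R) : 0 <= y <= pi / 2 -> y / 4 <= sin y.
Proof.
have sin1 (x : R) : 0 <= x <= 1 -> x / 2 <= sin x.
  move=> /andP[]; rewrite le_eqVlt => /orP[/eqP <-|x0] x1; first by rewrite sin0 mul0r.
  have [z zx] := @MVT R sin cos 0 x x0 (fun x _ => is_derive_sin x)
    (continuous_subspaceT (@continuous_sin R)).
  rewrite sin0 !subr0 => ->; rewrite mulrC ler_pM2r //.
  move: zx; rewrite in_itv /= => /andP[z0 zx].
  rewrite cos_half.
  have s0 : 0 <= sin (z / 2).
    by apply: sin_ge0_pi; have := @pi_ge2 R => ?; apply/andP; split; lra.
  have s1 : sin (z / 2) <= z / 2 by apply: sin_le_id; lra.
  have : sin (z / 2) ^+ 2 <= (1 / 2) ^+ 2 by rewrite ler_sqr ?nnegrE //; lra.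
  by lra.
move=> /andP[y0 y1]; have [y2|y2] := leP y 1.
  by have := sin1 y; rewrite y0 y2 => /(_ isT); lra.
have y4 : y <= 2 by apply: le_trans y1 (ltW (pihalf_lt2 R)).
have h : sin 1 < sin y.
  have p0 : - (pi / 2) <= 0 :> R by rewrite oppr_le0 divr_ge0 //; exact: pi_ge0.
  have p1 : - (pi / 2) <= 1 :> R by exact: le_trans p0 ler01.
  have i1 : (1 : R) \in `[ (- (pi/2)), pi/2].
    rewrite in_itv /= p1; exact: pihalf_ge1.
  have iy : y \in `[ (- (pi/2)), pi/2].
    rewrite in_itv /= y1 andbT; exact: le_trans p0 y0.
  rewrite (ltr_sin i1 iy); exact: y2.
have := sin1 1; rewrite ler01 lexx => /(_ isT).
by clear y1 sin1; lra.
Qed.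

Lemma cos_le_quadratic (b : R) : `|b| <= pi -> b ^+ 2 / 32 <= 1 - cos b.
Proof.
move=> bp; rewrite -(cos_norm b) -real_normK ?num_real //.
have b0 : 0 <= `|b| by [].
move: (`|b|) b0 bp => {}b b0 bp.
rewrite cos_half.
have h : b / 2 / 4 <= sin (b / 2) by apply: sin_ge_quarter; apply/andP; split; lra.
have : (b / 2 / 4) ^+ 2 <= sin (b / 2) ^+ 2.
  by rewrite ler_sqr ?nnegrE //; lra.
by lra.
Qed.

End SineBound.

(** * Expansion and growth under the exponential map *)

Section Exponential.
Context {R : realType}.
Implicit Types (x y z kappa : R[i]).

Lemma normc_cexp z : normc (cexp z) = expR (Re z).
Proof.
by rewrite /cexp /= !exprMn -mulrDr cos2Dsin2 mulr1 sqrtr_sqr ger0_norm.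
Qed.

Lemma cexp_continuous : continuous (@cexp R).
Proof.
apply: continuous_complex; apply: continuous_funM.
- apply: (@continuous_comp_fun _ _ _ _ expR); [exact: Re_continuous|exact: continuous_expR].
- apply: (@continuous_comp_fun _ _ _ _ cos); [exact: Im_continuous|exact: continuous_cos].
- apply: (@continuous_comp_fun _ _ _ _ expR); [exact: Re_continuous|exact: continuous_expR].
- apply: (@continuous_comp_fun _ _ _ _ sin); [exact: Im_continuous|exact: continuous_sin].
Qed.

Lemma exp_map_continuous kappa : continuous (exp_map kappa).
Proof.
by apply: continuous_funD; [exact: cexp_continuous|exact: cst_continuous].
Qed.

Lemma iter_exp_map_continuous kappa n : continuous (iter n (exp_map kappa)).
Proof.
elim: n => [|n ih]; first by move=> x; exact: cvg_id.
exact: (@continuous_comp_fun _ _ _ (iter n (exp_map kappa)) (exp_map kappa) ih (@exp_map_continuous kappa)).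
Qed.

(** For a and b the differences of the real and imaginary parts, the squared distance of the images
    is [expR (Re y) ^+ 2] times [(expR a - 1) ^+ 2 + 2 * expR a * (1 - cos b)]. The first summand
    controls a and, as b is at most [pi], the second controls b. *)
Lemma cexp_expand x y (Q : R) : Q <= Re x -> Q <= Re y -> `|Im x - Im y| <= pi ->
  expR Q / 8 * normc (x - y) <= normc (cexp x - cexp y).
Proof.
wlog: x y / Re y <= Re x.
  move=> h Qx Qy xy; have [yx|/ltW yx] := leP (Re y) (Re x); first exact: h.
  by rewrite normcB [leRHS]normcB; apply: h => //; rewrite distrC.
move=> yx Qx Qy xy.
apply: le_trans (_ : expR (Re y) / 8 * normc (x - y) <= _).
  by rewrite ler_wpM2r ?normc_ge0 // ler_pM2r ?ler_expR // invr_gt0.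
rewrite -(ler_pXn2r (ltn0Sn 1)) ?nnegrE ?normc_ge0 //; last first.
  by rewrite mulr_ge0 ?normc_ge0 // divr_ge0 // expR_ge0.
rewrite exprMn !sqr_normc_Re_Im !ReB !ImB /cexp /=.
set a := Re x - Re y; set b := Im x - Im y.
have -> : Re x = Re y + a by rewrite /a addrC subrK.
have -> : Im x = Im y + b by rewrite /b addrC subrK.
rewrite expRD.
have a0 : 0 <= a by rewrite subr_ge0.
have ea : 1 + a <= expR a by exact: expR_ge1Dx.
have hb : b ^+ 2 / 32 <= 1 - cos b by exact: cos_le_quadratic.
have -> : (expR (Re y) * expR a * cos (Im y + b) - expR (Re y) * cos (Im y)) ^+ 2 +
  (expR (Re y) * expR a * sin (Im y + b) - expR (Re y) * sin (Im y)) ^+ 2 =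
  expR (Re y) ^+ 2 * ((expR a - 1) ^+ 2 + 2 * expR a * (1 - cos b)).
  have e1 : cos (Im y + b) ^+ 2 + sin (Im y + b) ^+ 2 = 1 by exact: cos2Dsin2.
  have e2 : cos (Im y) ^+ 2 + sin (Im y) ^+ 2 = 1 by exact: cos2Dsin2.
  have e3 : cos b = cos (Im y + b) * cos (Im y) + sin (Im y + b) * sin (Im y).
    by rewrite -cosB; congr cos; rewrite addrC addKr.
  rewrite e3; move: (cos (Im y + b)) (sin (Im y + b)) (cos (Im y)) (sin (Im y)) e1 e2.
  move=> c1 s1 c2 s2 e1 e2.
  move: (expR (Re y)) (expR a) => E A.
  transitivity (E ^+ 2 * (A ^+ 2 * (c1 ^+ 2 + s1 ^+ 2) + (c2 ^+ 2 + s2 ^+ 2)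
     - 2 * A * (c1 * c2 + s1 * s2))); first by ring.
  by rewrite e1 e2; ring.
rewrite exprMn -mulrA ler_wpM2l ?sqr_ge0 //.
have h1 : a ^+ 2 <= (expR a - 1) ^+ 2 by rewrite ler_sqr ?nnegrE //; lra.
have h2 : b ^+ 2 / 32 <= expR a * (1 - cos b).
  apply: le_trans hb _; rewrite ler_peMl ?subr_ge0 ?cos_le1 //; lra.
have : 0 <= a ^+ 2 by exact: sqr_ge0.
have : 0 <= b ^+ 2 by exact: sqr_ge0.
lra.
Qed.

(* Once [x] is far ahead of [y], its image is eleven times larger than that of
   [y], with almost the same imaginary part, hence again far ahead. *)
Lemma exp_map_gap kappa x y :
  Re kappa <= Re (exp_map kappa x) -> 7 <= Re y ->
  `|Im (exp_map kappa x) - Im (exp_map kappa y)| <= pi ->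
  Re y + 10 < Re x -> Re (exp_map kappa y) + 10 < Re (exp_map kappa x).
Proof.
move=> X0 y7 XY xy; rewrite ltNge; apply/negP => h.
have nX : expR (Re x) <= Re (cexp x) + `|Im (cexp x)|.
  rewrite -normc_cexp; apply: le_trans (normc_le_Re_Im _) _.
  by rewrite lerD2r ger0_norm //; move: X0; rewrite /exp_map ReD; lra.
have nY1 := Re_le_normc (cexp y); have nY2 := Im_le_normc (cexp y).
rewrite normc_cexp in nY1 nY2.
have p4 : pi <= 4 :> R by have /andP[_] := @pihalf_02 R; lra.
have e11 : 11 * expR (Re y) <= expR (Re x).
  have -> : Re x = (Re x - Re y) + Re y by rewrite subrK.
  rewrite expRD ler_pM2r ?expR_gt0 //.
  by have := @expR_ge1Dx R (Re x - Re y); lra.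
have ey : 8 <= expR (Re y) by have := @expR_ge1Dx R (Re y); lra.
have hR : Re (cexp x) <= Re (cexp y) + 10 by move: h; rewrite /exp_map !ReD; lra.
have hI : `|Im (cexp x)| <= `|Im (cexp y)| + 4.
  have -> : Im (cexp x) = Im (cexp y) + (Im (cexp x) - Im (cexp y)) by ring.
  apply: le_trans (ler_normD _ _) _; rewrite lerD2l; apply: le_trans p4.
  by move: XY; rewrite /exp_map !ImD opprD addrACA subrr addr0.
have := ler_norm (Re (cexp y)).
lra.
Qed.

(** Being far ahead of [y] makes [cexp x] almost horizontal: its imaginary part is at most
    [expR (Re x) / 11 + 4]. So its real part is comparable to [expR (Re x)], which outgrows
    [Re x + 1] and the translation by [kappa]. *)
Lemma exp_map_growth kappa x y :
  Re kappa <= Re (exp_map kappa x) -> 10 + normc kappa <= Re x ->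
  `|Im (exp_map kappa x) - Im (exp_map kappa y)| <= pi ->
  Re y + 10 < Re x -> Re x + 1 <= Re (exp_map kappa x).
Proof.
move=> X0 x10 XY xy.
have nX : expR (Re x) <= Re (cexp x) + `|Im (cexp x)|.
  rewrite -normc_cexp; apply: le_trans (normc_le_Re_Im _) _.
  by rewrite lerD2r ger0_norm //; move: X0; rewrite /exp_map ReD; lra.
have nY2 := Im_le_normc (cexp y).
rewrite normc_cexp in nY2.
have p4 : pi <= 4 :> R by have /andP[_] := @pihalf_02 R; lra.
have e11 : 11 * expR (Re y) <= expR (Re x).
  have -> : Re x = (Re x - Re y) + Re y by rewrite subrK.
  rewrite expRD ler_pM2r ?expR_gt0 //.
  by have := @expR_ge1Dx R (Re x - Re y); lra.
have hI : `|Im (cexp x)| <= `|Im (cexp y)| + 4.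
  have -> : Im (cexp x) = Im (cexp y) + (Im (cexp x) - Im (cexp y)) by ring.
  apply: le_trans (ler_normD _ _) _; rewrite lerD2l; apply: le_trans p4.
  by move: XY; rewrite /exp_map !ImD opprD addrACA subrr addr0.
have ex : (1 + Re x / 2) ^+ 2 <= expR (Re x).
  have -> : Re x = Re x / 2 + Re x / 2 by lra.
  rewrite expRD -expr2 ler_sqr ?nnegrE ?expR_ge0 //.
    have := @expR_ge1Dx R (Re x / 2); lra.
  by have := normc_ge0 kappa; lra.
have k0 := normc_ge0 kappa.
have kR := Re_le_normc kappa.
have : - normc kappa <= Re kappa by move: kR; rewrite ler_norml => /andP[].
rewrite /exp_map ReD; nra.
Qed.

End Exponential.

(** * The order of points on a ray is seen in the real parts of their iterates *)

Section RayOrder.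
Context {R : realType} (kappa : R[i]) (g : R -> R[i]).
Let h := exp_map kappa.
Hypothesis tail : ray_tail h g.

Lemma ray_tail_cont : continuous (fun t : R => g (Num.max 0 t)).
Proof.
case: tail => cg _ _ _.
have := @within_comp _ _ _ (`[0, +oo[%classic : set R) g (fun t : R => Num.max 0 t) cg; apply.
  by apply: continuous_funmax; [exact: cst_continuous|move=> x; exact: cvg_id].
by move=> t /=; rewrite in_itv /= andbT le_max lexx.
Qed.

Lemma ray_tail_iter_cont n : continuous (fun t : R => iter n h (g (Num.max 0 t))).
Proof.
apply: (@continuous_comp_fun _ _ _ (fun t : R => g (Num.max 0 t)) (iter n h)).
  exact: ray_tail_cont.
exact: iter_exp_map_continuous.
Qed.

Lemma exp_map_Re_large (Q : R) z : expR Q + normc kappa < normc (h z) -> Q < Re z.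
Proof.
move=> H; rewrite -ltr_expR -normc_cexp.
have : normc (h z) <= normc (cexp z) + normc kappa by exact: le_normcD.
lra.
Qed.

Lemma ray_tail_Re (Q : R) : exists N, forall n, (N <= n)%N -> forall t, 0 <= t ->
  Q < Re (iter n h (g t)).
Proof.
case: tail => _ _ _ /(_ (expR Q + normc kappa)) [N _ hN].
exists N => n Nn t t0; apply: exp_map_Re_large.
by apply: (hN n.+1) => //=; rewrite leqW.
Qed.

(* The image of the tail lies in a right half-plane, so its preimage cannot
   meet the lines where [cos (Im z)] vanishes. *)
Lemma ray_tail_Im : exists N, forall n, (N <= n)%N -> forall t t', 0 <= t -> 0 <= t' ->
  `|Im (iter n h (g t)) - Im (iter n h (g t'))| <= pi.
Proof.
have [N hN] := ray_tail_Re (Re kappa).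
exists N => n Nn.
have cpos t : 0 <= t -> 0 < cos (Im (iter n h (g t))).
  move=> t0; have := hN n.+1 (leqW Nn) t t0.
  by rewrite /= /h /exp_map ReD ltrDr /cexp /= pmulr_rgt0 ?expR_gt0.
suff H t t' : 0 <= t -> 0 <= t' -> Im (iter n h (g t)) - Im (iter n h (g t')) <= pi.
  by move=> t t' t0 t'0; rewrite ler_norml H // lerNl opprB H.
move=> t0 t'0; rewrite leNgt; apply/negP => lt.
pose f (x : R) := Im (iter n h (g (Num.max 0 x))).
have cf : continuous f.
  apply: (@continuous_comp_fun _ _ _ _ (@complex.Im R)); first exact: ray_tail_iter_cont.
  exact: Im_continuous.
have ft x : 0 <= x -> f x = Im (iter n h (g x)).
  by move=> x0; rewrite /f (max_idPr x0).
pose v := f t' + pi.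
have pp := @pi_gt0 R.
have ftv : f t' <= v <= f t.
  by rewrite /v lerDl (ltW pp) /= !ft //; lra.
have [x x0 fx] : exists2 x, 0 <= x & f x = v.
  have [tt'|/ltW tt'] := leP t t'.
    have [||x + <-] := @IVT R f t t' v tt'; first exact: continuous_subspaceT.
      by rewrite ge_min le_max; have /andP[-> ->] := ftv; rewrite orbT.
    by rewrite in_itv /= => /andP[tx _]; exists x => //; exact: le_trans tx.
  have [||x + <-] := @IVT R f t' t v tt'; first exact: continuous_subspaceT.
    by rewrite ge_min le_max; have /andP[-> ->] := ftv; rewrite orbT.
  by rewrite in_itv /= => /andP[tx _]; exists x => //; exact: le_trans tx.
have := cpos _ x0; rewrite -ft // fx /v cosDpi oppr_gt0 => c1.
by have := cpos _ t'0; rewrite -ft // => c2; have := lt_trans c1 c2; rewrite ltxx.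
Qed.

Lemma iterSh n z : iter n.+1 h z = exp_map kappa (iter n h z).
Proof. by []. Qed.

Lemma ray_tail_gap_persists : exists N, forall n, (N <= n)%N -> forall t t', 0 <= t -> 0 <= t' ->
  Re (iter n h (g t)) + 10 < Re (iter n h (g t')) ->
  forall m, (n <= m)%N -> Re (iter m h (g t)) + 10 < Re (iter m h (g t')).
Proof.
have [N1 h1] := ray_tail_Re (Num.max 7 (Re kappa)); have [N2 h2] := ray_tail_Im.
exists (maxn N1 N2) => n; rewrite geq_max => /andP[n1 n2] t t' t0 t'0 lt.
elim=> [|m ih]; first by rewrite leqn0 => /eqP e; move: lt; rewrite e.
rewrite leq_eqVlt => /orP[/eqP <- //|]; rewrite ltnS => nm.
have m1 := leq_trans n1 nm; have m2 := leq_trans n2 nm.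
rewrite !iterSh; apply: exp_map_gap => //.
- by have := h1 m.+1 (leqW m1) t' t'0; rewrite gt_max => /andP[_ /ltW].
- by have := h1 m m1 t t0; rewrite gt_max => /andP[/ltW].
- exact: (h2 m.+1 (leqW m2)).
- exact: ih.
Qed.

Lemma ray_tail_expand : exists N, forall n, (N <= n)%N -> forall t t', 0 <= t -> 0 <= t' ->
  2 * normc (iter n h (g t) - iter n h (g t')) <=
  normc (iter n.+1 h (g t) - iter n.+1 h (g t')).
Proof.
(* The value 15 gives [2 <= expR 15 / 8] directly from [1 + x <= expR x]. *)
have [N1 h1] := ray_tail_Re 15; have [N2 h2] := ray_tail_Im.
exists (maxn N1 N2) => n; rewrite geq_max => /andP[n1 n2] t t' t0 t'0.
rewrite !iterSh /exp_map opprD addrACA subrr addr0.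
apply: le_trans (cexp_expand (ltW (h1 _ n1 _ t0)) (ltW (h1 _ n1 _ t'0)) (h2 _ n2 _ _ t0 t'0)).
rewrite ler_wpM2r ?normc_ge0 //.
by have := @expR_ge1Dx R 15; lra.
Qed.

Lemma ray_tail_expand_iter : exists N, forall k t t', 0 <= t -> 0 <= t' ->
  2 ^+ k * normc (iter N h (g t) - iter N h (g t')) <=
  normc (iter (k + N) h (g t) - iter (k + N) h (g t')).
Proof.
have [N hN] := ray_tail_expand; exists N => k t t' t0 t'0.
elim: k => [|k ih]; first by rewrite expr0 mul1r.
rewrite exprS -mulrA; apply: le_trans (hN (k + N)%N (leq_addl _ _) t t' t0 t'0).
by rewrite ler_pM2l.
Qed.

Lemma geometric_unbounded (d M : R) : 0 < d -> exists k0, forall k, (k0 <= k)%N -> M < 2 ^+ k * d.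
Proof.
move=> d0; have [k0 hk0] : exists k, M / d < k%:R.
  exists (Num.bound `|M / d|); apply: le_lt_trans (ler_norm _) _.
  exact: archi_boundP.
exists k0 => k kk; rewrite -ltr_pdivrMr //; apply: lt_trans hk0 _.
apply: (@le_lt_trans _ _ k%:R); first by rewrite ler_nat.
by rewrite -natrX ltr_nat ltn_expl.
Qed.

(** The modulus tends to infinity along the tail, while the imaginary part varies by at most [pi]
    and the real part is positive; so the growth is that of the real part. *)
Lemma ray_tail_escape_Re n : (exists N, (N <= n)%N /\
   (forall t t', 0 <= t -> 0 <= t' -> `|Im (iter n h (g t)) - Im (iter n h (g t'))| <= pi) /\
   (forall t, 0 <= t -> 0 < Re (iter n h (g t)))) ->
  forall M : R, exists2 T, 0 <= T & forall t, T <= t -> M < Re (iter n h (g t)).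
Proof.
move=> [_ [_ [hI hR]]] M.
case: tail => _ _ /(_ n)[_ /cvgryPgt hT] _.
have [T [_ hT']] := hT (M + `|Im (iter n h (g 0))| + pi).
exists (Num.max 0 (T + 1)); first by rewrite le_max lexx.
move=> t; rewrite ge_max => /andP[t0 Tt].
have := hT' t; rewrite (lt_le_trans _ Tt) ?ltrDl // => /(_ isT) H.
have := normc_le_Re_Im (iter n h (g t)); rewrite (gtr0_norm (hR _ t0)) => N1.
have := hI t 0 t0 (lexx 0); have := ler_distD 0 (Im (iter n h (g t))) (Im (iter n h (g 0))).
have := ler_normD (Im (iter n h (g t)) - Im (iter n h (g 0))) (Im (iter n h (g 0))).
rewrite subrK; lra.
Qed.

(** Expansion separates the two orbits while their imaginary parts stay within [pi] of each other.
    So one of them gets ahead in real part, and a lead of more than 10 persists. *)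
Lemma ray_order (t1 t2 : R) : 0 <= t1 -> t1 < t2 ->
  exists N, forall n, (N <= n)%N -> Re (iter n h (g t1)) + 10 < Re (iter n h (g t2)).
Proof.
move=> t10 t12; have t20 : 0 <= t2 by rewrite ltW // (le_lt_trans t10).
have [N1 h1] := ray_tail_gap_persists.
have [N2 h2] := ray_tail_expand_iter.
have [N3 h3] := ray_tail_Im.
have [N4 h4] := ray_tail_Re 0.
have inj t t' : 0 <= t -> 0 <= t' -> t != t' -> 0 < normc (iter N2 h (g t) - iter N2 h (g t')).
  move=> t0 t'0 tt'; rewrite normc_gt0 subr_eq0; apply: contra_neq tt' => e.
  case: tail => _ _ /(_ N2)[hinj _] _; apply: hinj => //; rewrite in_itv /= andbT //.
have d0 := inj _ _ t10 t20 (negbT (lt_eqF t12)).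
have [k0 hk0] := geometric_unbounded (10 + pi) d0.
pose n0 := (maxn (maxn N1 N3) (maxn N4 (k0 + N2))).
have [n01 n03 n04 n02] : [/\ (N1 <= n0)%N, (N3 <= n0)%N, (N4 <= n0)%N & (k0 + N2 <= n0)%N].
  by rewrite /n0 !leq_max !leqnn !orbT.
have far : 10 < `|Re (iter n0 h (g t1)) - Re (iter n0 h (g t2))|.
  have := h2 (n0 - N2)%N t1 t2 t10 t20.
  rewrite subnK; last exact: leq_trans (leq_addl _ _) n02.
  have := hk0 (n0 - N2)%N; rewrite leq_subRL; last exact: leq_trans (leq_addl _ _) n02.
  rewrite addnC n02 => /(_ isT) A B.
  have := normc_le_Re_Im (iter n0 h (g t1) - iter n0 h (g t2)).
  have := h3 n0 n03 t1 t2 t10 t20; rewrite ReB ImB; lra.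
have [le12|lt21] := leP (Re (iter n0 h (g t1))) (Re (iter n0 h (g t2))).
  exists n0; apply: h1 => //.
  by move: far; rewrite distrC ger0_norm ?subr_ge0 //; lra.
(* If [t1] led instead, some [t3] beyond [t2] would lead [t1]. On the arc from [t2] to [t3] the real
   part of a late iterate then takes the value it has at [t1], at a point within [pi] of the orbit
   of [g t1], although expansion has carried the whole arc further away from it. *)
exfalso.
have p21 : Re (iter n0 h (g t2)) + 10 < Re (iter n0 h (g t1)).
  by move: far; rewrite ger0_norm ?subr_ge0; lra.
have [T T0 hT] : exists2 T, 0 <= T & forall t, T <= t -> Re (iter n0 h (g t1)) + 10 < Re (iter n0 h (g t)).
  apply: ray_tail_escape_Re; exists 0%N; split => //; split; first exact: h3.
  exact: h4.
pose t3 := Num.max T t2.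
have t30 : 0 <= t3 by rewrite le_max T0.
have p13 : Re (iter n0 h (g t1)) + 10 < Re (iter n0 h (g t3)) by apply: hT; rewrite le_max lexx.
pose f (q : R) := normc (iter N2 h (g (Num.max 0 q)) - iter N2 h (g t1)).
have cf : continuous f.
  apply: (@continuous_comp_fun _ _ _ _ (@normc R)); last exact: normc_continuous.
  apply: continuous_funD; first exact: ray_tail_iter_cont.
  exact: cst_continuous.
have t23 : t2 <= t3 by rewrite le_max lexx orbT.
have [q q23 hq] : exists2 q, `[t2, t3]%classic q & forall q', `[t2, t3]%classic q' -> f q <= f q'.
  apply: compact_min => //; first exact: segment_compact.
  by exists t2; rewrite /= in_itv /= lexx t23.
have [qt2 qt3] : t2 <= q /\ q <= t3 by move: q23; rewrite /= in_itv /= => /andP[].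
have fq0 : 0 < f q.
  rewrite /f (max_idPr (le_trans t20 qt2)); apply: inj => //; first exact: le_trans qt2.
  by rewrite gt_eqF // (lt_le_trans t12).
have [k1 hk1] := geometric_unbounded pi fq0.
pose n := (maxn n0 (k1 + N2)).
have n0n : (n0 <= n)%N by rewrite leq_maxl.
have n2 : (N2 <= n)%N by rewrite leq_max (leq_trans (leq_addl _ _) n02).
have a21 := h1 n0 n01 _ _ t20 t10 p21 n n0n.
have a13 := h1 n0 n01 _ _ t10 t30 p13 n n0n.
pose F (x : R) := Re (iter n h (g (Num.max 0 x))).
have cF : continuous F.
  apply: (@continuous_comp_fun _ _ _ _ (@complex.Re R)); first exact: ray_tail_iter_cont.
  exact: Re_continuous.
have FE x : 0 <= x -> F x = Re (iter n h (g x)) by move=> x0; rewrite /F (max_idPr x0).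
have [||x + Fx] := @IVT R F t2 t3 (Re (iter n h (g t1))) t23.
- exact: continuous_subspaceT.
- by rewrite ge_min le_max !FE //; apply/andP; split; apply/orP; [left|right]; lra.
rewrite in_itv /= => /andP[x2 x3].
have x0 : 0 <= x by exact: le_trans t20 x2.
have := h2 (n - N2)%N x t1 x0 t10; rewrite subnK // => B.
have C : normc (iter n h (g x) - iter n h (g t1)) <= pi.
  apply: le_trans (normc_le_Re_Im _) _; rewrite ReB ImB -FE // Fx subrr normr0 add0r.
  by apply: h3 => //; exact: leq_trans n0n.
have fx : f q <= normc (iter N2 h (g x) - iter N2 h (g t1)).
  by have := hq x; rewrite /= in_itv /= x2 x3 /f (max_idPr x0); apply.
have := hk1 (n - N2)%N; rewrite leq_subRL // addnC leq_max leqnn orbT => /(_ isT) D.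
have : 2 ^+ (n - N2) * f q <= 2 ^+ (n - N2) * normc (iter N2 h (g x) - iter N2 h (g t1)).
  by rewrite ler_pM2l // exprn_gt0.
by lra.
Qed.

End RayOrder.

(** * Consequences for the orbit and the legs *)

Section Orbit.
Context {R : realType} (kappa : R[i]) (a : nat -> R[i]) (rays : nat -> R -> R[i])
  (tau : nat -> R).
Let h := exp_map kappa.
Hypothesis a_orbit : forall n, a n.+1 = h (a n).
Hypothesis rays_dynamic : forall n, dynamic_ray h (rays n).
Hypothesis a_on_rays : forall n, 0 < tau n /\ rays n (tau n) = a n.
Let leg n := ray_part (rays n) (tau n).

Lemma iter_orbit k n : iter k h (a n) = a (k + n).
Proof. by elim: k => //= k ->; rewrite a_orbit. Qed.

Lemma leg_tail n : ray_tail h (leg n).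
Proof. by have [[_ _ H] _] := rays_dynamic n; apply: H; have [] := a_on_rays n. Qed.

Lemma leg0 n : leg n 0 = a n.
Proof. by rewrite /leg /ray_part addr0; have [] := a_on_rays n. Qed.

(* A point of the ray before [a 0] has a slower orbit than [a 0]. *)
Lemma orbit_growth : exists N, forall n, (N <= n)%N -> Re (a n) + 1 <= Re (a n.+1).
Proof.
have [tau0 tauE] := a_on_rays 0.
pose g s := rays 0 (tau 0 / 2 + s).
have gt : ray_tail h g.
  by have [[_ _ H] _] := rays_dynamic 0; apply: H; rewrite divr_gt0.
have g2 : g (tau 0 / 2) = a 0 by rewrite /g -splitr.
have t20 : 0 < tau 0 / 2 by rewrite divr_gt0.
have [N1 h1] := ray_order gt (lexx 0) t20.
have [N2 h2] := ray_tail_Re gt (Num.max (Re kappa) (10 + normc kappa)).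
have [N3 h3] := ray_tail_Im gt.
exists (maxn N1 (maxn N2 N3)) => n; rewrite !geq_max => /and3P[n1 n2 n3].
have t2 := ltW t20.
have gn m : iter m h (g (tau 0 / 2)) = a m by rewrite g2 iter_orbit addn0.
rewrite a_orbit; apply: (@exp_map_growth _ kappa _ (iter n h (g 0))).
- have := h2 n.+1 (leqW n2) _ t2; rewrite gt_max gn -/h -a_orbit => /andP[? _]; exact: ltW.
- by have := h2 n n2 _ t2; rewrite gt_max gn => /andP[_ /ltW].
- by have := h3 n.+1 (leqW n3) _ _ t2 (lexx 0); rewrite gn -/h -a_orbit.
- by rewrite -gn; exact: h1.
Qed.

Lemma orbit_growth_le : exists N, forall m n, (N <= m)%N -> (m < n)%N -> Re (a m) + 1 <= Re (a n).
Proof.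
have [N hN] := orbit_growth; exists N => m n Nm.
elim: n => // n ih; rewrite ltnS leq_eqVlt => /orP[/eqP <-|mn]; first exact: hN.
apply: le_trans (ih mn) _; apply: le_trans (hN n _); first by rewrite lerDl.
exact: leq_trans Nm (ltnW mn).
Qed.

(** If [a i] were a later point of the leg than its start [a n], the orbit of [a i] would finally
    lead that of [a n]; but [a (m + n)] has a larger real part than [a (m + i)] for large [m]. *)
Lemma orbit_notin_leg i n t : (i < n)%N -> 0 <= t -> leg n t != a i.
Proof.
move=> lt_in; rewrite le_eqVlt => /orP[/eqP <-|t0]; apply/eqP => e.
  have [N hN] := orbit_growth_le.
  have := hN (N + i)%N (N + n)%N (leq_addr _ _); rewrite ltn_add2l => /(_ lt_in).
  by rewrite -!iter_orbit -e leg0; lra.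
have [N1 h1] := ray_order (leg_tail n) (lexx 0) t0.
have [N2 h2] := orbit_growth_le.
have := h1 (maxn N1 N2) (leq_maxl _ _); rewrite leg0 e !iter_orbit.
have := h2 (maxn N1 N2 + i)%N (maxn N1 N2 + n)%N.
rewrite ltn_add2l (leq_trans (leq_maxr N1 N2) (leq_addr _ _)) => /(_ isT lt_in).
by lra.
Qed.

Lemma leg_neq n t : 0 < t -> leg n t != a n.
Proof.
move=> t0; apply: contraTneq t0; rewrite -leg0.
case: (leg_tail n) => _ _ /(_ 0%N) [inj _] _.
have [t1|/ltW t1] := leP 0 t; last by move=> _; rewrite -leNgt.
by move/inj; rewrite !in_itv /= t1 lexx => /(_ isT isT) ->; rewrite ltxx.
Qed.

(** Read off the first image of the leg: [normc (h z)] is large only if [Re z] is. *)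
Lemma leg_Re n (M : R) : exists2 T, 0 <= T & forall t, T <= t -> M < Re (leg n t).
Proof.
case: (leg_tail n) => _ _ /(_ 1%N)[_ /cvgryPgt] /(_ (expR M + normc kappa)) [T [_ hT]] _.
exists (Num.max 0 (T + 1)); first by rewrite le_max lexx.
move=> t; rewrite ge_max => /andP[t0 Tt]; apply: (@exp_map_Re_large _ kappa).
by apply: hT; rewrite (lt_le_trans _ Tt) // ltrDl.
Qed.

Lemma orbit_escapes (M : R) : exists N, forall n, (N <= n)%N -> M < normc (a n).
Proof.
case: (leg_tail 0) => _ _ _ /(_ M) [N _ hN]; exists N => n Nn.
by have := hN n Nn 0 (lexx 0); rewrite leg0 iter_orbit addn0.
Qed.

End Orbit.

(** * Paths to infinity *)

Section Sphere.
Context {R : realType}.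
Local Notation C := R[i].

Lemma nbhs_None (A : set (sphere R)) (M : R) :
  (forall z, M < normc z -> A (Some z)) -> A None -> nbhs (None : sphere R) A.
Proof.
move=> hA A0; exists [set z : C | normc z <= M].
  split; first exact: compact_closed_disc.
  have -> : [set z : C | normc z <= M] = @normc R @^-1` [set x | x <= M] by [].
  by apply: closed_comp; [move=> x _; exact: normc_continuous|exact: closed_le].
by move=> _ [[z /= zM <-]|->] //; apply: hA; rewrite ltNge; exact/negP.
Qed.

Lemma nbhs_NoneE (A : set (sphere R)) : nbhs (None : sphere R) A ->
  A None /\ exists M : R, forall z, M < normc z -> A (Some z).
Proof.
move=> [K [cK _] KA]; split; first by apply: KA; right.
have [M hM] := closed_discE 0 cK; exists M => z Mz; apply: KA; left.
by exists z => // /hM; rewrite leNgt Mz.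
Qed.

Lemma Some_continuous : continuous (Some : C -> sphere R).
Proof. exact: one_point_compactification_some_continuous. Qed.

Lemma continuous_Some (T : topologicalType) (f : T -> C) :
  continuous f -> continuous (fun x => Some (f x) : sphere R).
Proof. by move=> cf; apply: (@continuous_comp_fun _ C (sphere R) f (Some : C -> sphere R)) => //; exact: Some_continuous. Qed.

Lemma cvg_to_None (T : topologicalType) (f : T -> sphere R) x :
  f x = None ->
  (forall M : R, \forall y \near x, forall z, f y = Some z -> M < normc z) ->
  {for x, continuous f}.
Proof.
move=> fx h A; rewrite /= fx => /nbhs_NoneE [A0 [M hM]].
rewrite /nbhs /=; apply: filterS (h M) => y hy /=.
by case e : (f y) => [z|//]; apply: hM; exact: hy.
Qed.

Lemma cvg_to_Some (T : topologicalType) (f : T -> sphere R) (g : T -> C) x :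
  (\forall y \near x, f y = Some (g y)) -> {for x, continuous g} ->
  {for x, continuous f}.
Proof.
move=> fg cg A; rewrite /= (nbhs_singleton fg) => hA.
have h : \forall y \near x, A (Some (g y)) := cg (fun z => A (Some z)) hA.
by rewrite /nbhs /=; apply: filterS2 fg h => y /= ->.
Qed.

(* [s/(1-s)] runs over [0, +oo[; the conjugating clamps make every homotopy a
   globally continuous map. *)
Lemma continuous_to_infinity (G : R * R -> C) :
  continuous G ->
  (forall M : R, exists T, forall u s, 0 <= u <= 1 -> T <= s -> M < normc (G (u, s))) ->
  continuous (fun x : R * R => path_to_infty (fun s => G (clamp x.1, s)) (clamp x.2)).
Proof.
move=> cG hG x.
have cc1 : continuous (fun y : R * R => clamp y.1).
  apply: (@continuous_comp_fun _ _ _ (fun y : R * R => y.1) clamp).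
    exact: continuous_fst.
  exact: clamp_continuous.
have cc : continuous (fun y : R * R => clamp y.2).
  apply: (@continuous_comp_fun _ _ _ (fun y : R * R => y.2) clamp).
    exact: continuous_snd.
  exact: clamp_continuous.
have [x1|x1] := ltP (clamp x.2) 1.
  apply: (@cvg_to_Some _ _ (fun y : R * R => G (clamp y.1, clamp y.2 / (1 - clamp y.2)))).
    have : \forall y \near x, clamp y.2 < 1.
      apply: (@near_lt _ _ (fun y : R * R => clamp y.2)) => //; exact: cc.
    by apply: filterS => y; rewrite /path_to_infty => ->.
  apply: (@continuous_comp _ _ _ (fun y : R * R => (clamp y.1, clamp y.2 / (1 - clamp y.2))) G).
    have h : {for x, continuous (fun y : R * R => clamp y.2 / (1 - clamp y.2))}.
      apply: cvgM; first exact: cc.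
      apply: cvgV; first by rewrite gt_eqF // subr_gt0.
      by apply: cvgD; [exact: cvg_cst|apply: cvgN; exact: cc].
    exact: (cvg_pair (cc1 x) h).
  exact: cG.
have {}x1 : clamp x.2 = 1 by apply/eqP; rewrite eq_le x1; have /andP[_ ->] := clamp_itv x.2.
apply: cvg_to_None; first by rewrite x1 /path_to_infty ltxx.
move=> M; have [T hT] := hG M.
pose s0 := 1 - (Num.max 0 T + 1)^-1.
have T0 : 0 < Num.max 0 T + 1 by rewrite ltr_pwDr // le_max lexx.
have : \forall y \near x, s0 < clamp y.2.
  apply: (@near_gt _ _ (fun y : R * R => clamp y.2)); first exact: cc.
  by rewrite x1 /s0 ltrBlDr ltrDl invr_gt0.
apply: filterS => y ys z; rewrite /path_to_infty; case: ltP => // y1 [<-].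
apply: hT; first exact: clamp_itv.
have := ys; rewrite /s0; move: (clamp y.2) y1 => s s1; rewrite ltrBlDr -ltrBlDl => hs.
rewrite ler_pdivlMr ?subr_gt0 //.
have TM : T <= Num.max 0 T by rewrite le_max lexx orbT.
have M0 : 0 <= Num.max 0 T by rewrite le_max lexx.
move: (Num.max 0 T) TM M0 T0 hs => m TM M0 T0 hs.
have : (1 - s) * (m + 1) < 1 by rewrite -ltr_pdivlMr // mul1r.
have : T * (1 - s) <= m * (1 - s) by rewrite ler_wpM2r // subr_ge0 ltW.
lra.
Qed.

Lemma is_path_to_infty (A : set (sphere R)) (g : R -> C) :
  continuous (fun t : R => g (Num.max 0 t)) ->
  (forall M : R, exists T, forall s, T <= s -> M < normc (g s)) ->
  (forall t, 0 < t -> A (Some (g t))) ->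
  is_path A (path_to_infty g).
Proof.
move=> cg hg gA; split.
  have cG : continuous (fun x : R * R => g (Num.max 0 x.2)).
    apply: (@continuous_comp_fun _ _ _ (fun x : R * R => x.2) (fun t : R => g (Num.max 0 t))) => //.
    exact: continuous_snd.
  have hG (M : R) : exists T, forall u s : R, 0 <= u <= 1 -> T <= s -> M < normc (g (Num.max 0 s)).
    have [T hT] := hg M; exists T => u s _ Ts; apply: hT.
    by rewrite le_max Ts orbT.
  have := @continuous_to_infinity (fun x => g (Num.max 0 x.2)) cG hG.
  move=> /(@continuous_comp_fun _ _ _ (fun t : R => (0 : R, t))) H.
  have -> : (fun t => path_to_infty g (clamp t)) =
    (fun t : R => path_to_infty (fun s => g (Num.max 0 s)) (clamp t)).
    apply/funext => t; rewrite /path_to_infty; case: ifP => // t1.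
    have /andP[c0 _] := clamp_itv t.
    by rewrite (max_idPr _) // divr_ge0 // subr_ge0 ltW.
  apply: H; apply: continuous_pair; first exact: cst_continuous.
  by move=> x; exact: cvg_id.
move=> t /andP[t0 t1]; rewrite /path_to_infty t1; apply: gA.
by rewrite divr_gt0 // subr_gt0.
Qed.

Lemma path_to_infty0 (g : R -> C) : path_to_infty g 0 = Some (g 0).
Proof. by rewrite /path_to_infty ltr01 mul0r. Qed.

Lemma path_to_infty1 (g : R -> C) : path_to_infty g 1 = None.
Proof. by rewrite /path_to_infty ltxx. Qed.

Definition segment (p q : C) (t : R) : sphere R := Some (p + t%:C * (q - p)).

Lemma path_to_infty_split (A : set (sphere R)) (g : R -> C) (T : R) : 0 < T ->
  is_path A (path_to_infty g) ->
  homot A (path_to_infty g)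
    (path_cat (fun t => Some (g (t * T))) (path_to_infty (fun s => g (T + s)))).
Proof.
move=> T0 pg.
(* The quotient [n t / d t] is the parameter at which [path_to_infty g] has reached time
   [n t / (d t - n t)], which is [2 * t * T] on the first half and [T + s / (1 - s)], with
   [s = 2 * t - 1], on the second. Cleared of denominators, it is continuous up to [t = 1]. *)
pose n (t : R) := if t <= 2^-1 then 2 * t * T else T * (1 - (2 * t - 1)) + (2 * t - 1).
pose d (t : R) := if t <= 2^-1 then 1 + 2 * t * T else (T + 1) * (1 - (2 * t - 1)) + (2 * t - 1).
have cn : continuous n.
  have -> : n = (fun t => if t <= 2^-1 then (2 * T) * t + 0 else (2 - 2 * T) * t + (2 * T - 1)).
    by apply/funext => t; rewrite /n; case: ifP => _; ring.
  apply: continuous_if_le.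
  - exact: continuous_scale.
  - exact: continuous_scale.
  - by move=> x; exact: cvg_id.
  - exact: cst_continuous.
  - by move=> x ->; field.
have cd : continuous d.
  have -> : d = (fun t => if t <= 2^-1 then (2 * T) * t + 1 else (- 2 * T) * t + (2 * T + 1)).
    by apply/funext => t; rewrite /d; case: ifP => _; ring.
  apply: continuous_if_le.
  - exact: continuous_scale.
  - exact: continuous_scale.
  - by move=> x; exact: cvg_id.
  - exact: cst_continuous.
  - by move=> x ->; field.
have nd t : 0 <= t <= 1 -> [/\ 0 <= n t, n t <= d t & 0 < d t].
  move=> /andP[t0 t1]; rewrite /n /d; case: (leP t 2^-1) => t2.
    have : 0 <= 2 * t * T by rewrite !mulr_ge0 // ltW.
    by split; lra.
  have : 0 <= T * (1 - (2 * t - 1)) by rewrite mulr_ge0; [|exact: ltW|lra].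
  by split; lra.
have nd' t : 0 < t < 1 -> 0 < n t /\ n t < d t.
  move=> /andP[t0 t1]; rewrite /n /d; case: (leP t 2^-1) => t2.
    have : 0 < 2 * t * T by rewrite !mulr_gt0.
    by split; lra.
  have : 0 < T * (1 - (2 * t - 1)) by rewrite mulr_gt0 //; lra.
  by split; lra.
pose th t := n (clamp t) / d (clamp t).
have cth : continuous th.
  have cc (f : R -> R) : continuous f -> continuous (fun t => f (clamp t)).
    by move=> cf; apply: (@continuous_comp_fun _ _ _ clamp f) => //; exact: clamp_continuous.
  apply: continuous_funM; first exact: cc.
  apply: continuous_funV; last exact: cc.
  by move=> x; have [_ _ /gt_eqF ->] := nd _ (clamp_itv x).
have th01 t : 0 <= t <= 1 -> 0 <= th t <= 1.
  move=> t01; rewrite /th clamp_id //; have [n0 nn d0] := nd _ t01.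
  by rewrite divr_ge0 ?ler_pdivrMr ?mul1r // ltW.
have th01' t : 0 < t < 1 -> 0 < th t < 1.
  move=> t01; rewrite /th clamp_id ?ltW_itv //; have [n0 nn] := nd' _ t01.
  have [_ _ d0] := nd _ (ltW_itv t01).
  by rewrite divr_gt0 // ltr_pdivrMr // mul1r.
apply: (@homot_eq _ _ _ (fun t => path_to_infty g t) (fun t => path_to_infty g (th t))) => //.
  move=> t t01; rewrite /th clamp_id // /path_cat.
  have [n0 nn d0] := nd _ t01; move: n0 nn d0.
  have [t0 t1] := andP t01.
  rewrite /n /d; case: (leP t 2^-1) => t2 n0 nn d0.
    rewrite /path_to_infty ltr_pdivrMr // mul1r ltrDr ltr01; congr (Some (g _)).
    by field; rewrite gt_eqF //=; slra.
  rewrite /path_to_infty ltr_pdivrMr // mul1r.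
  have -> : (T * (1 - (2 * t - 1)) + (2 * t - 1) < (T + 1) * (1 - (2 * t - 1)) + (2 * t - 1)) = (2 * t - 1 < 1).
    by apply/idP/idP => ?; slra.
  case: ifP => // t3; congr (Some (g _)).
  field; rewrite gt_eqF //=; last by slra.
  by rewrite gt_eqF //; slra.
apply: (@homot_interp _ _ _ (path_to_infty g) id th) => //.
- by case: pg.
- by move=> x; exact: cvg_id.
- by move=> t t01; split => //; exact: th01.
- by rewrite /th clamp0 /n invr_ge0 ler0n !mulr0 !mul0r.
- rewrite /th clamp1 /n /d one_le_half !mulr1 (_ : 2 - 1 = 1) ?two_sub1 // subrr !mulr0 !add0r.
  by rewrite divff // oner_eq0.
- by move=> u t u01 t01; apply pg.2; apply: itvo_interp => //; exact: th01'.
Qed.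

Lemma homotopic_inP (A : set (sphere R)) p q : homotopic_in A p q <-> homot A p q.
Proof.
split=> [[H [cH h1 h2 h3]]|[H [cH h1 h2 h3]]].
  exists (fun x => H (clamp x.1) (clamp x.2)); split => /=.
  - apply: (@within_comp _ _ _ (`[0, 1] `*` `[0, 1] : set (R * R))
      (fun x : R * R => H x.1 x.2) (fun x : R * R => (clamp x.1, clamp x.2))) => //.
    + apply: continuous_pair.
        apply: (@continuous_comp_fun _ _ _ (fun y : R * R => y.1) clamp).
          exact: continuous_fst.
        exact: clamp_continuous.
      apply: (@continuous_comp_fun _ _ _ (fun y : R * R => y.2) clamp).
        exact: continuous_snd.
      exact: clamp_continuous.
    + by move=> x; split; rewrite /= in_itv /= clamp_itv.
  - by move=> t t01; rewrite clamp0 clamp1 clamp_id //; exact: h1.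
  - by move=> u u01; rewrite clamp0 clamp1 clamp_id //; exact: h2.
  - by move=> u t u01 t01; rewrite (clamp_id u01) (clamp_id (ltW_itv t01)); exact: h3.
exists (fun u t => H (u, t)); split => //.
have -> : (fun x : R * R => H (x.1, x.2)) = H by apply/funext => -[].
exact: continuous_subspaceT.
Qed.

Lemma half_plane_subset (V : set C) (r r' : R) : r' <= r ->
  punctured_half_plane V r `<=` punctured_half_plane V r'.
Proof.
move=> rr _ [[z [zr zV] <-]|->]; [left; exists z => //; split => //|by right].
by rewrite /half_plane /= in zr *; exact: le_lt_trans zr.
Qed.

Lemma half_plane_Some (V : set C) (r : R) z :
  r < Re z -> ~ V z -> punctured_half_plane V r (Some z).
Proof. by move=> rz zV; left; exists z. Qed.

Lemma half_plane_None (V : set C) (r : R) : punctured_half_plane V r None.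
Proof. by right. Qed.

End Sphere.

(** * Composites of paths up to homotopy *)

Section PathLists.
Context {R : realType} (A : set (sphere R)).
Implicit Types (p q : R -> sphere R) (l m n : seq (R -> sphere R)) (x y z : sphere R).

Definition path_from_to x y p := [/\ is_path A p, p 0 = x, p 1 = y, A x & A y].

(** Composites are kept as lists, so that a homotopy can be applied to consecutive pieces regardless
    of bracketing. The starting point [x] gives a meaning to the empty list. *)
Fixpoint concat x l : R -> sphere R :=
  if l is p :: l' then path_cat p (concat (p 1) l') else fun=> x.

Fixpoint chain x l y : Prop :=
  if l is p :: l' then path_from_to x (p 1) p /\ chain (p 1) l' y else x = y /\ A x.

Definition eqv x y l m := [/\ chain x l y, chain x m y & homot A (concat x l) (concat x m)].

Lemma is_path_cst x : A x -> is_path A (fun _ : R => x).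
Proof. by move=> Ax; split => //; exact: cst_continuous. Qed.

Lemma chain_path x l y : chain x l y -> path_from_to x y (concat x l).
Proof.
elim: l x => [|p l ih] x /=; first by move=> [<- Ax]; split => //; exact: is_path_cst.
move=> [[pp p0 _ Ax Ap] /ih [pl l0 l1 _ Ay]]; split => //.
- by apply: is_path_cat => //; rewrite l0.
- by rewrite path_cat0.
- by rewrite path_cat1.
Qed.

Lemma chain1 x y p : path_from_to x y p -> chain x [:: p] y.
Proof. by move=> h; have [pp p0 p1 Ax Ay] := h; split; [rewrite p1|split; rewrite p1]. Qed.

Lemma chain_cons x y z p l : path_from_to x y p -> chain y l z -> chain x (p :: l) z.
Proof. by move=> h hl; have [_ _ p1 _ _] := h; split; rewrite p1. Qed.

Lemma chain_cat x l y m z : chain x l y -> chain y m z -> chain x (l ++ m) z.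
Proof.
elim: l x => [|p l ih] x /=; first by move=> [<- _].
by move=> [hp hl] hm; split => //; exact: ih.
Qed.

Lemma concat_cat x l y m z : chain x l y -> chain y m z ->
  homot A (concat x (l ++ m)) (path_cat (concat x l) (concat y m)).
Proof.
elim: l x => [|p l ih] x /=.
  move=> [-> Ay] hm; have [pm m0 _ _ _] := chain_path hm.
  by have := homot_sym (cat_cst_l pm _); rewrite m0; apply.
move=> [[pp p0 _ Ax Ap] hl] hm.
have [pl l0 l1 _ Ay] := chain_path hl.
have [pm m0 _ _ _] := chain_path hm.
have [pq q0 _ _ _] := chain_path (chain_cat hl hm).
apply: homot_trans (cat_hom (homot_refl pp) (ih _ hl hm) _ Ap) _; first by rewrite q0.
by apply/homot_sym/cat_assoc => //; rewrite ?l0 // l1.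
Qed.

Lemma eqv_refl x y l : chain x l y -> eqv x y l l.
Proof. by move=> h; split => //; apply: homot_refl; have [] := chain_path h. Qed.

Lemma eqv_sym x y l m : eqv x y l m -> eqv x y m l.
Proof. by move=> [? ? ?]; split => //; exact: homot_sym. Qed.

Lemma eqv_trans x y l m n : eqv x y l m -> eqv x y m n -> eqv x y l n.
Proof. by move=> [? _ h] [_ ? h']; split => //; exact: homot_trans h h'. Qed.

Lemma eqv_cat x y z l l' m m' : eqv x y l l' -> eqv y z m m' -> eqv x z (l ++ m) (l' ++ m').
Proof.
move=> [h1 h2 h] [k1 k2 k]; split; [exact: chain_cat k1|exact: chain_cat k2|].
apply: homot_trans (concat_cat h1 k1) _; apply: homot_trans (homot_sym (concat_cat h2 k2)).
have [_ _ l1 _ Ay] := chain_path h1; have [_ m0 _ _ _] := chain_path k1.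
by apply: cat_hom => //; rewrite l1 ?m0.
Qed.

Lemma eqv_ctx w x y z l l' m n : chain w m x -> chain y n z -> eqv x y l l' ->
  eqv w z (m ++ l ++ n) (m ++ l' ++ n).
Proof. by move=> hm hn h; apply: eqv_cat (eqv_refl hm) (eqv_cat h (eqv_refl hn)). Qed.

Lemma concat1 x y p : path_from_to x y p -> homot A (concat x [:: p]) p.
Proof. by move=> [pp p0 p1 Ax Ay]; apply: cat_cst_r => //; rewrite p1. Qed.

Lemma homot_path_from_to x y p q : homot A p q -> path_from_to x y p -> path_from_to x y q.
Proof.
move=> h [pp p0 p1 Ax Ay]; have [e0 e1] := homot_ends h.
by split => //; [exact: homot_path_r h|rewrite -e0|rewrite -e1].
Qed.

Lemma eqv_homot1 x y p q : path_from_to x y p -> homot A p q -> eqv x y [:: p] [:: q].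
Proof.
move=> hp h; have hq := homot_path_from_to h hp.
split; [exact: chain1|exact: chain1|].
apply: homot_trans (concat1 hp) _; apply: homot_trans h _; exact/homot_sym/(concat1 hq).
Qed.

Lemma eqv_concat x y l : chain x l y -> eqv x y [:: concat x l] l.
Proof.
move=> h; have hp := chain_path h; split => //; first exact: chain1.
exact: concat1 hp.
Qed.

Lemma eqv_homot x y p q : eqv x y [:: p] [:: q] -> homot A p q.
Proof.
move=> [/= [hp [p1 _]] [hq [q1 _]] h].
apply: homot_trans (homot_sym (concat1 hp)) _; apply: homot_trans h _; exact: concat1 hq.
Qed.

Lemma path_from_to_rev x y p : path_from_to x y p -> path_from_to y x (path_rev p).
Proof.
by move=> [pp p0 p1 Ax Ay]; split; rewrite ?path_rev0 ?path_rev1 //; exact: is_path_rev.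
Qed.

Lemma path_from_to_cat x y z p q : path_from_to x y p -> path_from_to y z q ->
  path_from_to x z (path_cat p q).
Proof.
move=> [pp p0 p1 Ax Ay] [pq q0 q1 _ Az]; split; rewrite ?path_cat0 ?path_cat1 //.
by apply: is_path_cat; rewrite ?p1.
Qed.

Lemma eqv_path_cat x y z p q : path_from_to x y p -> path_from_to y z q ->
  eqv x z [:: path_cat p q] [:: p; q].
Proof.
move=> hp hq; have hpq := path_from_to_cat hp hq.
split; [exact: chain1|exact: chain_cons hp (chain1 hq)|].
apply: homot_trans (concat1 hpq) _; have [pp p0 p1 Ax Ay] := hp.
have [pq q0 _ _ _] := hq.
apply: cat_hom; rewrite ?p1 ?q0 //; first exact: homot_refl.
exact: homot_sym (concat1 hq).
Qed.

Lemma eqv_split x y z p q s : path_from_to x y q -> path_from_to y z s ->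
  homot A p (path_cat q s) -> eqv x z [:: p] [:: q; s].
Proof.
move=> hq hs h; apply: eqv_trans (eqv_path_cat hq hs).
apply/eqv_sym; apply: eqv_homot1; last exact: homot_sym.
exact: path_from_to_cat hq hs.
Qed.

Lemma eqv_cst x : A x -> eqv x x [:: fun=> x] [::].
Proof.
move=> Ax; have h : path_from_to x x (fun=> x) by split => //; exact: is_path_cst.
by split; [exact: chain1 h|split|exact: concat1 h].
Qed.

Lemma eqv_rev_r x y p : path_from_to x y p -> eqv x x [:: p; path_rev p] [::].
Proof.
move=> hp; have hr := path_from_to_rev hp; have [pp p0 p1 Ax Ay] := hp.
apply: eqv_trans (eqv_sym (eqv_path_cat hp hr)) _.
apply: eqv_trans _ (eqv_cst Ax).
apply: eqv_homot1; first exact: path_from_to_cat hp hr.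
by have := cat_rev_r pp; rewrite p0 p1; apply.
Qed.

Lemma eqv_rev_l x y p : path_from_to x y p -> eqv y y [:: path_rev p; p] [::].
Proof. by move=> /path_from_to_rev /eqv_rev_r; rewrite path_revK. Qed.

Lemma eqv_cancel_r x y z l m p : path_from_to y z p -> chain x l y -> chain x m y ->
  eqv x z (l ++ [:: p]) (m ++ [:: p]) -> eqv x y l m.
Proof.
move=> hp hl hm h; have hr := path_from_to_rev hp.
have E n : chain x n y -> eqv x y n ((n ++ [:: p]) ++ [:: path_rev p]).
  move=> hn; rewrite -catA /= -{1}(cats0 n).
  by apply: eqv_cat (eqv_refl hn) _; apply/eqv_sym/(eqv_rev_r hp).
apply: eqv_trans (E _ hl) _; apply: eqv_trans _ (eqv_sym (E _ hm)).
by apply: eqv_cat h _; apply: eqv_refl; exact: chain1.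
Qed.

Lemma eqv_nil_loop x p : path_from_to x x p -> eqv x x [:: p] [::] -> homot A p (fun=> x).
Proof.
move=> hp h; have [_ _ _ Ax _] := hp.
by apply: (@eqv_homot x x); apply: eqv_trans h _; apply/eqv_sym/eqv_cst.
Qed.

End PathLists.

(** * Point pushing *)

Section IntervalInduction.
Context {R : realType}.

(** The supremum of the parameters reached is itself reached and cannot be smaller than 1, since a
    step of uniform size is possible around it. *)
Lemma interval_induction (P : R -> Prop) : P 0 ->
  (forall t, 0 <= t <= 1 -> exists2 e : R, 0 < e &
    forall s s', 0 <= s -> s <= s' -> s' <= 1 -> `|s - t| < e -> `|s' - t| < e ->
      P s -> P s') ->
  P 1.
Proof.
move=> P0 step; pose E := [set t : R | 0 <= t <= 1 /\ P t].
have E0 : E 0 by split=> //; exact: itv0.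
have Eb : has_sup E.
  by split; [exists 0|exists 1 => t [/andP[_ t1] _]].
set T := sup E.
have T01 : 0 <= T <= 1.
  rewrite sup_upper_bound //=; apply: ge_sup; first by exists 0.
  by move=> t [/andP[_ t1] _].
have [e e0 he] := step T T01.
have [s [/andP[s0 s1] Ps] sT] := sup_adherent e0 Eb.
have sleT : s <= T by apply: sup_upper_bound => //; split => //; apply/andP.
have [/andP[T0 T1]] := T01.
pose s' := Num.min 1 (T + e / 2).
have Ts' : T <= s' by rewrite le_min T1 lerDl divr_ge0 // ltW.
have s'1 : s' <= 1 by rewrite ge_min lexx.
have s'T : s' <= T + e / 2 by rewrite ge_min lexx orbT.
have Ps' : P s'.
  apply: (he s) => //.
  - exact: le_trans Ts'.
  - by rewrite ler0_norm ?subr_le0 // opprB -/T; move: sT; rewrite -/T; lra.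
  - by rewrite ger0_norm ?subr_ge0 //; lra.
have s'E : s' <= T.
  apply: sup_upper_bound => //; split=> //; apply/andP; split => //.
  exact: le_trans Ts'.
have : s' = 1; last by move=> <-.
have [h|/ltW h] := leP 1 (T + e / 2); first by rewrite /s' min_l.
by exfalso; move: s'E; rewrite /s' min_r // => ?; lra.
Qed.

(* Tube lemma for the compact interval. *)
Lemma uniform_in_first (F : R * R -> R[i]) (t e : R) : continuous F -> 0 < e ->
  exists2 d, 0 < d & forall u s, 0 <= u <= 1 -> `|s - t| < d -> normc (F (u, s) - F (u, t)) < e.
Proof.
move=> cF e0.
have cov := (compact_near_coveringP (`[0, 1]%classic : set R)).1 (@segment_compact R 0 1).
have := cov R (nbhs t) (fun s u => normc (F (u, s) - F (u, t)) < e) _ _.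
have h : forall u : R, `[0, 1]%classic u ->
   \forall u' \near u & s \near t, normc (F (u', s) - F (u', t)) < e.
  move=> u _.
  have c1 : continuous (fun x : R * R => normc (F x - F (x.1, t))).
    apply: (@continuous_comp_fun _ _ _ (fun x : R * R => F x - F (x.1, t)) (@normc R)).
      apply: (continuous_subc cF).
      apply: (@continuous_comp_fun _ _ _ (fun x : R * R => (x.1, t)) F); last exact: cF.
      by apply: continuous_pair; [exact: continuous_fst|exact: cst_continuous].
    exact: normc_continuous.
  have : \forall x \near ((u, t) : R * R), normc (F x - F (x.1, t)) < e.
    by apply: near_lt; [exact: c1|rewrite /= subrr normc0].
  by apply: filterS => -[].
move=> /(_ _ h) /nbhs_ballP [d /= d0 hd]; exists d => // u s u01 st.
have := hd s; rewrite /ball /= distrC => /(_ st) /(_ u); apply.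
by rewrite /= in_itv.
Qed.

End IntervalInduction.

(** * Perturbations of the identity that move prescribed points *)

Section Perturbation.
Context {R : realType}.
Local Notation C := R[i].
Implicit Types (Phi Psi : R -> C -> C).

(** Joint continuity of the inverses is recorded as well, because it is [Psi] that will be composed
    with an isotopy. *)
Definition mutual_inverses Phi Psi :=
  [/\ continuous (fun x : R * C => Phi (clamp x.1) x.2),
      continuous (fun x : R * C => Psi (clamp x.1) x.2) &
      forall u, 0 <= u <= 1 -> cancel (Phi u) (Psi u) /\ cancel (Psi u) (Phi u)].

Lemma mutual_inverses_id : mutual_inverses (fun _ z => z) (fun _ z => z).
Proof. by split => //; exact: continuous_snd. Qed.

Lemma continuous_clamp_apply (S : topologicalType) Phi (f : S -> R) (g : S -> C) :
  continuous (fun x : R * C => Phi (clamp x.1) x.2) -> continuous f -> continuous g ->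
  continuous (fun x => Phi (clamp (f x)) (g x)).
Proof.
move=> cP cf cg.
apply: (@continuous_comp_fun _ _ _ (fun x => (f x, g x))
  (fun x : R * C => Phi (clamp x.1) x.2)) => //.
exact: continuous_pair.
Qed.

Lemma mutual_inverses_comp Phi Psi Phi' Psi' :
  mutual_inverses Phi Psi -> mutual_inverses Phi' Psi' ->
  mutual_inverses (fun u z => Phi u (Phi' u z)) (fun u z => Psi' u (Psi u z)).
Proof.
move=> [c1 c2 h] [c1' c2' h']; split.
- exact: (continuous_clamp_apply c1 (@continuous_fst R C) c1').
- exact: (continuous_clamp_apply c2' (@continuous_fst R C) c2).
- by move=> u u01; have [k1 k2] := h _ u01; have [k1' k2'] := h' _ u01; split; exact: can_comp.
Qed.

(** A preimage of [y] is a point where the distance from [z + D u z] to [y] is minimal; the inverse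
    is Lipschitz because [c < 1], which also gives its continuity in [u]. *)
Lemma lipschitz_perturbation (D : R -> C -> C) (c : R) : 0 <= c < 1 ->
  (forall u x y, 0 <= u <= 1 -> normc (D u x - D u y) <= c * normc (x - y)) ->
  (forall z, continuous (fun u => D (clamp u) z)) ->
  exists Psi, mutual_inverses (fun u z => z + D u z) Psi.
Proof.
move=> /andP[c0 c1] lip cD.
have surj u y : 0 <= u <= 1 -> exists z, z + D u z = y.
  move=> u01.
  pose f z := normc (z + D u z - y).
  have cDu : continuous (D u).
    apply/continuous_normcP => x e e0; apply/nbhs_normc; exists e => // w wx.
    apply: le_lt_trans (lip _ _ _ u01) _; apply: le_lt_trans wx.
    by rewrite ler_piMl ?normc_ge0 // ltW.
  have cf : continuous f.
    apply: (@continuous_comp_fun _ _ _ (fun z => z + D u z - y) (@normc R)).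
      apply: continuous_subc; last exact: cst_continuous.
      exact: (continuous_addc (@continuous_idfun C) cDu).
    exact: normc_continuous.
  pose K := normc (D u 0) + normc y; pose M := (2 * K + 1) / (1 - c).
  have K0 : 0 <= K by rewrite addr_ge0 ?normc_ge0.
  have c10 : 0 < 1 - c by rewrite subr_gt0.
  have M0 : 0 <= M by rewrite divr_ge0 ?ltW //; lra.
  have n0 : normc (0 : C) <= M by rewrite normc0.
  have [|z zM hz] := @compact_min _ _ _ f (@compact_closed_disc R M) _ cf.
    by exists 0.
  have f0 : f 0 <= K by rewrite /f add0r; apply: le_trans (le_normcD _ _) _; rewrite normcN.
  have min w : f z <= f w.
    have [wM|Mw] := leP (normc w) M; first exact: hz.
    apply: le_trans (hz 0 n0) _.
    apply: le_trans f0 _.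
    have h1 : normc w <= f w + (normc y + normc (D u w)).
      have e : w = (w + D u w - y) + (y - D u w) by ring.
      rewrite {1}e; apply: le_trans (le_normcD _ _) _; rewrite /f lerD2l.
      by apply: le_trans (le_normcD _ _) _; rewrite normcN.
    have h2 : normc (D u w) <= c * normc w + normc (D u 0).
      have e : D u w = (D u w - D u 0) + D u 0 by rewrite subrK.
      rewrite {1}e; apply: le_trans (le_normcD _ _) _; rewrite lerD2r.
      by have := lip u w 0 u01; rewrite subr0.
    have h3 : 2 * K + 1 < (1 - c) * normc w by rewrite [ltRHS]mulrC -ltr_pdivrMr.
    rewrite /K in h3 *; lra.
  exists z; apply/eqP; rewrite -subr_eq0 -normc_eq0; apply/negPn/negP => fz.
  have {}fz : 0 < f z by rewrite /f normc_gt0 -normc_eq0.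
  (* One step of the iteration [z -> y - D u z] would multiply the minimum by at most [c]. *)
  have := min (y - D u z); rewrite /f.
  have -> : y - D u z + D u (y - D u z) - y = D u (y - D u z) - D u z by ring.
  move=> /le_trans /(_ (lip _ _ _ u01)).
  rewrite (_ : y - D u z - z = - (z + D u z - y)); last by ring.
  rewrite normcN -/(f z) => h.
  have : c * f z < f z by rewrite gtr_pMl.
  by rewrite ltNge h.
have inj u x y : 0 <= u <= 1 -> x + D u x = y + D u y -> x = y.
  move=> u01 e; apply/eqP; rewrite -subr_eq0 -normc_eq0; apply/negPn/negP => xy.
  have {}xy : 0 < normc (x - y) by rewrite normc_gt0 -normc_eq0.
  have := lip u x y u01.
  have -> : D u x - D u y = - (x - y).
    by apply/eqP; rewrite -subr_eq0 (_ : _ - _ = x + D u x - (y + D u y)); [rewrite e subrr|ring].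
  rewrite normcN => h.
  have : c * normc (x - y) < normc (x - y) by rewrite gtr_pMl.
  by rewrite ltNge h.
pose Psi (u : R) y := xget 0 [set z | z + D u z = y].
have PsiP u y : 0 <= u <= 1 -> Psi u y + D u (Psi u y) = y.
  by move=> u01; have [z hz] := surj u y u01; exact: (@xgetPex _ 0 [set z | z + D u z = y] (ex_intro _ z hz)).
exists Psi; split.
- apply/continuous_normcP => -[u z] e e0.
  have e2 : 0 < e / 2 by rewrite divr_gt0.
  have e4 : 0 < e / 4 by rewrite divr_gt0.
  have near1 : \forall x \near ((u, z) : R * C), normc (x.2 - z) < e / 4.
    have /continuous_normcP := @continuous_snd R C.
    by move=> /(_ (u, z) _ e4).
  have near2 : \forall x \near ((u, z) : R * C), normc (D (clamp x.1) z - D (clamp u) z) < e / 2.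
    have /continuous_normcP := @continuous_comp_fun _ _ _ (@fst R C) _ (@continuous_fst R C) (cD z).
    by move=> /(_ (u, z) _ e2).
  apply: filterS2 near1 near2 => -[u' z'] /= h1 h2.
  have h3 := lip _ z' z (clamp_itv u').
  have : normc (z' + D (clamp u') z' - (z + D (clamp u) z)) <=
      normc (z' - z) + (normc (D (clamp u') z' - D (clamp u') z) + normc (D (clamp u') z - D (clamp u) z)).
    rewrite (_ : _ - (z + _) = (z' - z) + ((D (clamp u') z' - D (clamp u') z) + (D (clamp u') z - D (clamp u) z))).
      by apply: le_trans (le_normcD _ _) _; rewrite lerD2l le_normcD.
    by ring.
  have : c * normc (z' - z) <= normc (z' - z) by rewrite ler_piMl ?normc_ge0 // ltW.
  lra.
- apply/continuous_normcP => -[u y] e e0.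
  have c10 : 0 < 1 - c by rewrite subr_gt0.
  have e2 : 0 < (1 - c) * e / 2 by rewrite divr_gt0 // mulr_gt0.
  set z := Psi (clamp u) y.
  have near1 : \forall x \near ((u, y) : R * C), normc (x.2 - y) < (1 - c) * e / 2.
    have /continuous_normcP := @continuous_snd R C.
    by move=> /(_ (u, y) _ e2).
  have near2 : \forall x \near ((u, y) : R * C), normc (D (clamp x.1) z - D (clamp u) z) < (1 - c) * e / 2.
    have /continuous_normcP := @continuous_comp_fun _ _ _ (@fst R C) _ (@continuous_fst R C) (cD z).
    by move=> /(_ (u, y) _ e2).
  apply: filterS2 near1 near2 => -[u' y'] /= h1 h2.
  rewrite -/z; set z' := Psi (clamp u') y'.
  have h3 := lip _ z' z (clamp_itv u').
  have E1 := PsiP _ y (clamp_itv u); have E2 := PsiP _ y' (clamp_itv u').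
  rewrite -/z in E1; rewrite -/z' in E2.
  have : normc (z' - z) <= normc (y' - y) + (normc (D (clamp u') z' - D (clamp u') z) + normc (D (clamp u') z - D (clamp u) z)).
    have -> : z' - z = (y' - y) - ((D (clamp u') z' - D (clamp u') z) + (D (clamp u') z - D (clamp u) z)).
      by rewrite -E1 -E2; ring.
    apply: le_trans (le_normcD _ _) _; rewrite normcN lerD2l.
    exact: le_normcD.
  move=> h4; rewrite -(ltr_pM2l c10); lra.
- move=> u u01; split.
    by move=> z; apply: (inj u) => //; exact: PsiP.
  by move=> y; exact: PsiP.
Qed.

(** A cone of height [v] over the disc of radius [rho] about [p], chosen for its explicit Lipschitz
    constant [normc v / rho]. *)
Definition bump (rho : R) (p v z : C) : C := (Num.max 0 (1 - normc (z - p) / rho))%:C * v.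

Lemma bump_out (rho : R) p v z : 0 < rho -> rho <= normc (z - p) -> bump rho p v z = 0.
Proof.
move=> r0 h; rewrite /bump (max_idPl _) ?mul0r //.
by rewrite subr_le0 ler_pdivlMr // mul1r.
Qed.

Lemma bump_center (rho : R) p v : bump rho p v p = v.
Proof. by rewrite /bump subrr normc0 mul0r subr0 (max_idPr ler01) mul1r. Qed.

Lemma bump0 (rho : R) p z : bump rho p 0 z = 0.
Proof. by rewrite /bump mulr0. Qed.

Lemma normc_bump (rho : R) p v z : 0 < rho -> normc (bump rho p v z) <= normc v.
Proof.
move=> r0; rewrite /bump normcM normc_real ger0_norm ?le_max ?lexx //.
rewrite ler_piMl ?normc_ge0 // ge_max ler01 lerBlDr lerDl.
by rewrite divr_ge0 ?normc_ge0 // ltW.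
Qed.

Lemma max0_lip (x y : R) : `|Num.max 0 x - Num.max 0 y| <= `|x - y|.
Proof.
wlog xy : x y / y <= x.
  move=> H; have [/H//|/ltW/H] := leP y x.
  by rewrite distrC [leRHS]distrC.
rewrite [leRHS]ger0_norm ?subr_ge0 //.
have [x0|x0] := leP 0 x; have [y0|y0] := leP 0 y.
- by rewrite ger0_norm ?subr_ge0.
- by rewrite subr0 ger0_norm //; lra.
- by lra.
- by rewrite subrr normr0; lra.
Qed.

Lemma bump_lip (rho : R) p v x y : 0 < rho ->
  normc (bump rho p v x - bump rho p v y) <= normc v / rho * normc (x - y).
Proof.
move=> r0; rewrite /bump -mulrBl -rmorphB /= normcM normc_real.
apply: le_trans (_ : normc (x - y) / rho * normc v <= _); last first.
  by rewrite (_ : normc (x - y) / rho * normc v = normc v / rho * normc (x - y)) //; ring.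
rewrite ler_wpM2r ?normc_ge0 //; apply: le_trans (max0_lip _ _) _.
have -> : 1 - normc (x - p) / rho - (1 - normc (y - p) / rho) =
    (normc (y - p) - normc (x - p)) / rho by ring.
rewrite normrM (@ger0_norm _ rho^-1) ?invr_ge0 ?(ltW r0) //.
rewrite ler_pM2r ?invr_gt0 // ler_norml.
have h1 := ler_dist_normc (y - p) (x - p); have h2 := ler_dist_normc (x - p) (y - p).
rewrite opprB addrA subrK in h1; rewrite opprB addrA subrK in h2.
by rewrite [normc (y - x)]normcB in h1; apply/andP; split; lra.
Qed.

Lemma continuous_bump (S : topologicalType) (rho : R) (p v z : S -> C) :
  continuous p -> continuous v -> continuous z ->
  continuous (fun s => bump rho (p s) (v s) (z s)).
Proof.
move=> cp cv cz; apply: continuous_mulc; last exact: cv.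
apply: (@continuous_comp_fun _ _ _ _ (fun x : R => x%:C)); last exact: continuous_real_complex.
apply: continuous_funmax; first exact: cst_continuous.
apply: continuous_funD; first exact: cst_continuous.
apply: continuous_funN; apply: continuous_funM; last exact: cst_continuous.
apply: (@continuous_comp_fun _ _ _ (fun s => z s - p s) (@normc R)).
  exact: (continuous_subc cz cp).
exact: normc_continuous.
Qed.

(** A displacement of at most half the radius makes the bump a contraction with factor 1/2. *)
Lemma push_point (rho : R) (p q : R -> C) : 0 < rho ->
  continuous (fun u => p (clamp u)) -> continuous (fun u => q (clamp u)) ->
  (forall u, 0 <= u <= 1 -> normc (q u - p u) <= rho / 2) ->
  exists Phi Psi, [/\ mutual_inverses Phi Psi,
    forall u, Phi u (p u) = q u,
    forall u z, p u = q u -> Phi u z = z &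
    forall u z, rho <= normc (z - p u) -> Phi u z = z].
Proof.
move=> r0 cp cq pq.
pose D (u : R) z := bump rho (p u) (q u - p u) z.
have [|||Psi hPsi] := @lipschitz_perturbation D 2^-1.
- by apply/andP; split; lra.
- move=> u x y u01; apply: le_trans (bump_lip _ _ _ _ r0) _.
  rewrite ler_wpM2r ?normc_ge0 // ler_pdivrMr // mulrC; exact: pq.
- move=> z; apply: continuous_bump; [exact: cp| |exact: cst_continuous].
  exact: (continuous_subc cq cp).
exists (fun u z => z + D u z), Psi; split => //.
- by move=> u; rewrite /D bump_center addrC subrK.
- by move=> u z e; rewrite /D e subrr bump0 addr0.
- by move=> u z h; rewrite /D bump_out // addr0.
Qed.

(* Point pushing: a null-homotopy of the loop described by a point is followed
   by an isotopy supported near its trace. *)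
Lemma push_along (L : R * R -> C) (b : C) (rho : R) : 0 < rho -> continuous L ->
  (forall u, 0 <= u <= 1 -> L (u, 0) = b) ->
  (forall s, 0 <= s <= 1 -> L (0, s) = b /\ L (1, s) = b) ->
  exists Phi Psi, [/\ mutual_inverses Phi Psi,
    forall u, 0 <= u <= 1 -> Phi u b = L (u, 1),
    forall z, Phi 0 z = z /\ Phi 1 z = z &
    forall u z, 0 <= u <= 1 ->
      (forall u' s, 0 <= u' <= 1 -> 0 <= s <= 1 -> rho <= normc (z - L (u', s))) -> Phi u z = z].
Proof.
move=> r0 cL L0 L1.
pose P (s : R) := 0 <= s <= 1 -> exists Phi Psi, [/\ mutual_inverses Phi Psi,
    forall u, 0 <= u <= 1 -> Phi u b = L (u, s),
    forall z, Phi 0 z = z /\ Phi 1 z = z &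
    forall u z, 0 <= u <= 1 ->
      (forall u' s, 0 <= u' <= 1 -> 0 <= s <= 1 -> rho <= normc (z - L (u', s))) -> Phi u z = z].
suff : P 1 by apply; exact: itv1.
apply: interval_induction.
  move=> _; exists (fun _ z => z), (fun _ z => z); split => //; first exact: mutual_inverses_id.
  by move=> u u01; rewrite L0.
(* Both [s] and [s'] are compared with [t], so each comparison may use half of the displacement
   [rho / 2] that [push_point] allows. *)
move=> t t01; have r4 : 0 < rho / 4 by rewrite divr_gt0.
have [e e0 he] := uniform_in_first t cL r4.
exists e => // s s' s0 ss' s'1 st s't Ps s'01.
have s01 : 0 <= s <= 1 by rewrite s0 (le_trans ss').
have [Phi [Psi [inv h1 h2 h3]]] := Ps s01.
have cLs x : continuous (fun u => L (clamp u, x)).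
  apply: (@continuous_comp_fun _ _ _ (fun u => (clamp u, x)) L) => //.
  by apply: continuous_pair; [exact: clamp_continuous|exact: cst_continuous].
have [|Phi' [Psi' [inv' k1 k2 k3]]] := @push_point rho (fun u => L (u, s)) (fun u => L (u, s')) r0 (cLs s) (cLs s').
  move=> u u01; apply: le_trans (normc_triangle _ (L (u, t)) _) _.
  by have := he u s' u01 s't; have := he u s u01 st; rewrite normcB; lra.
exists (fun u z => Phi' u (Phi u z)), (fun u z => Psi u (Psi' u z)); split.
- exact: mutual_inverses_comp.
- by move=> u u01; rewrite h1.
- move=> z; have [-> ->] := h2 z.
  have [a0 a1] := L1 s s01; have [b0 b1] := L1 s' s'01.
  by rewrite !k2 ?a0 ?a1 ?b0 ?b1.
- move=> u z u01 hz; rewrite h3 //; apply: k3; exact: hz.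
Qed.

(** The discs of radius [rho] about the points are disjoint, so infinitely many pushes can be made
    at once. *)
Lemma push_separated (b : nat -> C) (beta : nat -> R -> C) (M : nat) (rho : R) : 0 < rho ->
  (forall m l, (M <= m)%N -> (M <= l)%N -> m != l -> 2 * rho <= normc (b m - b l)) ->
  (forall m, continuous (fun u => beta m (clamp u))) ->
  (forall m u, (M <= m)%N -> 0 <= u <= 1 -> normc (beta m u - b m) <= rho / 4) ->
  exists Phi Psi, [/\ mutual_inverses Phi Psi,
    forall m u, (M <= m)%N -> 0 <= u <= 1 -> Phi u (b m) = beta m u,
    forall u z, (forall m, beta m u = b m) -> Phi u z = z &
    forall u z, 0 <= u <= 1 -> normc (Phi u z - z) <= rho].
Proof.
move=> r0 sep cb close.
pose near z := [set m : nat | (M <= m)%N /\ normc (z - b m) < rho].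
pose idx z := xget M (near z).
pose F m u z := bump rho (b m) (beta m u - b m) z.
have uniq z m l : near z m -> near z l -> m = l.
  move=> [Mm zm] [Ml zl]; apply/eqP/negPn/negP => ml.
  have := sep m l Mm Ml ml; have := normc_triangle (b m) z (b l).
  rewrite (normcB (b m) z); lra.
have out z m u : (M <= m)%N -> idx z <> m -> F m u z = 0.
  move=> Mm zm; rewrite /F bump_out // leNgt; apply/negP => h.
  apply: zm; have hm : near z m by [].
  by apply: (uniq z) => //; exact: (@xgetPex _ M (near z) (ex_intro _ m hm)).
have Midx z : (M <= idx z)%N by rewrite /idx; case: xgetP => [m _ []|].
pose D u z := F (idx z) u z.
have Flip m u x y : (M <= m)%N -> 0 <= u <= 1 ->
    normc (F m u x - F m u y) <= 4^-1 * normc (x - y).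
  move=> Mm u01; apply: le_trans (bump_lip _ _ _ _ r0) _.
  by rewrite ler_wpM2r ?normc_ge0 // ler_pdivrMr // mulrC; exact: close.
have [|||Psi hPsi] := @lipschitz_perturbation D 2^-1.
- by apply/andP; split; lra.
- move=> u x y u01; rewrite /D.
  (* For different indices each bump vanishes at the other point, and the two constants 1/4 add up
     to 1/2; this is why the strands are kept within [rho / 4]. *)
  have [e|/eqP ne] := eqVneq (idx x) (idx y).
    rewrite e; apply: le_trans (Flip _ _ _ _ (Midx y) u01) _.
    by rewrite ler_wpM2r ?normc_ge0 //; lra.
  have e1 : F (idx x) u y = 0 by apply: out => // e; apply: ne.
  have e2 : F (idx y) u x = 0 by exact: out.
  have := Flip _ u x y (Midx x) u01; have := Flip _ u x y (Midx y) u01.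
  rewrite e1 e2 subr0 sub0r normcN => h1 h2.
  by apply: le_trans (le_normcD _ _) _; rewrite normcN; lra.
- move=> z; apply: continuous_bump; try exact: cst_continuous.
  by apply: continuous_subc; [exact: cb|exact: cst_continuous].
exists (fun u z => z + D u z), Psi; split => //.
- move=> m u Mm u01; rewrite /D.
  have -> : idx (b m) = m.
    have hm : near (b m) m by split => //; rewrite subrr normc0.
    by apply: (uniq (b m)) => //; exact: (@xgetPex _ M (near (b m)) (ex_intro _ m hm)).
  by rewrite /F bump_center addrC subrK.
- by move=> u z h; rewrite /D /F h subrr bump0 addr0.
- move=> u z u01; rewrite addrC addKr; apply: le_trans (normc_bump _ _ _ r0) _.
  by apply: le_trans (close _ _ (Midx z) u01) _; lra.
Qed.

End Perturbation.

(** * Generators and words *)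

Section FiniteSets.
Context {R : realType}.

Lemma finite_min_pos (T : eqType) (s : seq T) (P : pred T) (f : T -> R) :
  (forall x, x \in s -> P x -> 0 < f x) ->
  exists2 e : R, 0 < e & forall x, x \in s -> P x -> e <= f x.
Proof.
elim: s => [|y s ih] h; first by exists 1.
have [|e e0 he] := ih; first by move=> x xs; apply: h; rewrite inE xs orbT.
have [Py|nPy] := boolP (P y); last first.
  by exists e => // x; rewrite inE => /orP[/eqP -> /(negP nPy)|/he].
exists (Num.min e (f y)); first by rewrite lt_min e0 h // mem_head.
move=> x; rewrite inE ge_min => /orP[/eqP -> _|xs Px]; first by rewrite lexx orbT.
by rewrite he.
Qed.

Lemma sqr_lt_norm (a e : R) : 0 < e -> a ^+ 2 < e ^+ 2 -> `|a| < e.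
Proof.
move=> e0 h; rewrite -(ltr_pXn2r (ltn0Sn 1)) ?nnegrE ?(ltW e0) //.
by rewrite real_normK ?num_real.
Qed.

End FiniteSets.

(** * The horizontal rays with half-circles around the points of V *)

Section Bypass.
Context {R : realType} (V : set R[i]).
Hypothesis finV : finite_set V.
Implicit Types (w z : R[i]) (e r x t : R).

Definition bump_sum e w x : R :=
  \sum_(z \in V `&` [set z | Im z = Im w /\ z <> w]) Num.sqrt (e ^+ 2 - (x - Re z) ^+ 2).

Lemma bypass_rayE e w t : bypass_ray V e w t = (Re w + t) +i* (Im w + bump_sum e w (Re w + t)).
Proof. by []. Qed.

Lemma bump_sum_seq w : exists2 s : seq R[i], uniq s &
  (forall z, z \in s <-> [/\ V z, Im z = Im w & z <> w]) /\
  forall e x, bump_sum e w x = \sum_(z <- s) Num.sqrt (e ^+ 2 - (x - Re z) ^+ 2).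
Proof.
have : finite_set (V `&` [set z | Im z = Im w /\ z <> w]).
  by apply: sub_finite_set finV => z [].
move=> /finite_seqP [s hs]; exists (undup s); first exact: undup_uniq.
split=> [z|e x].
  rewrite mem_undup; have e : [set` s] z = (V `&` [set z | Im z = Im w /\ z <> w]) z by rewrite hs.
  split; first by move=> zs; have : [set` s] z by []; rewrite e => -[? []].
  by move=> [h1 h2 h3]; have : [set` s] z by rewrite e.
rewrite /bump_sum hs (_ : [set` s] = [set` undup s]); first by rewrite -fsbig_seq ?undup_uniq.
by apply/seteqP; split => z /=; rewrite mem_undup.
Qed.

Lemma bump_sum_ge0 e w x : 0 <= bump_sum e w x.
Proof. by apply: fsumr_ge0 => z _; exact: sqrtr_ge0. Qed.

Lemma bump_sum_ge e w x z : V z -> Im z = Im w -> z <> w ->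
  Num.sqrt (e ^+ 2 - (x - Re z) ^+ 2) <= bump_sum e w x.
Proof.
move=> Vz zw nzw; have [s us [hs ->]] := bump_sum_seq w.
rewrite (bigD1_seq z) //=; last exact/hs.
by rewrite lerDl sumr_ge0 // => y _; exact: sqrtr_ge0.
Qed.

Lemma same_line_dist r e w z z' : small_radius V r e -> V z -> V z' -> z <> z' ->
  Im z = Im w -> Im z' = Im w -> 2 * e < `|Re z - Re z'|.
Proof.
move=> [e0 _ h] Vz Vz' zz' e1 e2; have := h _ _ Vz Vz' zz'.
have := normc_le_Re_Im (z - z'); rewrite ReB ImB e1 e2 subrr normr0; lra.
Qed.

(* The half-circles over distinct points of a line do not overlap. *)
Lemma bump_sum_cases r e w x : small_radius V r e ->
  bump_sum e w x = 0 \/ exists z, [/\ V z, Im z = Im w, z <> w, (x - Re z) ^+ 2 < e ^+ 2 &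
    bump_sum e w x = Num.sqrt (e ^+ 2 - (x - Re z) ^+ 2)].
Proof.
move=> sr; have [s us [hs sE]] := bump_sum_seq w.
have [[z [zs hz]]|h] := pselect (exists z, z \in s /\ (x - Re z) ^+ 2 < e ^+ 2).
  right; exists z; have [Vz zw nzw] := (hs z).1 zs; split => //.
  rewrite sE (bigD1_seq z) //= [X in _ + X]big_seq_cond big1 ?addr0 // => y /andP[ys yz].
  have [Vy yw nyw] := (hs y).1 ys.
  apply/eqP; rewrite sqrtr_eq0 subr_le0 leNgt; apply/negP => hy.
  have [e0 _ _] := sr.
  have h1 : `|x - Re z| < e.
    exact: sqr_lt_norm.
  have h2 : `|x - Re y| < e.
    exact: sqr_lt_norm.
  have := same_line_dist sr Vy Vz (elimN eqP yz) yw zw.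
  have := ler_distD x (Re y) (Re z); rewrite [`|Re y - x|]distrC; lra.
left; rewrite sE big_seq_cond big1 // => y /andP[ys _].
apply/eqP; rewrite sqrtr_eq0 subr_le0 leNgt; apply/negP => hy.
by apply: h; exists y.
Qed.

Lemma bump_sum_le r e w x : small_radius V r e -> bump_sum e w x <= e.
Proof.
move=> sr; have [e0 _ _] := sr.
case: (bump_sum_cases w x sr) => [->|[z [_ _ _ hz ->]]]; first exact: ltW.
rewrite -{2}(ger0_norm (ltW e0)) -sqrtr_sqr ler_wsqrtr // gerBl sqr_ge0 //.
Qed.

(** A point of [V] on the same line is passed at height at least [e]. A point off the line could be
    met only on a half-circle, at distance [e] from its centre, while points of [V] are more than
    [2 * e] apart. *)
Lemma bypass_avoids r e w t z : small_radius V r e -> V w -> 0 <= t -> (z = w -> 0 < t) ->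
  V z -> bypass_ray V e w t <> z.
Proof.
move=> sr Vw t0 zw Vz; rewrite bypass_rayE => hz; have [e0 _ dist] := sr.
have [hR hI] : Re z = Re w + t /\ Im z = Im w + bump_sum e w (Re w + t) by rewrite -hz.
have [e1|/eqP ne] := eqVneq (Im z) (Im w).
  have [e2|/eqP nzw] := eqVneq z w.
    by have := zw e2; move: hR; rewrite e2; lra.
  have := bump_sum_ge e (Re w + t) Vz e1 nzw.
  rewrite -hR subrr expr0n subr0 sqrtr_sqr ger0_norm ?(ltW e0) //.
  by move: hI; rewrite e1 -hR; lra.
case: (bump_sum_cases w (Re w + t) sr) => [h0|[z' [Vz' z'w nz'w hz' hb]]].
  by apply: ne; rewrite hI h0 addr0.
have nzz' : z <> z' by move=> e2; apply: ne; rewrite e2.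
have : (2 * e) ^+ 2 < normc (z - z') ^+ 2.
  by rewrite ltr_sqr ?nnegrE ?normc_ge0 ?dist // mulr_ge0 // ltW.
rewrite sqr_normc_Re_Im ReB ImB z'w hI [Im w + _ - _]addrC addKr hb hR.
rewrite sqr_sqrtr ?subr_ge0 ?(ltW hz') //.
have : 0 < e ^+ 2 by rewrite exprn_gt0.
rewrite exprMn; lra.
Qed.

Lemma continuous_sqr (T : topologicalType) (f : T -> R) :
  continuous f -> continuous (fun y => f y ^+ 2).
Proof. by move=> cf; exact: (continuous_funM cf cf). Qed.

Lemma continuous_bump_sum (T : topologicalType) w (e x : T -> R) :
  continuous e -> continuous x -> continuous (fun y => bump_sum (e y) w (x y)).
Proof.
move=> ce cx; have [s us [hs sE]] := bump_sum_seq w.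
have -> : (fun y => bump_sum (e y) w (x y)) =
  (fun y => \sum_(z <- s) Num.sqrt (e y ^+ 2 - (x y - Re z) ^+ 2)).
  by apply/funext => y; rewrite sE.
elim: s {us hs sE} => [|z s ih].
  have -> : (fun y => \sum_(z <- [::]) Num.sqrt (e y ^+ 2 - (x y - Re z) ^+ 2)) = fun=> 0.
    by apply/funext => y; rewrite big_nil.
  exact: cst_continuous.
have -> : (fun y => \sum_(z <- z :: s) Num.sqrt (e y ^+ 2 - (x y - Re z) ^+ 2)) =
  fun y => Num.sqrt (e y ^+ 2 - (x y - Re z) ^+ 2) +
           \sum_(z <- s) Num.sqrt (e y ^+ 2 - (x y - Re z) ^+ 2).
  by apply/funext => y; rewrite big_cons.
apply: continuous_funD => //.
apply: (@continuous_comp_fun _ _ _ (fun y => e y ^+ 2 - (x y - Re z) ^+ 2) Num.sqrt); last first.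
  exact: sqrt_continuous.
apply: continuous_funD; first exact: continuous_sqr.
apply: continuous_funN; apply: continuous_sqr.
by apply: continuous_funD => //; exact: cst_continuous.
Qed.

Lemma continuous_bypass (T : topologicalType) w (e t : T -> R) :
  continuous e -> continuous t -> continuous (fun y => bypass_ray V (e y) w (t y)).
Proof.
move=> ce ct; have c2 : continuous (fun y => Re w + t y).
  by apply: continuous_funD => //; exact: cst_continuous.
apply: (continuous_complex c2).
apply: continuous_funD; first exact: cst_continuous.
exact: (continuous_bump_sum ce c2).
Qed.

Lemma bypass_Re e w t : Re (bypass_ray V e w t) = Re w + t. Proof. by []. Qed.

Lemma bypass0 r e w t : small_radius V r e -> V w -> 0 <= t <= e -> bypass_ray V e w t = w + t%:C.
Proof.
move=> sr Vw /andP[t0 te]; rewrite bypass_rayE.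
suff -> : bump_sum e w (Re w + t) = 0 by case: w Vw => a b Vw; rewrite !addr0 /=; congr (_ +i* _); rewrite addr0.
case: (bump_sum_cases w (Re w + t) sr) => // -[z [Vz zw nzw hz _]]; exfalso.
have [e0 _ _] := sr.
have h1 : `|Re w + t - Re z| < e.
  exact: sqr_lt_norm.
have := same_line_dist sr Vw Vz (not_eq_sym nzw) erefl zw.
have := ler_normD (Re w + t - Re z) (- t); rewrite addrAC addrK normrN (ger0_norm t0).
lra.
Qed.

End Bypass.

Section Families.
Context {R : realType}.

Lemma continuous_cat_family (P Q : R * R -> sphere R) : continuous P -> continuous Q ->
  (forall u, P (u, 1) = Q (u, 0)) ->
  continuous (fun x : R * R =>
    path_cat (fun t => P (x.1, t)) (fun t => Q (x.1, t)) (clamp x.2)).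
Proof.
move=> cP cQ PQ.
have cl (k l : R) : continuous (fun x : R * R => (x.1, k * clamp x.2 + l)).
  apply: continuous_pair; first exact: continuous_fst.
  apply: (@continuous_comp_fun _ _ _ (fun x : R * R => x.2) (fun t => k * clamp t + l)).
    exact: continuous_snd.
  apply: (@continuous_comp_fun _ _ _ clamp (fun t => k * t + l)).
    exact: clamp_continuous.
  exact: continuous_scale.
have -> : (fun x : R * R => path_cat (fun t => P (x.1, t)) (fun t => Q (x.1, t)) (clamp x.2)) =
  (fun x : R * R => if clamp x.2 <= 2^-1 then P (x.1, 2 * clamp x.2 + 0)
                    else Q (x.1, 2 * clamp x.2 + (- 1))).
  by apply/funext => x; rewrite /path_cat addr0.
apply: continuous_if_le.
- by apply: (@continuous_comp_fun _ _ _ (fun x : R * R => (x.1, 2 * clamp x.2 + 0)) P).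
- by apply: (@continuous_comp_fun _ _ _ (fun x : R * R => (x.1, 2 * clamp x.2 + (- 1))) Q).
- apply: (@continuous_comp_fun _ _ _ (fun x : R * R => x.2) clamp).
    exact: continuous_snd.
  exact: clamp_continuous.
- exact: cst_continuous.
- by move=> x ->; rewrite divff ?pnatr_eq0 // addr0 subrr PQ.
Qed.

Lemma interp_lt (u x y c : R) : 0 <= u <= 1 -> x < c -> y < c -> (1 - u) * x + u * y < c.
Proof.
move=> /andP[u0 u1] xc yc.
have [->|u10] := eqVneq u 1; first by rewrite subrr mul0r add0r mul1r.
have h1 : 0 < (1 - u) * (c - x) by rewrite mulr_gt0 ?subr_gt0 // lt_neqAle u10.
have h2 : 0 <= u * (c - y) by rewrite mulr_ge0 // subr_ge0 ltW.
lra.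
Qed.

End Families.

(** * Loops of words, their independence of the radius, and reduction *)

Section WordLoops.
Context {R : realType} (V : set R[i]).
Hypothesis finV : finite_set V.
Implicit Types (w z : R[i]) (e r : R).
Let X r := punctured_half_plane V r.

Lemma small_radius_interp r e e' u : small_radius V r e -> small_radius V r e' ->
  0 <= u <= 1 -> small_radius V r ((1 - u) * e + u * e').
Proof.
move=> [e0 h1 h2] [e'0 h1' h2'] /andP[u0 u1]; split.
- have [->|u10] := eqVneq u 1; first by rewrite subrr mul0r add0r mul1r.
  by rewrite ltr_pwDl ?mulr_ge0 ?(ltW e'0) // mulr_gt0 // subr_gt0 lt_neqAle u10.
- move=> w Vw; have := @interp_lt _ u (r + e) (r + e') (Re w).
  by rewrite u0 u1 => /(_ isT (h1 _ Vw) (h1' _ Vw)); lra.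
- move=> w z Vw Vz wz; have := @interp_lt _ u (2 * e) (2 * e') (normc (w - z)).
  by rewrite u0 u1 => /(_ isT (h2 _ _ Vw Vz wz) (h2' _ _ Vw Vz wz)); lra.
Qed.

Lemma small_radius_le r r' e : r' <= r -> small_radius V r e -> small_radius V r' e.
Proof.
by move=> rr [e0 h1 h2]; split => // w Vw; apply: le_lt_trans (h1 _ Vw); rewrite lerD2r.
Qed.

Lemma bypass_in r e w t : small_radius V r e -> V w -> 0 < t -> X r (Some (bypass_ray V e w t)).
Proof.
move=> sr Vw t0; apply: half_plane_Some.
  by rewrite bypass_Re; have [e0 h _] := sr; have := h _ Vw; lra.
move=> h; exact: (bypass_avoids finV sr Vw (ltW t0) (fun _ => t0) h erefl).
Qed.

Lemma circle_in r e w t : small_radius V r e -> V w -> X r (clockwise_circle e w t).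
Proof.
move=> sr Vw; have [e0 h1 h2] := sr; apply: half_plane_Some.
  rewrite ReD /=; have := h1 _ Vw; have := cos_geN1 (2 * pi * t); nra.
move=> Vz; set z := w + _ in Vz.
have nz : normc (w - z) = e.
  rewrite /z opprD addrA subrr sub0r normcN /= sqrrN !exprMn -mulrDr cos2Dsin2 mulr1.
  by rewrite sqrtr_sqr ger0_norm // ltW.
have wz : w <> z by move=> wz; move: nz e0; rewrite -wz subrr normc0 => <-; rewrite ltxx.
by have := h2 _ _ Vw Vz wz; rewrite nz; lra.
Qed.

Lemma bypass_far e w (M : R) : exists T, forall t, T <= t -> M < normc (bypass_ray V e w t).
Proof.
exists (M + 1 - Re w) => t Tt.
by have := Re_le_normc (bypass_ray V e w t); rewrite bypass_Re ler_norml; lra.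
Qed.

Section TwoRadii.
Variables (r e e' : R) (w : R[i]).
Hypotheses (sr : small_radius V r e) (sr' : small_radius V r e') (Vw : V w).
Let E u := (1 - u) * e + u * e'.

Let cE : continuous (fun x : R * R => E x.1).
Proof.
have c1 : continuous (fun x : R * R => x.1) by exact: continuous_fst.
by apply: continuous_interp => //; exact: cst_continuous.
Qed.

Let srE u : 0 <= u <= 1 -> small_radius V r (E u).
Proof. exact: small_radius_interp. Qed.

(** The radius is left free in [curve_words]. The conditions on it are convex, so two admissible
    radii are joined by interpolation. *)
Lemma bypass_homot :
  homot (X r) (path_to_infty (bypass_ray V e w)) (path_to_infty (bypass_ray V e' w)).
Proof.
have cG : continuous (fun x : R * R => bypass_ray V (E x.1) w x.2).
  by apply: continuous_bypass => //; exact: continuous_snd.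
have H : continuous (fun x : R * R =>
    path_to_infty (fun s => bypass_ray V (E (clamp x.1)) w s) (clamp x.2)).
  apply: (continuous_to_infinity cG) => M; exists (M + 1 - Re w) => u s _ Ts.
  have := Re_le_normc (bypass_ray V (E u) w s); rewrite bypass_Re ler_norml; lra.
exists (fun x => path_to_infty (fun s => bypass_ray V (E (clamp x.1)) w s) (clamp x.2)).
split => //=.
- by move=> t t01; rewrite clamp0 clamp1 clamp_id // /E subr0 subrr !mul0r !mul1r addr0 add0r.
- move=> u u01; rewrite clamp0 clamp1 !path_to_infty0 !path_to_infty1 !(@bypass0 _ _ finV r) //.
  + by have [/ltW e0 _ _] := sr; rewrite lexx e0.
  + by apply: srE; exact: clamp_itv.
  + by have [/ltW e0 _ _] := srE (clamp_itv u); rewrite lexx e0.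
- move=> u t u01 t01; rewrite (clamp_id u01) (clamp_id (ltW_itv t01)) /path_to_infty.
  have /andP[t0 ->] := t01; apply: bypass_in => //; first exact: srE.
  by rewrite divr_gt0 // subr_gt0; case/andP: t01.
Qed.

Lemma generator_homot : homot (X r) (generator V e w) (generator V e' w).
Proof.
pose T (x : R * R) := path_to_infty (fun s => bypass_ray V (E (clamp x.1)) w (E (clamp x.1) + s)) (clamp x.2).
pose Ci (x : R * R) := clockwise_circle (E (clamp x.1)) w x.2.
have cG : continuous (fun x : R * R => bypass_ray V (E x.1) w (E x.1 + x.2)).
  apply: continuous_bypass => //.
  by apply: continuous_funD => //; exact: continuous_snd.
have cT : continuous T.
  apply: (continuous_to_infinity cG) => M; exists (M + 1 - Re w) => u s u01 Ts.
  have := Re_le_normc (bypass_ray V (E u) w (E u + s)); rewrite bypass_Re ler_norml.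
  by have [e0 _ _] := srE u01; lra.
have cTR : continuous (fun x : R * R => T (x.1, 1 - x.2)).
  apply: (@continuous_comp_fun _ _ _ (fun x : R * R => (x.1, 1 - x.2)) T) => //.
  apply: continuous_pair; first exact: continuous_fst.
  apply: continuous_funD; first exact: cst_continuous.
  by apply: continuous_funN; exact: continuous_snd.
have cEc : continuous (fun x : R * R => E (clamp x.1)).
  apply: (@continuous_comp_fun _ _ _ (fun x : R * R => (clamp x.1, x.2)) (fun x : R * R => E x.1)) => //.
  apply: continuous_pair; last exact: continuous_snd.
  apply: (@continuous_comp_fun _ _ _ (fun x : R * R => x.1) clamp).
    exact: continuous_fst.
  exact: clamp_continuous.
have cang : continuous (fun x : R * R => 2 * pi * x.2).
  by apply: continuous_funM; [exact: cst_continuous|exact: continuous_snd].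
have cCi : continuous Ci.
  apply: continuous_Some; apply: continuous_addc; first exact: cst_continuous.
  apply: continuous_complex.
    apply: continuous_funM => //.
    by apply: (@continuous_comp_fun _ _ _ (fun x : R * R => 2 * pi * x.2) cos) => //; exact: continuous_cos.
  apply: continuous_funN; apply: continuous_funM => //.
  by apply: (@continuous_comp_fun _ _ _ (fun x : R * R => 2 * pi * x.2) sin) => //; exact: continuous_sin.
have T0 u : T (u, 0) = Some (w + (E (clamp u))%:C).
  rewrite /T /= clamp0 path_to_infty0 addr0 (@bypass0 _ _ finV r) //.
    by apply: srE; exact: clamp_itv.
  by have [/ltW e0 _ _] := srE (clamp_itv u); rewrite lexx e0.
have Ci0 u : Ci (u, 0) = Some (w + (E (clamp u))%:C).
  by rewrite /Ci /clockwise_circle /= mulr0 cos0 sin0 mulr0 mulr1 oppr0.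
have Ci1 u : Ci (u, 1) = Some (w + (E (clamp u))%:C).
  rewrite /Ci /clockwise_circle /= mulr1.
  have -> : 2 * pi = pi *+ 2 :> R by rewrite mulr2n; ring.
  by rewrite cos2pi sin2pi mulr0 mulr1 oppr0.
pose In (x : R * R) := path_cat (fun t => Ci (x.1, t)) (fun t => T (x.1, t)) (clamp x.2).
have cIn : continuous In.
  by apply: continuous_cat_family => // u; rewrite Ci1 T0.
pose G (x : R * R) := path_cat (fun t => T (x.1, 1 - t)) (fun t => In (x.1, t)) (clamp x.2).
have cGG : continuous G.
  apply: (@continuous_cat_family _ (fun x => T (x.1, 1 - x.2)) In) => // u /=.
  by rewrite subrr T0 /In /= clamp0 path_cat0 Ci0.
have GE u t : 0 <= u <= 1 -> 0 <= t <= 1 -> G (u, t) = generator V (E u) w t.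
  move=> u01 t01; rewrite /G /generator /= clamp_id //.
  have [t0 t1] := andP t01.
  have TE s : 0 <= s <= 1 -> T (u, s) = path_to_infty (fun s => bypass_ray V (E u) w (E u + s)) s.
    by move=> s01; rewrite /T /= !clamp_id.
  rewrite /path_cat; case: (leP t 2^-1) => t2.
    by rewrite /path_rev -TE //; apply/andP; split; lra.
  rewrite /In /= clamp_id; last by apply/andP; split; lra.
  rewrite /path_cat; case: (leP (2 * t - 1) 2^-1) => t3; first by rewrite /Ci /= clamp_id.
  by rewrite -TE //; apply/andP; split; lra.
have TA u t : X r (T (u, t)).
  rewrite /T /= /path_to_infty; case: ltP => t11; last by right.
  have sru := srE (clamp_itv u); apply: (bypass_in sru Vw).
  have [e0 _ _] := sru; apply: (lt_le_trans e0).
  by rewrite lerDl divr_ge0 ?subr_ge0 ?(ltW t11) //; have /andP[] := clamp_itv t.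
have E0 : E 0 = e by rewrite /E subr0 mul1r mul0r addr0.
have E1 : E 1 = e' by rewrite /E subrr mul0r mul1r add0r.
have end0 e1 : generator V e1 w 0 = None.
  by rewrite /generator path_cat0 path_rev0 path_to_infty1.
have end1 e1 : generator V e1 w 1 = None.
  by rewrite /generator !path_cat1 path_to_infty1.
exists G; split => //.
- by move=> t t01; rewrite !GE ?itv0 ?itv1 // E0 E1.
- by move=> u u01; rewrite !GE ?itv0 ?itv1 // !end0 !end1.
- move=> u t u01 /andP[t0 t1]; rewrite /G /= clamp_id ?(ltW t0) ?(ltW t1) //.
  rewrite /path_cat; case: (leP t 2^-1) => t2.
    exact: TA.
  rewrite /In /= clamp_id; last by apply/andP; split; lra.
  rewrite /path_cat; case: (leP (2 * t - 1) 2^-1) => t3.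
    by apply: circle_in => //; apply: srE; exact: clamp_itv.
  exact: TA.
Qed.

End TwoRadii.

Lemma generator_path r e w : small_radius V r e -> V w ->
  path_from_to (X r) None None (generator V e w).
Proof.
move=> sr Vw; split.
- exact: homot_path_l (generator_homot sr sr Vw).
- by rewrite /generator path_cat0 path_rev0 path_to_infty1.
- by rewrite /generator !path_cat1 path_to_infty1.
- by right.
- by right.
Qed.

Definition letters (m : word R) := forall x, x \in m -> V x.1.

Definition letter_loop e (x : R[i] * bool) :=
  if x.2 then generator V e x.1 else path_rev (generator V e x.1).

Lemma letter_path r e x : small_radius V r e -> V x.1 ->
  path_from_to (X r) None None (letter_loop e x).
Proof.
move=> sr Vx; rewrite /letter_loop; case: ifP => _; first exact: generator_path.
exact/path_from_to_rev/generator_path.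
Qed.

Lemma word_loop_comp e (m : word R) t : 0 <= t <= 1 ->
  word_loop V e m t = concat None [seq letter_loop e x | x <- m] t.
Proof.
elim: m t => [|[w b] m ih] t //= t01.
have -> : letter_loop e (w, b) 1 = None.
  rewrite /letter_loop /=; case: b; first by rewrite /generator !path_cat1 path_to_infty1.
  by rewrite path_rev1 /generator path_cat0 path_rev0 path_to_infty1.
rewrite {1}/letter_loop /path_cat; case: ifP => // t2; apply: ih.
by move: t2 t01 => /negbT; rewrite -ltNge => ? /andP[? ?]; apply/andP; split; lra.
Qed.

Lemma chain_letters r e m : small_radius V r e -> letters m ->
  chain (X r) None [seq letter_loop e x | x <- m] None.
Proof.
move=> sr; elim: m => [|x m ih] hm /=; first by split => //; right.
apply: chain_cons; first by apply: letter_path => //; apply: hm; exact: mem_head.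
by apply: ih => y ym; apply: hm; rewrite inE ym orbT.
Qed.

Lemma word_loop_homot_comp r e m : small_radius V r e -> letters m ->
  homot (X r) (word_loop V e m) (concat None [seq letter_loop e x | x <- m]).
Proof.
move=> sr hm; apply/homot_sym/homot_of_eq.
  by move=> t t01; rewrite word_loop_comp.
by have [] := chain_path (chain_letters sr hm).
Qed.

Lemma word_loop_path r e m : small_radius V r e -> letters m ->
  path_from_to (X r) None None (word_loop V e m).
Proof.
move=> sr hm; apply: homot_path_from_to (homot_sym (word_loop_homot_comp sr hm)) _.
exact: chain_path (chain_letters sr hm).
Qed.

Lemma word_loop_homot r e e' m : small_radius V r e -> small_radius V r e' -> letters m ->
  homot (X r) (word_loop V e m) (word_loop V e' m).
Proof.
move=> sr sr'; elim: m => [|[w b] m ih] hm.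
  by apply: homot_refl; have [] := word_loop_path sr hm.
have hm' : letters m by move=> y ym; apply: hm; rewrite inE ym orbT.
have Vw : V w by apply: (hm (w, b)); exact: mem_head.
have gh := generator_homot sr sr' Vw.
have [_ w0 _ _ _] := word_loop_path sr hm'.
have [_ _ l1 _ _] := letter_path (x := (w, b)) sr Vw.
rewrite /letter_loop /= in l1.
rewrite /=; apply: cat_hom.
- by case: b {hm l1} => //; exact: rev_hom.
- exact: ih.
- by rewrite l1 w0.
- by rewrite l1; right.
Qed.

(** Both curves are the bypassing ray followed by the loop of [m], up to the choice of radius. The
    freedom in [r] makes room for legs moved by an isotopy. *)
Lemma common_word (g g' : R -> R[i]) m : g 0 = g' 0 -> V (g 0) ->
  curve_words V g m -> curve_words V g' m ->
  exists r0, forall r, r <= r0 -> homot (X r) (path_to_infty g) (path_to_infty g').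
Proof.
move=> gg' Vg [[_ hm] [r1 [e [l [_ sr [l0 l1] h1 h2]]]]].
move=> [_ [r2 [e' [l' [_ sr' [l'0 l'1] h1' h2']]]]].
move: h1 h2 h1' h2' => /homotopic_inP h1 /homotopic_inP h2 /homotopic_inP h1' /homotopic_inP h2'.
exists (Num.min r1 r2) => r; rewrite le_min => /andP[rr1 rr2].
have s1 := @half_plane_subset _ V _ _ rr1; have s2 := @half_plane_subset _ V _ _ rr2.
have sre := small_radius_le rr1 sr; have sre' := small_radius_le rr2 sr'.
have bh := bypass_homot sre sre' Vg.
apply: homot_trans (homot_sym (homot_subset s1 h1)) _.
apply: homot_trans _ (homot_subset s2 h1').
rewrite -gg'; apply: cat_hom => //.
- apply: homot_trans (homot_subset s1 h2) _.
  apply: homot_trans _ (homot_sym (homot_subset s2 h2')).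
  exact: word_loop_homot.
- by rewrite path_to_infty1 l0.
- by rewrite path_to_infty1; right.
Qed.

(** Elements of [free_group] are reduced. A letter put in front of a reduced word either leaves it
    reduced or cancels its first letter. *)
Lemma reduce_word r e m : small_radius V r e -> letters m ->
  exists2 m', free_group V m' & homot (X r) (word_loop V e m) (word_loop V e m').
Proof.
move=> sr; elim: m => [|[w b] m ih] hm.
  by exists [::] => //; apply: homot_refl; have [] := word_loop_path sr hm.
have hm1 : letters m by move=> y ym; apply: hm; rewrite inE ym orbT.
have Vw : V w by apply: (hm (w, b)); exact: mem_head.
have [m1 [s1 l1] h1] := ih hm1.
have lp c := letter_path (x := (w, c)) sr Vw.
have step : homot (X r) (word_loop V e ((w, b) :: m)) (path_cat (letter_loop e (w, b)) (word_loop V e m1)).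
  have [pl l0 le _ _] := lp b; have [_ w0 _ _ _] := word_loop_path sr hm1.
  apply: (@cat_hom _ _ (letter_loop e (w, b))).
  - exact: homot_refl.
  - exact: h1.
  - exact: (etrans le (esym w0)).
  - by rewrite le; right.
case: m1 s1 l1 h1 step => [|[w' b'] m2] s1 l1 h1 step.
  by exists [:: (w, b)] => //; split => // x; rewrite inE => /eqP ->.
have [/andP[/eqP ww' /eqP bb']|nc] := boolP ((w == w') && (b' == ~~ b)); last first.
  exists [:: (w, b), (w', b') & m2] => //; split; last first.
    by move=> x; rewrite inE => /orP[/eqP ->|/l1].
  rewrite /= in s1 *; rewrite s1 andbT; apply: contraNN nc => /andP[-> bb'] /=.
  by move: bb'; case: (b); case: (b').
exists m2.
  split; first by move: s1 => /=; exact: path_sorted.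
  by move=> x xm; apply: l1; rewrite inE xm orbT.
apply: homot_trans step _; subst w' b'.
have l2 : letters m2 by move=> x xm; apply: l1; rewrite inE xm orbT.
have [pw w0 _ _ _] := word_loop_path sr l2.
have [pl p0 p1 _ _] := lp b.
have -> : word_loop V e ((w, ~~ b) :: m2) = path_cat (path_rev (letter_loop e (w, b))) (word_loop V e m2).
  by rewrite /letter_loop /=; case: (b) => //=; rewrite path_revK.
apply: cat_cat_rev => //; first by rewrite p0 w0.
  by rewrite p0; right.
by rewrite p1; right.
Qed.

End WordLoops.

(** * Every loop is represented by a word *)

Section Convex.
Context {R : realType}.
Local Notation C := R[i].

Lemma local_Some (T : topologicalType) (f : T -> sphere R) (x : T) (z : C) :
  {for x, continuous f} -> f x = Some z ->
  (\forall y \near x, f y = Some (odflt 0 (f y))) /\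
  {for x, continuous (fun y => odflt 0 (f y) : C)}.
Proof.
move=> cf fx; split.
  have h : nbhs (f x) [set y : sphere R | y = Some (odflt 0 y)].
    rewrite fx; apply: (@filterS _ (nbhs (Some z : sphere R)) _ (Some @` setT)).
      by move=> _ [u _ <-].
    by apply: one_point_compactification_some_nbhs; exact: filterT.
  exact: (cf _ h).
move=> A; rewrite /= fx => hA.
have h : nbhs (f x) (Some @` A : set (sphere R)).
  by rewrite fx; exact: one_point_compactification_some_nbhs.
have h2 : \forall y \near x, (Some @` A) (f y) := cf _ h.
by rewrite /nbhs /=; apply: filterS h2 => y [u Au e]; rewrite /= -e.
Qed.

Lemma continuous_odflt (T : topologicalType) (f : T -> sphere R) :
  continuous f -> (forall x, exists z, f x = Some z) ->
  continuous (fun y => odflt 0 (f y) : C).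
Proof. by move=> cf h x; have [z hz] := h x; have [] := local_Some (cf x) hz. Qed.

Definition within_set (S : set (sphere R)) (p : R -> sphere R) :=
  forall t, 0 <= t <= 1 -> S (p t).

Lemma within_cat S p q : within_set S p -> within_set S q -> within_set S (path_cat p q).
Proof.
move=> hp hq t /andP[t0 t1]; rewrite /path_cat; case: (leP t 2^-1) => t2.
  by apply: hp; apply/andP; split; lra.
by apply: hq; apply/andP; split; lra.
Qed.

Lemma within_concat S x l : S x -> (forall p, List.In p l -> within_set S p) ->
  within_set S (concat x l).
Proof.
elim: l x => [|p l ih] x Sx h /=; first by move=> t _.
have hp : within_set S p by apply: h; left.
apply: within_cat => //; apply: ih; first by apply: hp; rewrite ler01 lexx.
by move=> q hq; apply: h; right.
Qed.

Lemma within_rev S p : within_set S p -> within_set S (path_rev p).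
Proof. by move=> h t /andP[t0 t1]; apply: h; apply/andP; split; lra. Qed.

Lemma within_sub S p a b : 0 <= a -> a <= b -> b <= 1 ->
  (forall t, a <= t <= b -> S (p t)) -> within_set S (subpath p a b).
Proof.
move=> a0 ab b1 h t /andP[t0 t1]; apply: h.
have h1 : 0 <= (b - a) * t by rewrite mulr_ge0 // subr_ge0.
have h2 : 0 <= (b - a) * (1 - t) by rewrite mulr_ge0 // subr_ge0.
by apply/andP; split; lra.
Qed.

Definition segment_closed (S : set C) :=
  forall x y (u : R), S x -> S y -> 0 <= u <= 1 -> S (x + u%:C * (y - x)).

Lemma convex_homot (A : set (sphere R)) (S : set C) p q : segment_closed S ->
  (Some @` S : set (sphere R)) `<=` A -> continuous (fun t => p (clamp t)) ->
  continuous (fun t => q (clamp t)) -> within_set (Some @` S) p -> within_set (Some @` S) q ->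
  p 0 = q 0 -> p 1 = q 1 -> homot A p q.
Proof.
move=> cS SA cp cq hp hq e0 e1.
pose P t := odflt 0 (p (clamp t)) : C; pose Q t := odflt 0 (q (clamp t)) : C.
have PE t : 0 <= t <= 1 -> p t = Some (P t) /\ S (P t).
  by move=> t01; rewrite /P clamp_id //; have [z Sz <-] := hp _ t01.
have QE t : 0 <= t <= 1 -> q t = Some (Q t) /\ S (Q t).
  by move=> t01; rewrite /Q clamp_id //; have [z Sz <-] := hq _ t01.
have cP : continuous P.
  by apply: continuous_odflt => // t; have [z _ <-] := hp _ (clamp_itv t); exists z.
have cQ : continuous Q.
  by apply: continuous_odflt => // t; have [z _ <-] := hq _ (clamp_itv t); exists z.
exists (fun x => Some (P x.2 + (x.1)%:C * (Q x.2 - P x.2))); split => /=.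
- apply: continuous_Some.
  have cP2 : continuous (fun x : R * R => P x.2).
    by apply: (@continuous_comp_fun _ _ _ (fun x : R * R => x.2) P); [exact: continuous_snd|exact: cP].
  have cQ2 : continuous (fun x : R * R => Q x.2).
    by apply: (@continuous_comp_fun _ _ _ (fun x : R * R => x.2) Q); [exact: continuous_snd|exact: cQ].
  apply: (continuous_addc cP2); apply: continuous_mulc; last exact: (continuous_subc cQ2 cP2).
  apply: (@continuous_comp_fun _ _ _ (fun x : R * R => x.1) (fun x : R => x%:C)).
    exact: continuous_fst.
  exact: continuous_real_complex.
- move=> t t01; have [-> _] := PE _ t01; have [-> _] := QE _ t01.
  by rewrite mul0r addr0 mul1r addrC subrK.
- move=> u _; rewrite !e0 !e1.
  have [p0 _] := PE _ itv0; have [p1 _] := PE _ itv1.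
  have [q0 _] := QE _ itv0; have [q1 _] := QE _ itv1.
  have -> : P 0 = Q 0 by move: e0; rewrite p0 q0 => -[].
  have -> : P 1 = Q 1 by move: e1; rewrite p1 q1 => -[].
  by rewrite q0 q1 !subrr !mulr0 !addr0.
- move=> u t u01 /ltW_itv t01; apply: SA; have [_ Pt] := PE _ t01; have [_ Qt] := QE _ t01.
  by exists (P t + u%:C * (Q t - P t)) => //; exact: cS.
Qed.

Lemma convex_eqv (A : set (sphere R)) (S : set C) x y l m : segment_closed S ->
  (Some @` S : set (sphere R)) `<=` A -> (Some @` S : set (sphere R)) x ->
  chain A x l y -> chain A x m y ->
  (forall p, List.In p l -> within_set (Some @` S) p) ->
  (forall p, List.In p m -> within_set (Some @` S) p) -> eqv A x y l m.
Proof.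
move=> cS SA Sx hl hm wl wm; split => //.
have [[cp _] p0 p1 _ _] := chain_path hl; have [[cq _] q0 q1 _ _] := chain_path hm.
by apply: (@convex_homot A S); rewrite ?p0 ?q0 ?p1 ?q1 //; exact: within_concat.
Qed.

Lemma segment0 (p q : C) : segment p q 0 = Some p.
Proof. by rewrite /segment mul0r addr0. Qed.

Lemma segment1 (p q : C) : segment p q 1 = Some q.
Proof. by rewrite /segment mul1r addrC subrK. Qed.

Lemma segment_continuous (p q : C) : continuous (segment p q).
Proof.
apply: continuous_Some; apply: continuous_addc; first exact: cst_continuous.
by apply: continuous_mulc; [exact: continuous_real_complex|exact: cst_continuous].
Qed.

Lemma segment_within (S : set C) p q : segment_closed S -> S p -> S q ->
  within_set (Some @` S) (segment p q).
Proof. by move=> cS Sp Sq t t01; exists (p + t%:C * (q - p)) => //; exact: cS. Qed.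

Lemma within_path (A S : set (sphere R)) p : S `<=` A -> continuous (fun t => p (clamp t)) ->
  within_set S p -> path_from_to A (p 0) (p 1) p.
Proof.
move=> SA cp hp; split => //.
- by split => // t /ltW_itv t01; apply: SA; exact: hp.
- by apply: SA; apply: hp; exact: itv0.
- by apply: SA; apply: hp; exact: itv1.
Qed.

Lemma segment_path (A : set (sphere R)) (S : set C) p q : segment_closed S ->
  (Some @` S : set (sphere R)) `<=` A -> S p -> S q ->
  path_from_to A (Some p) (Some q) (segment p q).
Proof.
move=> cS SA Sp Sq; rewrite -(segment0 p q) -(segment1 p q).
apply: (within_path SA); last exact: segment_within.
apply: (@continuous_comp_fun _ _ _ clamp (segment p q)); first exact: clamp_continuous.
exact: segment_continuous.
Qed.

End Convex.

(** * Contraction of the slit half-plane to infinity *)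

Section Flow.
Context {R : realType} (V : set R[i]) (r dl : R).
Local Notation C := R[i].
Hypothesis dl01 : 0 < dl < 1.
Let X := punctured_half_plane V r.

(** A coordinate that is constant along the cuts. Horizontal cuts could contain several points of
    [V]; a small generic slope [dl] separates them. *)
Definition ell (z : C) := Im z - dl * Re z.

(* The complement of the cuts [w - t (1 + dl i)], [t >= 0], [w] in [V]. *)
Definition uncut (z : C) := r < Re z /\ forall w, V w -> ell z = ell w -> Re w < Re z.

Definition uncut_sphere : set (sphere R) := (Some @` uncut) `|` [set None].

Lemma uncut_sub : uncut_sphere `<=` X.
Proof.
move=> _ [[z [rz h] <-]|->]; last by right.
by apply: half_plane_Some => // Vz; have := h z Vz erefl; rewrite ltxx.
Qed.

(** Translation parallel to the cuts and away from them: a contraction of the uncut region to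
    infinity. *)
Definition flow (x : sphere R) (t : R) : sphere R :=
  if x is Some z then path_to_infty (fun s => z + s%:C * (1 +i* dl)) t else None.

Lemma ReD_flow z (s : R) : Re (z + s%:C * (1 +i* dl)) = Re z + s.
Proof. by rewrite ReD ReZ /= mulr1. Qed.

Lemma ell_flow z (s : R) : ell (z + s%:C * (1 +i* dl)) = ell z.
Proof. by rewrite /ell ReD_flow ImD ImZ /=; ring. Qed.

Lemma flow0 x : flow x 0 = x.
Proof. by case: x => [z|] //=; rewrite path_to_infty0 mul0r addr0. Qed.

Lemma flow1 x : flow x 1 = None.
Proof. by case: x => [z|] //=; rewrite path_to_infty1. Qed.

Lemma flow_uncut x t : 0 <= t <= 1 -> uncut_sphere x -> uncut_sphere (flow x t).
Proof.
move=> /andP[t0 t1] [[z [rz h] <-]|->]; last by right.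
rewrite /flow /path_to_infty; case: ltP => t1'; last by right.
have s0 : 0 <= t / (1 - t) by rewrite divr_ge0 // subr_ge0.
left; exists (z + (t / (1 - t))%:C * (1 +i* dl)) => //; split.
  by rewrite ReD_flow; exact: ltr_wpDr.
by move=> w Vw; rewrite ell_flow ReD_flow => /(h w Vw); exact: ltr_wpDr.
Qed.

(** The bound on real parts matters at infinity: a far point to the right of the line of abscissa
    [r] cannot be brought back to a bounded region by moving to the right. *)
Lemma flow_continuous (T : topologicalType) (f : T -> sphere R) (g : T -> R) :
  continuous f -> continuous g -> (forall y z, f y = Some z -> r < Re z) ->
  continuous (fun y => flow (f y) (clamp (g y))).
Proof.
move=> cf cg hf x; have /andP[dl0 dl1] := dl01.
have cc : continuous (fun y => clamp (g y)).
  by apply: (@continuous_comp_fun _ _ _ g clamp) => //; exact: clamp_continuous.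
have g1 y : clamp (g y) < 1 \/ clamp (g y) = 1.
  have /andP[_] := clamp_itv (g y); rewrite le_eqVlt => /orP[/eqP|]; by [right|left].
have [[z fx]|fN] : (exists z, f x = Some z) \/ f x = None.
  by case: (f x) => [z|]; [left; exists z|right].
  have [nf cz] := local_Some (cf x) fx.
  case: (g1 x) => gx.
    pose s y := clamp (g y) / (1 - clamp (g y)).
    apply: (@cvg_to_Some _ _ _ (fun y => odflt 0 (f y) + (s y)%:C * (1 +i* dl))).
      have : \forall y \near x, clamp (g y) < 1 by apply: near_lt => //; exact: cc.
      by apply: filterS2 nf => y -> h; rewrite /flow /path_to_infty h.
    have cs : {for x, continuous s}.
      apply: cvgM; first exact: cc.
      apply: cvgV; first by rewrite gt_eqF // subr_gt0.
      by apply: cvgD; [exact: cvg_cst|apply: cvgN; exact: cc].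
    have cs2 : {for x, continuous (fun y => (s y)%:C)}.
      exact: (@continuous_comp _ _ _ s (fun t : R => t%:C) x cs (@continuous_real_complex R _)).
    exact: (@cvgD C C _ _ _ _ _ _ _ cz (@cvgM C _ _ _ _ _ _ _ cs2 (@cvg_cst _ _ _ _ _))).
  apply: cvg_to_None; first by rewrite fx gx /= path_to_infty1.
  move=> M; pose s0 := 1 - (Num.max 0 (M - r) + 1)^-1.
  have T0 : 0 < Num.max 0 (M - r) + 1 by rewrite ltr_pwDr // le_max lexx.
  have : \forall y \near x, s0 < clamp (g y).
    by apply: near_gt; [exact: cc|rewrite gx /s0 ltrBlDr ltrDl invr_gt0].
  apply: filterS => y ys ze; case fy : (f y) => [z'|//] /=.
  rewrite /path_to_infty; case: ltP => // y1 [<-].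
  have rz' := hf _ _ fy.
  apply: lt_le_trans (le_trans (ler_norm _) (Re_le_normc _)); rewrite ReD_flow.
  suff : M - r <= clamp (g y) / (1 - clamp (g y)) by lra.
  have := ys; rewrite /s0; move: (clamp (g y)) y1 => s s1; rewrite ltrBlDr -ltrBlDl => hs.
  rewrite ler_pdivlMr ?subr_gt0 //.
  have TM : M - r <= Num.max 0 (M - r) by rewrite le_max lexx orbT.
  have M0 : 0 <= Num.max 0 (M - r) by rewrite le_max lexx.
  move: (Num.max 0 (M - r)) TM M0 T0 hs => m TM M0 T0 hs.
  have : (1 - s) * (m + 1) < 1 by rewrite -ltr_pdivlMr // mul1r.
  have : (M - r) * (1 - s) <= m * (1 - s) by rewrite ler_wpM2r // subr_ge0 ltW.
  lra.
apply: cvg_to_None; first by rewrite fN.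
(* A point moved by [s] into the disc of radius [M] satisfies [s <= M - r], and the direction of the
   flow has modulus at most 2. *)
move=> M; pose M' := M + 2 * `|M - r|.
have h : \forall y \near x, forall z, f y = Some z -> M' < normc z.
  have : nbhs (f x) [set y : sphere R | forall z, y = Some z -> M' < normc z].
    by rewrite fN; apply: (@nbhs_None _ _ M') => // z hz _ [<-].
  by move=> /cf.
apply: filterS h => y hy ze; case fy : (f y) => [z'|//] /=.
rewrite /path_to_infty; case: ltP => // y1 [<-].
have rz' := hf _ _ fy; have := hy _ fy.
set s := clamp (g y) / (1 - clamp (g y)).
have s0 : 0 <= s.
  by rewrite /s divr_ge0 ?subr_ge0 ?(ltW y1) //; have /andP[] := clamp_itv (g y).
rewrite !ltNge; apply: contraNN => hM.
have h1 : Re z' + s <= M.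
  by rewrite -ReD_flow; apply: le_trans hM; apply: le_trans (ler_norm _) (Re_le_normc _).
have h2 : normc z' <= M + normc (s%:C * (1 +i* dl)).
  have e : z' = (z' + s%:C * (1 +i* dl)) - s%:C * (1 +i* dl) by rewrite addrK.
  by rewrite {1}e; apply: le_trans (le_normcD _ _) _; rewrite normcN lerD2r.
apply: le_trans h2 _; rewrite /M' lerD2l normcM normc_real (ger0_norm s0).
have h3 : normc (1 +i* dl) <= 2.
  by apply: le_trans (normc_le_Re_Im _) _; rewrite /= normr1 gtr0_norm //; lra.
have h4 : s <= `|M - r| by apply: le_trans (ler_norm _); lra.
have := normc_ge0 (1 +i* dl); nra.
Qed.

Lemma flow_path x : uncut_sphere x -> path_from_to X x None (flow x).
Proof.
move=> hx; have := @within_path _ X uncut_sphere (flow x) uncut_sub.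
rewrite flow0 flow1; apply; last by move=> t t01; exact: flow_uncut.
apply: (@flow_continuous _ (fun=> x) id); [exact: cst_continuous|exact: continuous_idfun|].
by case: hx => [[z [rz _] <-] _ _ [<-]|->].
Qed.

(** The flow lines starting on [p] fill a square whose upper side is collapsed at infinity. *)
Lemma flow_contract p : continuous (fun t => p (clamp t)) -> within_set uncut_sphere p ->
  eqv X (p 0) None [:: p; flow (p 1)] [:: flow (p 0)].
Proof.
move=> cp hp; have pp := within_path uncut_sub cp hp.
have f0 := flow_path (hp 0 itv0); have f1 := flow_path (hp 1 itv1).
apply: eqv_trans (eqv_sym (eqv_path_cat pp f1)) _.
apply: eqv_homot1; first exact: path_from_to_cat pp f1.
pose Q (x : R * R) := flow (p (clamp x.1)) (clamp x.2).
have cQ : continuous Q.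
  apply: (@flow_continuous _ (fun x : R * R => p (clamp x.1)) (fun x : R * R => x.2)).
  - by apply: (@continuous_comp_fun _ _ _ (fun x : R * R => x.1) (fun t => p (clamp t))); [exact: continuous_fst|].
  - exact: continuous_snd.
  - move=> y z e; have := hp _ (clamp_itv y.1); rewrite e.
    by case=> [[z' [rz' _] [<-]]|].
have Q1 x : 0 <= x <= 1 -> Q (x, 1) = Q (0, 1) by rewrite /Q /= clamp1 !flow1.
have QA x y : 0 <= x <= 1 -> 0 <= y <= 1 -> X (Q (x, y)).
  by move=> x01 y01; apply: uncut_sub; apply: flow_uncut; [exact: clamp_itv|exact/hp/clamp_itv].
apply: homot_eq (square_end cQ Q1 QA) => t /andP[t0 t1]; rewrite /Q /=; last first.
  by rewrite clamp0 clamp_id // t0.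
rewrite /path_cat; case: (leP t 2^-1) => t2.
  by rewrite clamp0 flow0 clamp_id //; apply/andP; split; lra.
by rewrite clamp1 [clamp (_ - _)]clamp_id //; apply/andP; split; lra.
Qed.

Lemma flow_contract1 x p : path_from_to X x None p -> within_set uncut_sphere p ->
  eqv X x None [:: p] [:: flow x].
Proof.
move=> hp wp; have [[cp _] p0 p1 _ _] := hp.
have := flow_contract cp wp; rewrite p0 p1; apply: eqv_trans.
have XN : X None by right.
apply: eqv_sym; apply: (@eqv_cat _ _ _ None _ [:: p] [:: p] [:: flow None] [::]).
  exact: eqv_refl (chain1 hp).
exact: eqv_cst.
Qed.

End Flow.

(** * Three arcs of the clockwise circle *)

Section CircleAngles.
Context {R : realType}.
Implicit Types t : R.

Lemma two_pi_sub t : 2 * pi * (1 - t) = - (2 * pi * t) + pi *+ 2 :> R.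
Proof. by rewrite -mulr_natr; ring. Qed.

Lemma sin_two_pi_sub t : sin (2 * pi * (1 - t)) = - sin (2 * pi * t) :> R.
Proof. by rewrite two_pi_sub sinD2pi sinN. Qed.

Lemma cos_two_pi_sub t : cos (2 * pi * (1 - t)) = cos (2 * pi * t) :> R.
Proof. by rewrite two_pi_sub cosD2pi cosN. Qed.

(** The cut leaves the centre to the lower left with slope below 1, so it meets the clockwise circle
    at a time between 3/8 and 1/2. The arcs over [0, 3/8] and [5/8, 1] avoid it, and the arc between
    them lies to the left of the centre. *)
Lemma circle_lower t : 0 <= t <= 3 / 8 ->
  0 <= sin (2 * pi * t) /\ 0 <= sin (2 * pi * t) + cos (2 * pi * t).
Proof.
move=> /andP[t0 t1]; have p0 := @pi_gt0 R.
have h1 : 0 <= 2 * pi * t <= pi * (3 / 4).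
  have h : 2 * pi * t = pi * (2 * t) :> R by ring.
  by rewrite h pmulr_rge0 // ler_pM2l //; apply/andP; split; lra.
have /andP[a0 a1] := h1.
split; first by apply: sin_ge0_pi; rewrite a0 (le_trans a1) //; lra.
have c4 : 0 < cos (pi / 4) :> R by apply: cos_gt0_pihalf; apply/andP; split; lra.
have s4 : sin (pi / 4) = cos (pi / 4) :> R.
  have := @tan_piquarter R; rewrite /tan => /(congr1 ( *%R^~ (cos (pi / 4)))).
  by rewrite divfK ?gt_eqF // mul1r.
have := @sin_ge0_pi R (2 * pi * t + pi / 4); rewrite sinD s4 -mulrDl pmulr_lge0 //.
by apply; apply/andP; split; lra.
Qed.

Lemma circle_upper t : 5 / 8 <= t <= 1 ->
  sin (2 * pi * t) <= 0 /\ 0 <= cos (2 * pi * t) - sin (2 * pi * t).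
Proof.
move=> /andP[t0 t1]; have [|] := @circle_lower (1 - t).
  by apply/andP; split; lra.
by rewrite sin_two_pi_sub cos_two_pi_sub; lra.
Qed.

Lemma circle_left t : 3 / 8 <= t <= 5 / 8 -> cos (2 * pi * t) < 0.
Proof.
move=> /andP[t0 t1]; have p0 := @pi_gt0 R.
have -> : 2 * pi * t = (2 * pi * t - pi) + pi by rewrite subrK.
rewrite cosDpi oppr_lt0; apply: cos_gt0_pihalf.
have h : 2 * pi * t - pi = pi * (2 * t - 1) by ring.
have h2 : pi / 2 = pi * (1 / 2) :> R by ring.
by rewrite h h2 -mulrN !ltr_pM2l //; apply/andP; split; lra.
Qed.

Lemma circle_38 : 0 < sin (2 * pi * (3 / 8)) :> R.
Proof. by have p0 := @pi_gt0 R; apply: sin_gt0_pi; apply/andP; split; lra. Qed.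

End CircleAngles.

(** * Crossing a cut inserts a generator *)

Section Strips.
Context {R : realType} (V : set R[i]) (r e dl eta : R).
Local Notation C := R[i].
Hypothesis finV : finite_set V.
Hypothesis sr : small_radius V r e.
Hypothesis dl01 : 0 < dl < 1.
(** The strips about the cuts are disjoint by [eta_sep], the small circles fit in the width of their
    strips by [e_eta], and the bypassing rays, bumps included, stay below the cuts of higher points
    by [e_gap]. *)
Hypothesis eta_sep : forall w z, V w -> V z -> w <> z -> 2 * eta <= `|ell dl w - ell dl z|.
Hypothesis e_eta : 2 * e < eta.
Hypothesis e_gap : forall w z, V w -> V z -> Im w < Im z ->
  e + dl * `|Re w - Re z| < Im z - Im w.
Let X := punctured_half_plane V r.
Let l := ell dl.
Let A0 := uncut_sphere V r dl.

Let e0 : 0 < e. Proof. by case: sr. Qed.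
Let eta0 : 0 < eta. Proof. by apply: lt_trans e_eta; rewrite mulr_gt0. Qed.

(** An open convex neighbourhood of the part of the cut of [w] in the half-plane; with the uncut
    region, these cover H_r. *)
Definition strip w (z : C) := [/\ r < Re z, Re z < Re w & `|ell dl z - ell dl w| < eta].

Lemma strip_convex w : segment_closed (strip w).
Proof.
move=> x y u [x1 x2 x3] [y1 y2 y3] u01; have /andP[u0 u1] := u01.
have RE : Re (x + u%:C * (y - x)) = (1 - u) * Re x + u * Re y.
  by rewrite ReD ReZ ReB; ring.
have LE : ell dl (x + u%:C * (y - x)) - ell dl w =
    (1 - u) * (ell dl x - ell dl w) + u * (ell dl y - ell dl w).
  by rewrite /ell RE ImD ImZ ImB; ring.
split; rewrite ?RE ?LE.
- have := @interp_lt _ u (- Re x) (- Re y) (- r) u01; rewrite !ltrN2 => /(_ x1 y1); lra.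
- exact: interp_lt.
- move: x3 y3; rewrite !ltr_norml => /andP[a1 a2] /andP[b1 b2]; apply/andP; split; last exact: interp_lt.
  have := @interp_lt _ u (- (ell dl x - ell dl w)) (- (ell dl y - ell dl w)) eta u01.
  rewrite !(ltrNl _ eta) => /(_ a1 b1); lra.
Qed.

Lemma strip_unique w w' z : V w -> V w' -> `|l z - l w| < eta -> `|l z - l w'| < eta -> w = w'.
Proof.
move=> Vw Vw' h h'; apply: contrapT => ww'.
have := eta_sep Vw Vw' ww'; rewrite -/l.
by have := ler_distD (l z) (l w) (l w'); rewrite (distrC (l w) (l z)); lra.
Qed.

Lemma strip_sub w : V w -> (Some @` strip w : set (sphere R)) `<=` X.
Proof.
move=> Vw _ [z [z1 z2 z3] <-]; apply: half_plane_Some => // Vz.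
have zw : z = w by apply: (@strip_unique z w z) => //; rewrite subrr normr0.
by move: z2; rewrite zw ltxx.
Qed.

Lemma near_uncut w z : V w -> r < Re z -> `|l z - l w| < eta -> l z <> l w -> uncut V r dl z.
Proof.
move=> Vw rz h ne; split=> // w' Vw' hw'; exfalso; apply: ne.
have ww' : w' = w by apply: (strip_unique Vw' Vw _ h); rewrite /l hw' subrr normr0.
by rewrite /l hw' ww'.
Qed.

Lemma uncut_or_strip z : X (Some z) -> uncut V r dl z \/ exists2 w, V w & strip w z.
Proof.
case=> [[z' [rz nV] [zz']]|//]; rewrite zz' in rz nV; clear z' zz'.
have [h|h] := pselect (exists w, [/\ V w, ell dl z = ell dl w & Re z <= Re w]).
  have [w [Vw lzw zw]] := h; right; exists w => //; split => //.
    rewrite lt_neqAle zw andbT; apply/eqP => zwE; apply: nV.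
    suff -> : z = w by [].
    move: lzw zwE; rewrite /ell; case: z w {rz zw h Vw} => [a b] [c d] /= h1 h2.
    by rewrite h2 in h1 *; congr (_ +i* _); lra.
  by rewrite lzw subrr normr0.
left; split => // w Vw lzw; rewrite ltNge; apply/negP => zw; apply: h.
by exists w.
Qed.

(** The vertical projection of [z] to a line parallel to the cut of [w], above or below it according
    to the sign of [d]. *)
Definition level (w z : C) (d : R) : C := Re z +i* (Im z + (ell dl w + d - ell dl z)).

Lemma ell_level w z d : ell dl (level w z d) = ell dl w + d.
Proof. by rewrite /ell /level /=; rewrite /ell; ring. Qed.

Lemma strip_level w z d : strip w z -> `|d| < eta -> strip w (level w z d).
Proof. by move=> [z1 z2 z3] dd; split; rewrite ?ell_level // addrAC subrr add0r. Qed.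

Let eta2 : `|eta / 2| < eta.
Proof. by have := eta0 => ?; rewrite gtr0_norm ?divr_gt0 //; lra. Qed.

(* Moving off the cut of [w] to one side (on the side of [d]), then along the flow. *)
Definition side w z (d : R) : seq (R -> sphere R) :=
  [:: segment z (level w z d); flow dl (Some (level w z d))].

Lemma uncut_Some z : uncut V r dl z -> A0 (Some z).
Proof. by move=> h; left; exists z. Qed.

Lemma strip_uncut w z : V w -> strip w z -> l z <> l w -> uncut V r dl z.
Proof. by move=> Vw [z1 z2 z3]; exact: near_uncut. Qed.

Lemma level_uncut w z d : V w -> strip w z -> d <> 0 -> `|d| < eta -> uncut V r dl (level w z d).
Proof.
move=> Vw sz d0 dd; apply: (strip_uncut Vw); first exact: strip_level.
by rewrite /l ell_level => h; apply: d0; lra.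
Qed.

Lemma side_chain w z d : V w -> strip w z -> d <> 0 -> `|d| < eta ->
  chain X (Some z) (side w z d) None.
Proof.
move=> Vw sz d0 dd; apply: chain_cons.
  apply: (@segment_path _ X (strip w)) => //; first exact: strip_convex.
    exact: strip_sub.
  exact: strip_level.
by apply: chain1; apply: flow_path => //; apply: uncut_Some; exact: level_uncut.
Qed.

(** A segment on one side of the cut stays in the uncut region, where the flow contracts it. *)
Lemma same_side w z z' (d : R) : V w -> strip w z -> strip w z' ->
  0 < d * (l z - l w) -> 0 < d * (l z' - l w) ->
  eqv X (Some z) None [:: segment z z'; flow dl (Some z')] [:: flow dl (Some z)].
Proof.
move=> Vw sz sz' dz dz'.
have := @flow_contract _ V r dl dl01 (segment z z'); rewrite segment0 segment1; apply.
  apply: (@continuous_comp_fun _ _ _ clamp (segment z z')); first exact: clamp_continuous.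
  exact: segment_continuous.
move=> t t01; apply: uncut_Some; have /andP[t0 t1] := t01.
apply: (strip_uncut Vw); first exact: strip_convex.
move=> h.
have : d * (l (z + t%:C * (z' - z)) - l w) = (1 - t) * (d * (l z - l w)) + t * (d * (l z' - l w)).
  by rewrite /l /ell ReD ReZ ReB ImD ImZ ImB; ring.
rewrite h subrr mulr0 => h2.
have := @interp_lt _ t (- (d * (l z - l w))) (- (d * (l z' - l w))) 0 t01.
by rewrite !oppr_lt0 => /(_ dz dz'); lra.
Qed.

Lemma side_flow w z d : V w -> strip w z -> `|d| < eta -> 0 < d * (l z - l w) ->
  eqv X (Some z) None (side w z d) [:: flow dl (Some z)].
Proof.
move=> Vw sz dd dz; apply: (@same_side w z _ d) => //; first exact: strip_level.
rewrite /l ell_level addrAC subrr add0r.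
have : d != 0 by apply: contraTneq dz => ->; rewrite mul0r ltxx.
by rewrite -sqrf_eq0 => h; rewrite -expr2 lt_neqAle eq_sym h sqr_ge0.
Qed.

(** In the convex strip, [p] followed by the vertical segment at [z'] can be exchanged for the
    vertical segment at [z] followed by one parallel to the cut; the latter is absorbed by the
    flow. *)
Lemma strip_move w z z' d p : V w -> strip w z -> strip w z' -> d <> 0 -> `|d| < eta ->
  path_from_to X (Some z) (Some z') p -> within_set (Some @` strip w) p ->
  eqv X (Some z) None (p :: side w z' d) (side w z d).
Proof.
move=> Vw sz sz' d0 dd hp wp.
have sl := strip_level sz dd; have sl' := strip_level sz' dd.
have cv := @strip_convex w; have ss := strip_sub Vw.
have seg x y : strip w x -> strip w y -> path_from_to X (Some x) (Some y) (segment x y).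
  by move=> *; exact: (segment_path cv ss).
have wseg x y : strip w x -> strip w y -> within_set (Some @` strip w) (segment x y).
  by move=> *; exact: segment_within.
have fl := flow_path dl01 (uncut_Some (level_uncut Vw sz' d0 dd)).
have E1 : eqv X (Some z) (Some (level w z' d)) [:: p; segment z' (level w z' d)]
    [:: segment z (level w z d); segment (level w z d) (level w z' d)].
  apply: (convex_eqv cv ss); first by exists z.
  - exact: chain_cons hp (chain1 (seg _ _ sz' sl')).
  - exact: chain_cons (seg _ _ sz sl) (chain1 (seg _ _ sl sl')).
  - by move=> q [<-|[<-|[]]] //; exact: wseg.
  - by move=> q [<-|[<-|[]]]; exact: wseg.
apply: eqv_trans (eqv_cat E1 (eqv_refl (chain1 fl))) _ => /=.
apply: (@eqv_cat _ _ _ (Some (level w z d)) _ [:: segment z (level w z d)] [:: segment z (level w z d)]).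
  exact: eqv_refl (chain1 (seg _ _ sz sl)).
have dd0 : 0 < d * d.
  by rewrite -expr2 lt_neqAle eq_sym sqrf_eq0 sqr_ge0 andbT; apply/eqP.
by apply: (@same_side w _ _ d) => //; rewrite /l ell_level addrAC subrr add0r.
Qed.

Section OneGenerator.
Variable w : C.
Hypothesis Vw : V w.
Let Ci := clockwise_circle e w.
Let T := path_to_infty (fun t => bypass_ray V e w (e + t)).
Definition circle_pt (t : R) : C := w + ((e * cos (2 * pi * t)) -i* (e * sin (2 * pi * t))).

Lemma Re_circle t : Re (circle_pt t) = Re w + e * cos (2 * pi * t).
Proof. by rewrite ReD. Qed.

Lemma ell_circle t :
  l (circle_pt t) - l w = - (e * (sin (2 * pi * t) + dl * cos (2 * pi * t))).
Proof. by rewrite /l /ell ReD ImD /=; ring. Qed.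

Lemma circle_close t : `|l (circle_pt t) - l w| < eta.
Proof.
have /andP[d0 d1] := dl01; rewrite ell_circle normrN normrM (gtr0_norm e0).
apply: le_lt_trans e_eta; rewrite mulrC ler_pM2r //.
apply: le_trans (ler_normD _ _) _; rewrite normrM (gtr0_norm d0).
have := sin_max (2 * pi * t); have := cos_max (2 * pi * t); nra.
Qed.

Lemma circle_Re_gt t : r < Re (circle_pt t).
Proof. by case: (circle_in t sr Vw) => [[z [rz _] [zE]]|//]; rewrite /circle_pt -zE. Qed.

Lemma circle_uncut t : (l (circle_pt t) = l w -> 0 < cos (2 * pi * t)) ->
  uncut V r dl (circle_pt t).
Proof.
move=> h; have [|/eqP ne] := eqVneq (l (circle_pt t)) (l w); last first.
  exact: (near_uncut Vw (circle_Re_gt t) (circle_close t)).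
move=> lE; split; first exact: circle_Re_gt.
move=> w' Vw' hw'.
have -> : w' = w.
  by apply: (strip_unique Vw' Vw _ (circle_close t)); rewrite /l hw' subrr normr0.
by rewrite Re_circle ltrDl mulr_gt0 // h.
Qed.

Lemma circle_lower_uncut t : 0 <= t <= 3 / 8 -> A0 (Ci t).
Proof.
move=> t01; have [s0 sc0] := circle_lower t01; have /andP[d0 d1] := dl01.
apply: uncut_Some; apply: circle_uncut => h; exfalso.
have := ell_circle t; rewrite h subrr => /esym/eqP; rewrite oppr_eq0 mulf_eq0 gt_eqF //= => /eqP h2.
have := cos2Dsin2 (2 * pi * t); move: (cos _) (sin _) s0 sc0 h2 => c s s0 sc0 h2.
have c0 : c = 0 by nra.
have : s = 0 by nra.
by move=> ->; rewrite c0; lra.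
Qed.

Lemma circle_upper_uncut t : 5 / 8 <= t <= 1 -> A0 (Ci t).
Proof.
move=> t01; have [s0 sc0] := circle_upper t01; have /andP[d0 d1] := dl01.
apply: uncut_Some; apply: circle_uncut => h.
have := ell_circle t; rewrite h subrr => /esym/eqP; rewrite oppr_eq0 mulf_eq0 gt_eqF //= => /eqP h2.
have := cos2Dsin2 (2 * pi * t); move: (cos _) (sin _) s0 sc0 h2 => c s s0 sc0 h2 h3.
have c0 : 0 <= c by nra.
rewrite lt_neqAle c0 andbT; apply/eqP => c00; move: h2 h3; rewrite -c00; nra.
Qed.

Lemma circle_strip t : 3 / 8 <= t <= 5 / 8 -> strip w (circle_pt t).
Proof.
move=> t01; split; [exact: circle_Re_gt| |exact: circle_close].
by rewrite Re_circle gtrDl pmulr_rlt0 //; exact: circle_left.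
Qed.

(** The cut of a higher point lies above the ray by [e_gap], that of a lower point below it, and a
    point at the same height is bypassed on the side opposite to its cut, which descends to the
    left. *)
Lemma tail_uncut t : 0 <= t <= 1 -> A0 (T t).
Proof.
move=> /andP[t0 t1]; rewrite /T /path_to_infty; case: ltP => t1'; last by right.
have s0 : 0 <= t / (1 - t) by rewrite divr_ge0 // subr_ge0.
move: (t / (1 - t)) s0 => s s0; apply: uncut_Some.
have es0 : 0 < e + s by have := e0; lra.
have /andP[d0 d1] := dl01; split.
  by rewrite bypass_Re; case: sr => _ h _; have := h _ Vw; have := e0; lra.
move=> w' Vw' hw'; rewrite ltNge; apply/negP => le.
move: hw' le; rewrite /ell bypass_rayE /= => hw' le.
have B0 := bump_sum_ge0 V e w (Re w + (e + s)).
have [lt|gt|eq] := ltgtP (Im w) (Im w').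
- have := e_gap Vw Vw' lt; have := bump_sum_le finV w (Re w + (e + s)) sr.
  have : dl * (- `|Re w - Re w'|) <= dl * (Re w + (e + s) - Re w').
    by rewrite ler_pM2l // lerNl; have := ler_norm (Re w' - Re w); rewrite distrC; lra.
  by lra.
- have : dl * (Re w + (e + s)) <= dl * Re w' by rewrite ler_pM2l.
  by lra.
- have h1 : dl * (Re w + (e + s)) <= dl * Re w' by rewrite ler_pM2l.
  have h2 : dl * (Re w + (e + s)) = dl * Re w' by lra.
  have h3 : Re w + (e + s) = Re w' by apply: (mulfI (lt0r_neq0 d0)).
  have ne : w' <> w by move=> ww'; move: h3; rewrite ww'; lra.
  have := bump_sum_ge finV e (Re w + (e + s)) Vw' (esym eq) ne.
  by rewrite h3 subrr expr0n subr0 sqrtr_sqr gtr0_norm //; have := e0; rewrite h3 in hw'; lra.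
Qed.

Lemma circle_continuous : continuous Ci.
Proof.
have cang : continuous (fun t : R => 2 * pi * t).
  by apply: continuous_funM; [exact: cst_continuous|exact: continuous_idfun].
apply: continuous_Some; apply: continuous_addc; first exact: cst_continuous.
apply: continuous_complex.
  apply: continuous_funM; first exact: cst_continuous.
  by apply: (@continuous_comp_fun _ _ _ (fun t : R => 2 * pi * t) cos) => //; exact: continuous_cos.
apply: continuous_funN; apply: continuous_funM; first exact: cst_continuous.
by apply: (@continuous_comp_fun _ _ _ (fun t : R => 2 * pi * t) sin) => //; exact: continuous_sin.
Qed.

Let cC : continuous (fun t => Ci (clamp t)).
Proof.
by apply: (@continuous_comp_fun _ _ _ clamp Ci); [exact: clamp_continuous|exact: circle_continuous].
Qed.

Lemma circle_path a b : 0 <= a <= 1 -> 0 <= b <= 1 -> path_from_to X (Ci a) (Ci b) (subpath Ci a b).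
Proof.
move=> a01 b01; have hX t : X (Ci t) by exact: circle_in.
have pC : is_path X Ci by split; [exact: cC|move=> t _; exact: hX].
split; [|by rewrite /subpath mulr0 addr0|by rewrite /subpath mulr1 addrC subrK|exact: hX|exact: hX].
by apply: (is_path_sub pC a01 b01) => _ _; exact: hX.
Qed.

Let T0 : T 0 = Ci 0.
Proof.
rewrite /T path_to_infty0 addr0 (bypass0 finV sr Vw) ?lexx ?(ltW e0) //.
by rewrite /Ci /clockwise_circle mulr0 cos0 sin0 mulr0 mulr1 oppr0.
Qed.

Let Ci1 : Ci 1 = Ci 0.
Proof.
rewrite /Ci /clockwise_circle mulr1 mulr0.
have -> : 2 * pi = 0 + pi *+ 2 :> R by rewrite -mulr_natr; ring.
by rewrite cosD2pi sinD2pi.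
Qed.

Lemma tail_path : path_from_to X (Ci 0) None T.
Proof.
have XC t : X (Ci t) by exact: circle_in.
split; rewrite ?T0 //; [|by rewrite /T path_to_infty1|by right].
apply: is_path_to_infty.
- have c0 : continuous (fun t : R => e + Num.max 0 t).
    apply: continuous_funD; first exact: cst_continuous.
    by apply: continuous_funmax; [exact: cst_continuous|exact: continuous_idfun].
  have ce : continuous (fun _ : R => e) by exact: cst_continuous.
  exact: (continuous_bypass finV ce c0).
- move=> M; have [T' hT] := bypass_far V e w M; exists (T' - e) => s hs; apply: hT; lra.
- by move=> t t0; apply: (bypass_in finV sr Vw); have := e0; lra.
Qed.

Let gE : generator V e w = path_cat (path_rev T) (path_cat Ci T).
Proof. by []. Qed.

(** The first and last arcs of the circle, each joined with the tail of the generator, stay in the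
    uncut region and contract to flow lines. What remains of the generator is the middle arc, which
    crosses the cut from below to above inside the convex strip. *)
Lemma side_generator z : strip w z ->
  eqv X (Some z) None (side w z (eta / 2)) (side w z (- (eta / 2)) ++ [:: generator V e w]).
Proof.
move=> sz; have dN : - (eta / 2) <> 0 by have := eta0; lra.
have dP : eta / 2 <> 0 by have := eta0; lra.
have etaN : `|- (eta / 2)| < eta by rewrite normrN.
have i38 : 0 <= (3 / 8 : R) <= 1 by apply/andP; split; lra.
have i58 : 0 <= (5 / 8 : R) <= 1 by apply/andP; split; lra.
have sq1 : strip w (circle_pt (3 / 8)) by apply: circle_strip; apply/andP; split; lra.
have sq2 : strip w (circle_pt (5 / 8)) by apply: circle_strip; apply/andP; split; lra.
have s38 := @circle_38 R.
have [_ sc38] := @circle_lower R (3 / 8) ltac:(by apply/andP; split; lra).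
have /andP[d0 d1] := dl01.
have lq1 : 0 < - (eta / 2) * (l (circle_pt (3 / 8)) - l w).
  rewrite ell_circle mulrNN mulr_gt0 ?divr_gt0 // mulr_gt0 //.
  by move: s38 sc38; move: (sin _) (cos _) => s c; nra.
have lq2 : 0 < (eta / 2) * (l (circle_pt (5 / 8)) - l w).
  rewrite ell_circle -mulrN pmulr_rgt0 ?divr_gt0 // pmulr_rgt0 //.
  have -> : 5 / 8 = 1 - 3 / 8 :> R by lra.
  rewrite sin_two_pi_sub cos_two_pi_sub.
  have c0 := @circle_left R (3 / 8) ltac:(by apply/andP; split; lra).
  by move: s38 sc38 c0; move: (sin _) (cos _) => s c; nra.
pose al := subpath Ci 0 (3 / 8); pose be := subpath Ci (3 / 8) (5 / 8).
pose ga := subpath Ci (5 / 8) 1.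
have hal : path_from_to X (Ci 0) (Ci (3 / 8)) al by apply: circle_path; rewrite ?itv0.
have hbe : path_from_to X (Ci (3 / 8)) (Ci (5 / 8)) be by exact: circle_path.
have hga : path_from_to X (Ci (5 / 8)) (Ci 0) ga by rewrite -Ci1; apply: circle_path; rewrite ?itv1.
have hT := tail_path.
have wT : within_set A0 T by move=> t; exact: tail_uncut.
have wal : within_set A0 al.
  by apply: within_sub; rewrite ?lexx //; try lra; move=> t; exact: circle_lower_uncut.
have wga : within_set A0 ga.
  by apply: within_sub; rewrite ?lexx //; try lra; move=> t; exact: circle_upper_uncut.
have wbe : within_set (Some @` strip w) be.
  apply: within_sub; try lra; move=> t ht; exists (circle_pt t) => //; exact: circle_strip.
have hCi : path_from_to X (Ci 0) (Ci 0) Ci.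
  by rewrite -{2}Ci1; rewrite -[X in path_from_to _ _ _ X]subpath01; apply: circle_path; rewrite ?itv0 ?itv1.
have hrT := path_from_to_rev hT.
have hral := path_from_to_rev hal.
have E1 : eqv X (Ci 0) (Ci 0) [:: Ci] [:: al; be; ga].
  have h58 : path_from_to X (Ci 0) (Ci (5 / 8)) (subpath Ci 0 (5 / 8)).
    by apply: circle_path; rewrite ?itv0.
  have pCi : is_path X Ci by case: hCi.
  apply: (@eqv_trans _ _ _ _ _ [:: subpath Ci 0 (5 / 8); ga]).
    apply: (eqv_split h58 hga); apply: path_split => //; apply/andP; split; lra.
  apply: (@eqv_cat _ _ _ (Ci (5 / 8)) _ [:: _] [:: al; be] [:: ga] [:: ga]); last first.
    exact: eqv_refl (chain1 hga).
  apply: (eqv_split hal hbe); apply: sub_cat => //; lra.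
have E2 : eqv X (Ci (3 / 8)) None [:: path_rev al; T] [:: flow dl (Ci (3 / 8))].
  have hc := path_from_to_cat hral hT.
  apply: eqv_trans (eqv_sym (eqv_path_cat hral hT)) _.
  by apply: (flow_contract1 dl01 hc); apply: within_cat => //; exact: within_rev.
have E3 : eqv X (Ci (5 / 8)) None [:: ga; T] [:: flow dl (Ci (5 / 8))].
  have hc := path_from_to_cat hga hT.
  apply: eqv_trans (eqv_sym (eqv_path_cat hga hT)) _.
  by apply: (flow_contract1 dl01 hc); exact: within_cat.
have sl := strip_level sz etaN; have slp := strip_level sz eta2.
have cv := @strip_convex w; have ss := strip_sub Vw.
have seg x y : strip w x -> strip w y -> path_from_to X (Some x) (Some y) (segment x y).
  by move=> *; exact: (segment_path cv ss).
have wseg x y : strip w x -> strip w y -> within_set (Some @` strip w) (segment x y).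
  by move=> *; exact: segment_within.
set zd := level w z (- (eta / 2)) in sl; set zu := level w z (eta / 2) in slp.
have zd_side : 0 < - (eta / 2) * (l zd - l w).
  by rewrite /l ell_level addrAC subrr add0r mulrNN mulr_gt0 // divr_gt0.
have zu_side : 0 < (eta / 2) * (l zu - l w).
  by rewrite /l ell_level addrAC subrr add0r mulr_gt0 // divr_gt0.
have F1 := @same_side w zd (circle_pt (3 / 8)) _ Vw sl sq1 zd_side lq1.
have F2 := @same_side w zu (circle_pt (5 / 8)) _ Vw slp sq2 zu_side lq2.
have hg := generator_path finV sr Vw.
have chz := chain1 (seg _ _ sz sl); have chu := chain1 (seg _ _ sz slp).
have chq := chain1 (seg _ _ sl sq1); have chq2 := chain1 (seg _ _ slp sq2).
have hCT := path_from_to_cat hCi hT.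
have G1 : eqv X None None [:: generator V e w] [:: path_rev T; al; be; ga; T].
  rewrite gE; apply: eqv_trans (eqv_path_cat hrT hCT) _.
  apply: (@eqv_cat _ _ _ (Ci 0) _ [:: _] [:: _]); first exact: eqv_refl (chain1 hrT).
  apply: eqv_trans (eqv_path_cat hCi hT) _.
  exact: (eqv_cat E1 (eqv_refl (chain1 hT))).
have G2 : eqv X (Some zd) None [:: flow dl (Some zd); generator V e w]
    [:: segment zd (circle_pt (3 / 8)); be; flow dl (Ci (5 / 8))].
  apply: eqv_trans (eqv_cat (eqv_sym F1) G1) _ => /=.
  apply: (@eqv_cat _ _ _ (Ci (3 / 8)) _ [:: _] [:: _]); first exact: eqv_refl chq.
  have chb : chain X (Ci (3 / 8)) [:: be; ga; T] None.
    exact: chain_cons hbe (chain_cons hga (chain1 hT)).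
  have chab : chain X (Ci 0) [:: al; be; ga; T] None by exact: chain_cons hal chb.
  apply: (@eqv_trans _ _ _ _ _ ([:: path_rev al; T] ++ [:: path_rev T; al; be; ga; T])).
    apply: (@eqv_cat _ _ _ None _ [:: _]); first exact: eqv_sym.
    exact: eqv_refl (chain_cons hrT chab).
  apply: (@eqv_trans _ _ _ _ _ [:: path_rev al; al; be; ga; T]).
    apply: (@eqv_ctx _ _ (Ci (3 / 8)) (Ci 0) (Ci 0) None [:: T; path_rev T] [::] [:: path_rev al]).
    - exact: chain1.
    - exact: chab.
    - exact: eqv_rev_r hT.
  apply: (@eqv_trans _ _ _ _ _ [:: be; ga; T]).
    apply: (@eqv_cat _ _ _ (Ci (3 / 8)) _ [:: path_rev al; al] [::]).
      exact: eqv_rev_l hal.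
    exact: eqv_refl chb.
  apply: (@eqv_cat _ _ _ (Ci (5 / 8)) _ [:: be] [:: be]); first exact: eqv_refl (chain1 hbe).
  exact: E3.
have fl2 := flow_path dl01 (circle_upper_uncut (t := 5 / 8) ltac:(by apply/andP; split; lra)).
apply: (@eqv_trans _ _ _ _ _ [:: segment z zu; segment zu (circle_pt (5 / 8)); flow dl (Ci (5 / 8))]).
  apply: (@eqv_cat _ _ _ (Some zu) _ [:: _] [:: _]); first exact: eqv_refl chu.
  exact: eqv_sym F2.
apply: (@eqv_trans _ _ _ _ _ [:: segment z zd; segment zd (circle_pt (3 / 8)); be; flow dl (Ci (5 / 8))]).
  apply: (@eqv_cat _ _ _ (Ci (5 / 8)) _ [:: _; _] [:: _; _; _]); last exact: eqv_refl (chain1 fl2).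
  apply: (convex_eqv cv ss); first by exists z.
  - exact: chain_cons (seg _ _ sz slp) chq2.
  - exact: chain_cons (seg _ _ sz sl) (chain_cons (seg _ _ sl sq1) (chain1 hbe)).
  - by move=> q [<-|[<-|[]]]; exact: wseg.
  - by move=> q [<-|[<-|[<-|[]]]]; [exact: wseg|exact: wseg|].
apply: (@eqv_cat _ _ _ (Some zd) _ [:: _] [:: _]); first exact: eqv_refl chz.
exact: eqv_sym G2.
Qed.

End OneGenerator.

(** A standard way to infinity: the flow from an uncut point, or first upwards across the cut for a
    point of a strip. Points of both kinds have two such ways. *)
Definition canonical (x : sphere R) (L : seq (R -> sphere R)) :=
  (A0 x /\ L = [:: flow dl x]) \/
  exists w z, [/\ V w, x = Some z, strip w z & L = side w z (eta / 2)].

Let eta2n : eta / 2 <> 0. Proof. by apply/eqP; rewrite gt_eqF // divr_gt0. Qed.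

Lemma canonical_chain x L : canonical x L -> chain X x L None.
Proof.
case=> [[hx ->]|[w [z [Vw -> sz ->]]]]; first by apply: chain1; exact: flow_path.
exact: side_chain.
Qed.

(** Above the cut the two ways agree by the flow. Below it, going up across the cut differs from the
    flow by one generator. *)
Lemma canonical_compare x L L' : canonical x L -> canonical x L' ->
  exists2 m, letters V m & eqv X x None L' (L ++ [seq letter_loop V e y | y <- m]).
Proof.
have nil : letters V [::] by [].
have uncut_ne w z : V w -> strip w z -> A0 (Some z) -> l z <> l w.
  move=> Vw [_ z2 _] [[z' [_ h] [zz']]|//]; rewrite zz' in h => lzw.
  by have := h w Vw lzw; rewrite ltNge (ltW z2).
have P : 0 < eta / 2 by rewrite divr_gt0.
have hN : `|- (eta / 2)| < eta by rewrite normrN.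
have lower w z : V w -> strip w z -> l z < l w ->
    eqv X (Some z) None (side w z (eta / 2)) [:: flow dl (Some z); generator V e w].
  move=> Vw sz lt; apply: eqv_trans (side_generator Vw sz) _.
  apply: (@eqv_cat _ _ _ None _ _ [:: _] [:: _] [:: _]); last first.
    exact: eqv_refl (chain1 (generator_path finV sr Vw)).
  apply: side_flow => //; rewrite mulNr -mulrN mulr_gt0 //; lra.
move=> hL hL'; case: (hL) (hL') => [[hx LE]|[w [z [Vw xE sz LE]]]] [[hx' LE']|[w' [z' [Vw' xE' sz' LE']]]].
- exists [::] => //; rewrite cats0 LE' LE; apply: eqv_refl; apply: chain1; exact: flow_path.
- rewrite LE LE' xE' in hx *; have ne := uncut_ne _ _ Vw' sz' hx.
  have [lt|gt|//] := ltgtP (l z') (l w').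
    exists [:: (w', true)]; last exact: lower.
    by move=> y; rewrite inE => /eqP ->.
  exists [::] => //; rewrite cats0; apply: side_flow => //; rewrite mulr_gt0 //; lra.
- rewrite LE LE' xE in hx' *; have ne := uncut_ne _ _ Vw sz hx'.
  have hg := generator_path finV sr Vw.
  have [lt|gt|//] := ltgtP (l z) (l w).
    exists [:: (w, false)]; first by move=> y; rewrite inE => /eqP ->.
    rewrite /= /letter_loop /=; apply: (@eqv_trans _ _ _ _ _ [:: flow dl (Some z); generator V e w; path_rev (generator V e w)]).
      apply: (@eqv_cat _ _ _ None _ [:: _] [:: _] [::]).
        by apply: eqv_refl; apply: chain1; exact: flow_path.
      exact: eqv_sym (eqv_rev_r hg).
    apply: (@eqv_cat _ _ _ None _ [:: _; _] (side w z (eta / 2)) [:: _] [:: _]).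
      exact: eqv_sym (lower _ _ Vw sz lt).
    exact: eqv_refl (chain1 (path_from_to_rev hg)).
  exists [::] => //; rewrite cats0; apply: eqv_sym; apply: side_flow => //.
  by rewrite mulr_gt0 //; lra.
- have zz' : z = z' by move: xE'; rewrite xE => -[].
  have ww' : w = w'.
    apply: (strip_unique (z := z)) => //; first by case: sz.
    by rewrite zz'; case: sz'.
  exists [::] => //; rewrite cats0 LE' LE -ww' -zz' xE; apply: eqv_refl; exact: side_chain.
Qed.

Lemma ell_continuous : continuous l.
Proof.
apply: (@continuous_funD R R); first exact: Im_continuous.
apply: continuous_funN; apply: (@continuous_funM R); first exact: cst_continuous.
exact: Re_continuous.
Qed.

Lemma strip_open w z : strip w z -> nbhs z (strip w).
Proof.
move=> [z1 z2 z3].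
have n1 : \forall y \near z, r < Re y by apply: near_gt => //; exact: Re_continuous.
have n2 : \forall y \near z, Re y < Re w by apply: near_lt => //; exact: Re_continuous.
have cl : continuous (fun y : C => l y - l w).
  by apply: (@continuous_funD R R); [exact: ell_continuous|exact: cst_continuous].
have cn : continuous (fun y : C => `|l y - l w|).
  by apply: (@continuous_comp_fun _ _ _ (fun y : C => l y - l w) (fun y : R => `|y|)); [exact: cl|exact: norm_continuous].
have n3 : \forall y \near z, `|l y - l w| < eta by apply: (@near_lt _ _ (fun y => `|l y - l w|)); [exact: cn|exact: z3].
by apply: filterS3 n1 n2 n3 => y *; split.
Qed.

Lemma uncut_open z : uncut V r dl z -> nbhs z (uncut V r dl).
Proof.
move=> [rz h]; have /finite_seqP[s Vs] := finV.
have n1 : \forall y \near z, r < Re y by apply: near_gt => //; exact: Re_continuous.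
suff n2 : \forall y \near z, forall w, w \in s -> l y = l w -> Re w < Re y.
  apply: filterS2 n1 n2 => y ry hy; split=> // w Vw; apply: hy.
  by have : [set` s] w by rewrite -Vs.
have {}h w : w \in s -> l z = l w -> Re w < Re z by move=> ws; apply: h; rewrite Vs.
elim: s {Vs} h => [|w s ih] h; first by apply: filterE => y w; rewrite in_nil.
have n3 : \forall y \near z, l y = l w -> Re w < Re y.
  have [E|/eqP ne] := eqVneq (l z) (l w).
    have := h w (mem_head _ _) E => lt.
    have : \forall y \near z, Re w < Re y by apply: near_gt => //; exact: Re_continuous.
    by apply: filterS.
  have cl : continuous (fun y : C => `|l y - l w|).
    apply: (@continuous_comp_fun _ _ _ (fun y : C => l y - l w) (fun y : R => `|y|)).
      by apply: (@continuous_funD R R); [exact: ell_continuous|exact: cst_continuous].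
    exact: norm_continuous.
  have : \forall y \near z, 0 < `|l y - l w|.
    by apply: near_gt; [exact: cl|rewrite normr_gt0 subr_eq0; apply/eqP].
  by apply: filterS => y; rewrite normr_gt0 subr_eq0 => /eqP.
have n4 : \forall y \near z, forall w, w \in s -> l y = l w -> Re w < Re y.
  by apply: ih => w' ws; apply: h; rewrite inE ws orbT.
apply: filterS2 n3 n4 => y h3 h4 w'; rewrite inE => /orP[/eqP ->|]; [exact: h3|exact: h4].
Qed.

(** The part of a cut inside the half-plane is bounded, since the real part on it lies between [r]
    and that of its starting point; hence infinity is interior to the uncut region relative to
    H_r. *)
Lemma uncut_far : exists M : R, forall z, r < Re z -> M < normc z -> uncut V r dl z.
Proof.
have /finite_seqP[s Vs] := finV.
suff [M hM] : exists M : R, forall z, r < Re z -> M < normc z ->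
    forall w, w \in s -> l z = l w -> Re w < Re z.
  exists M => z rz Mz; split=> // w Vw; apply: (hM z rz Mz).
  by have : [set` s] w by rewrite -Vs.
have /andP[d0 d1] := dl01.
elim: s {Vs} => [|w s [M hM]]; first by exists 0 => z _ _ w; rewrite in_nil.
exists (Num.max M (2 * (`|r| + `|Re w|) + `|l w|)) => z rz; rewrite gt_max => /andP[Mz wz] w'.
rewrite inE => /orP[/eqP ->|]; last exact: hM.
move=> lE; rewrite ltNge; apply/negP => zw.
have h1 : `|Re z| <= `|r| + `|Re w|.
  rewrite ler_norml; have := ler_norm (- r); have := ler_norm (Re w); rewrite normrN.
  by have := normr_ge0 r; have := normr_ge0 (Re w); lra.
have h2 : `|Im z| <= `|l w| + `|Re z|.
  have -> : Im z = l w + dl * Re z by rewrite -lE /l /ell; ring.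
  apply: le_trans (ler_normD _ _) _; rewrite lerD2l normrM (gtr0_norm d0).
  by rewrite ler_piMl // ltW.
by have := normc_le_Re_Im z; lra.
Qed.

Lemma uncut_sphere_open x : A0 x -> nbhs x [set y | X y -> A0 y].
Proof.
case=> [[z hz <-]|->].
  have : nbhs (Some z : sphere R) (Some @` (uncut V r dl)).
    by apply: one_point_compactification_some_nbhs; exact: uncut_open.
  by apply: filterS => _ [y hy <-] _; exact: uncut_Some.
have [M hM] := uncut_far; apply: (@nbhs_None _ _ M); last by move=> _; right.
move=> z Mz [[z' [rz _] [zz']]|//]; rewrite zz' in rz; apply: uncut_Some; exact: hM.
Qed.

(** Division points may coincide here, with constant pieces, as happens in a continuous
    induction. *)
Lemma sub_cat_closed p (a b c : R) : continuous (fun t => p (clamp t)) -> within_set X p ->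
  0 <= a -> a <= b -> b <= c -> c <= 1 ->
  eqv X (p a) (p c) [:: subpath p a c] [:: subpath p a b; subpath p b c].
Proof.
move=> cp wp a0 ab bc c1.
have pp : is_path X p by split; [exact: cp|move=> t /ltW_itv; exact: wp].
have sp x y : 0 <= x -> x <= y -> y <= 1 -> path_from_to X (p x) (p y) (subpath p x y).
  move=> x0 xy y1.
  have x01 : 0 <= x <= 1 by rewrite x0 (le_trans xy).
  have y01 : 0 <= y <= 1 by rewrite y1 (le_trans x0).
  split; [|by rewrite /subpath mulr0 addr0|by rewrite /subpath mulr1 addrC subrK|exact: wp|exact: wp].
  apply: (is_path_sub pp x01 y01) => _ _; apply: wp; [exact: itv0|exact: itv1].
have hac := sp a c a0 (le_trans ab bc) c1.
have hab := sp a b a0 ab (le_trans bc c1).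
have hbc := sp b c (le_trans a0 ab) bc c1.
have cE x : subpath p x x = fun=> p x.
  by apply/funext => t; rewrite /subpath subrr mul0r addr0.
have Xp x : 0 <= x -> x <= 1 -> X (p x) by move=> x0 x1; apply: wp; rewrite x0.
move: ab; rewrite le_eqVlt => /orP[/eqP abE|ab].
  rewrite -abE in hbc *; rewrite cE.
  apply: (@eqv_cat _ _ _ (p a) _ [::] [:: fun=> p a] [:: _] [:: _]).
    by apply: eqv_sym; apply: eqv_cst; case: hac.
  exact: eqv_refl (chain1 hbc).
move: bc; rewrite le_eqVlt => /orP[/eqP bcE|bc].
  rewrite bcE in hab *; rewrite cE.
  apply: (@eqv_cat _ _ _ (p c) _ [:: _] [:: _] [::] [:: fun=> p c]).
    exact: eqv_refl (chain1 hab).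
  by apply: eqv_sym; apply: eqv_cst; case: hac.
by apply: (eqv_split hab hbc); apply: sub_cat.
Qed.

(* Cut the loop into short pieces, each inside the uncut region or a strip, and
   join the division points to infinity along canonical paths. *)
Lemma loop_word f : path_from_to X None None f ->
  exists2 m, letters V m & homot X f (word_loop V e m).
Proof.
move=> hf; have [[cf Xf] f0 f1 XN _] := hf.
have wf : within_set X f.
  move=> t /andP[]; rewrite le_eqVlt => /orP[/eqP <-|t0]; first by rewrite f0.
  rewrite le_eqVlt => /orP[/eqP ->|t1]; first by rewrite f1.
  by apply: Xf; rewrite t0.
pose lt m := [seq letter_loop V e y | y <- m].
(* The invariant: [f] up to time [t], closed up by a canonical way to infinity, is the loop of a
   word. *)
pose P t := exists L m, [/\ canonical (f t) L, letters V m &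
   eqv X None None (subpath f 0 t :: L) (lt m)].
have sub01 t : 0 <= t -> t <= 1 -> path_from_to X None (f t) (subpath f 0 t).
  move=> t0 t1; have t01 : 0 <= t <= 1 by rewrite t0.
  have pf : is_path X f by case: hf.
  split; [|by rewrite /subpath mulr0 addr0 f0|by rewrite /subpath mulr1 addrC subrK|by right|exact: wf].
  by apply: (is_path_sub pf itv0 t01) => _ _; rewrite ?f0 ?f1; right.
suff [L [m [cL lm h]]] : P 1.
  exists m => //; apply: homot_trans (homot_sym (word_loop_homot_comp finV sr lm)).
  have LE : L = [:: flow dl None].
    by case: cL => [[_ ->]|[w [z [_ + _ _]]]]; rewrite f1.
  have [_ _ hh] : eqv X None None [:: f] (lt m).
    apply: eqv_trans h; rewrite LE subpath01.
    apply: (@eqv_cat _ _ _ None _ [:: _] [:: _] [::]); first exact: eqv_refl (chain1 hf).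
    exact: eqv_sym (eqv_cst XN).
  exact: homot_trans (homot_sym (concat1 hf)) hh.
apply: interval_induction.
  exists [:: flow dl None], [::]; split => //; first by left; rewrite f0; split => //; right.
  have -> : subpath f 0 0 = fun=> None.
    by apply/funext => t; rewrite /subpath subrr mul0r addr0 f0.
  by apply: (@eqv_cat _ _ _ None _ [:: _] [::] [:: _] [::]); exact: eqv_cst.
move=> t t01; have ct := cf t; rewrite /= in ct.
have near_step (S : set (sphere R)) : nbhs (f t) [set y | X y -> S y] ->
    exists2 d : R, 0 < d & forall s, 0 <= s <= 1 -> `|s - t| < d -> S (f s).
  move=> hS; have hS' : nbhs (f (clamp t)) [set y | X y -> S y] by rewrite clamp_id.
  have /nbhs_ballP [d /= d0 hd] := ct _ hS'; exists d => // s s01 st.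
  have hb : ball t d s by rewrite /ball /= distrC.
  by have := hd s hb; rewrite /= (clamp_id s01); apply; exact: wf.
have main (S : set (sphere R)) : S `<=` X ->
    (forall x L, S x -> canonical x L -> exists2 L0, canonical x L0 & forall y p, S y ->
       path_from_to X x y p -> continuous (fun t => p (clamp t)) -> within_set S p ->
       exists2 L', canonical y L' & eqv X x None (p :: L') L0) ->
    nbhs (f t) [set y | X y -> S y] ->
    exists2 d : R, 0 < d & forall s s', 0 <= s -> s <= s' -> s' <= 1 ->
      `|s - t| < d -> `|s' - t| < d -> P s -> P s'.
  move=> SX hS /near_step [d d0 hd]; exists d => // s s' s0 ss' s'1 st s't.
  have s01 : 0 <= s <= 1 by rewrite s0 (le_trans ss').
  have s'01 : 0 <= s' <= 1 by rewrite s'1 (le_trans s0).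
  move=> [L [m [cL lm h]]].
  have [L0 cL0 hL0] := hS _ _ (hd s s01 st) cL.
  pose p := subpath f s s'.
  have pf : is_path X f by case: hf.
  have ipf : is_path X p.
    by apply: (is_path_sub pf s01 s'01) => _ _; rewrite ?f0 ?f1; right.
  have hp : path_from_to X (f s) (f s') p.
    split; [exact: ipf|by rewrite /p /subpath mulr0 addr0|by rewrite /p /subpath mulr1 addrC subrK|exact: wf|exact: wf].
  have wp : within_set S p.
    apply: within_sub => // u /andP[su us']; apply: hd.
      by apply/andP; split; [exact: le_trans su|exact: le_trans us' _].
    by move: st s't; rewrite !ltr_norml => /andP[? ?] /andP[? ?]; apply/andP; split; lra.
  have [L' cL' hL'] := hL0 _ _ (hd s' s'01 s't) hp (proj1 ipf) wp.
  (* Exchanging the way [L] for the one adapted to the region [S] costs the letters [m']. *)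
  have [m' lm' hm'] := canonical_compare cL cL0.
  exists L', (m ++ m'); split => //.
    by move=> y; rewrite mem_cat => /orP[/lm|/lm'].
  have h1 := sub01 s s0 (le_trans ss' s'1).
  apply: (@eqv_trans _ _ _ _ _ ([:: subpath f 0 s; p] ++ L')).
    apply: (@eqv_cat _ _ _ (f s') _ [:: _] [:: _; _]).
      by have := sub_cat_closed cf wf (lexx 0) s0 ss' s'1; rewrite f0.
    exact: eqv_refl (canonical_chain cL').
  apply: (@eqv_trans _ _ _ _ _ (subpath f 0 s :: L0)).
    by apply: (@eqv_cat _ _ _ (f s) _ [:: _] [:: _]); [exact: eqv_refl (chain1 h1)|].
  apply: (@eqv_trans _ _ _ _ _ ((subpath f 0 s :: L) ++ lt m')).
    by apply: (@eqv_cat _ _ _ (f s) _ [:: _] [:: _]); [exact: eqv_refl (chain1 h1)|].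
  rewrite /lt map_cat; apply: (eqv_cat h); apply: eqv_refl.
  exact: chain_letters.
have [h|h] : A0 (f t) \/ exists2 w, V w & (Some @` strip w) (f t).
  have := wf t t01; case ft : (f t) => [z|]; last by left; right.
  move=> /uncut_or_strip[hz|[w Vw sz]]; first by left; exact: uncut_Some.
  by right; exists w => //; exists z.
- apply: (main A0); [exact: uncut_sub| |exact: uncut_sphere_open].
  move=> x L Ax _; exists [:: flow dl x]; first by left.
  move=> y p Ay hp cp wp; exists [:: flow dl y]; first by left.
  by have [_ p0 p1 _ _] := hp; have := flow_contract dl01 cp wp; rewrite p0 p1.
- have [w Vw sft] := h; apply: (main (Some @` strip w)); first exact: strip_sub.
    move=> x L [z sz <-] _; exists (side w z (eta / 2)); first by right; exists w, z.
    move=> y p [z' sz' <-] hp cp wp; exists (side w z' (eta / 2)).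
      by right; exists w, z'.
    exact: strip_move.
  case: sft => z sz <-.
  have : nbhs (Some z : sphere R) (Some @` strip w).
    by apply: one_point_compactification_some_nbhs; exact: strip_open.
  by apply: filterS => y hy _.
Qed.

End Strips.

(** * Choice of slope, width and radius *)

Section GenericSlope.
Context {R : realType} (V : set R[i]).
Hypothesis finV : finite_set V.

Lemma finite_pairs_min (P : R[i] -> R[i] -> bool) (f : R[i] -> R[i] -> R) :
  (forall w z, V w -> V z -> P w z -> 0 < f w z) ->
  exists2 e : R, 0 < e & forall w z, V w -> V z -> P w z -> e <= f w z.
Proof.
have /finite_seqP[s Vs] := finV; move=> h.
have Vin w : V w -> w \in s by rewrite Vs.
have inV w : w \in s -> V w by rewrite Vs.
have [|e e0 he] := @finite_min_pos R _ [seq (w, z) | w <- s, z <- s] (fun x => P x.1 x.2) (fun x => f x.1 x.2).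
  by move=> _ /allpairsP [[w z] [/= ws zs ->]] /=; apply: h; exact: inV.
exists e => // w z Vw Vz; apply: (he (w, z)).
by apply/allpairsP; exists (w, z); split => //=; exact: Vin.
Qed.

Lemma finite_bounded_below : exists r : R, forall w, V w -> r < Re w.
Proof.
have /finite_seqP[s ->] := finV; elim: s => [|w s [r hr]]; first by exists 0 => w; rewrite /= in_nil.
exists (Num.min r (Re w - 1)) => w'; rewrite /= inE => /orP[/eqP ->|/hr].
  by rewrite gt_min; apply/orP; right; lra.
by move=> h; rewrite gt_min h.
Qed.

(** The slope is small against the ratios of height to horizontal distance, so points of different
    heights keep their order in [ell]; points of equal height are separated since [dl] is positive.
    Then [eta] and [e] come from finitely many positive distances. *)
Lemma generic_parameters (r : R) : (forall w, V w -> r + 1 < Re w) -> exists e dl eta : R,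
  [/\ small_radius V r e, 0 < dl < 1,
   forall w z, V w -> V z -> w <> z -> 2 * eta <= `|ell dl w - ell dl z|, 2 * e < eta &
   forall w z, V w -> V z -> Im w < Im z -> e + dl * `|Re w - Re z| < Im z - Im w].
Proof.
move=> rV.
have [|g g0 hg] := @finite_pairs_min (fun w z => Im w < Im z) (fun w z => Im z - Im w).
  by move=> w z _ _; rewrite subr_gt0.
have [|d d0 hd] := @finite_pairs_min (fun w z => Im w < Im z)
    (fun w z => (Im z - Im w) / (2 * (`|Re w - Re z| + 1))).
  by move=> w z _ _ h; rewrite divr_gt0 ?subr_gt0 // mulr_gt0 // ltr_pwDr.
pose dl := Num.min d 2^-1.
have dl0 : 0 < dl by rewrite lt_min d0 invr_gt0 ltr0n.
have dl1 : dl < 1 by apply: (@le_lt_trans _ _ 2^-1); [rewrite ge_min lexx orbT|lra].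
have hdl w z : V w -> V z -> Im w < Im z -> dl * `|Re w - Re z| < (Im z - Im w) / 2.
  move=> Vw Vz h; have h1 := hd w z Vw Vz h.
  have h2 : dl <= (Im z - Im w) / (2 * (`|Re w - Re z| + 1)) by apply: le_trans h1; rewrite ge_min lexx.
  have n0 : 0 <= `|Re w - Re z| by [].
  move: h2; rewrite ler_pdivlMr; last lra.
  lra.
have ellne w z : V w -> V z -> w != z -> 0 < `|ell dl w - ell dl z|.
  move=> Vw Vz wz; rewrite normr_gt0 subr_eq0; apply: contraNneq wz => E.
  have [lt|gt|eqI] := ltgtP (Im w) (Im z).
  - have := hdl w z Vw Vz lt; move: E; rewrite /ell => E.
    have : dl * (Re z - Re w) <= dl * `|Re w - Re z| by rewrite ler_pM2l // distrC ler_norm.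
    by move=> ? ?; exfalso; lra.
  - have := hdl z w Vz Vw gt; move: E; rewrite /ell => E.
    have : dl * (Re w - Re z) <= dl * `|Re z - Re w| by rewrite ler_pM2l // distrC ler_norm.
    by move=> ? ?; exfalso; lra.
  - move: E; rewrite /ell eqI => /(addrI _) /oppr_inj /(mulfI (lt0r_neq0 dl0)) eqR.
    by apply/eqP; case: w z eqI eqR {Vw Vz} => [a b] [c d'] /= -> ->.
have [|eta2 eta20 heta] := @finite_pairs_min (fun w z => w != z) (fun w z => `|ell dl w - ell dl z|).
  by [].
have [|D D0 hD] := @finite_pairs_min (fun w z => w != z) (fun w z => normc (w - z)).
  by move=> w z _ _; rewrite normc_gt0 subr_eq0.
pose e := Num.min (Num.min (eta2 / 8) (g / 4)) (Num.min (D / 4) 2^-1).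
have e0 : 0 < e by rewrite !lt_min !divr_gt0 //= invr_gt0 ltr0n.
have e1 : e <= eta2 / 8 by rewrite !ge_min lexx.
have e2 : e <= g / 4 by rewrite !ge_min lexx orbT.
have e3 : e <= D / 4 by rewrite !ge_min lexx !orbT.
have e4 : e <= 2^-1 by rewrite !ge_min lexx !orbT.
exists e, dl, (eta2 / 2); split.
- split => //; first by move=> w Vw; have := rV w Vw; lra.
  by move=> w z Vw Vz /eqP wz; have := hD w z Vw Vz wz; lra.
- by rewrite dl0 dl1.
- by move=> w z Vw Vz /eqP wz; have := heta w z Vw Vz wz; lra.
- by lra.
- by move=> w z Vw Vz h; have := hdl w z Vw Vz h; have := hg w z Vw Vz h; lra.
Qed.

End GenericSlope.

(** * The beginning of a curve, and existence of its word *)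

Section Start.
Context {R : realType}.
Local Notation C := R[i].

Lemma polar (z : C) : exists2 th : R, - pi <= th <= pi & z = (normc z)%:C * (cos th +i* sin th).
Proof.
have [->|z0] := eqVneq z 0; first by exists 0; rewrite ?normc0 ?mul0r // oppr_le0 pi_ge0.
have n0 : 0 < normc z by rewrite normc_gt0.
have y1 : -1 <= Re z / normc z <= 1.
  by rewrite -ler_norml normrM normfV (gtr0_norm n0) ler_pdivrMr // mul1r Re_le_normc.
have complexE_ (w : C) : w = Re w +i* Im w by case: w.
have cE : normc z * cos (acos (Re z / normc z)) = Re z.
  by rewrite acosK ?in_itv //= mulrC divfK // gt_eqF.
have sE : normc z * sin (acos (Re z / normc z)) = `|Im z|.
  rewrite sin_acos // -[X in X * _]gtr0_norm // -sqrtr_sqr -sqrtrM ?sqr_ge0 //.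
  rewrite mulrBr mulr1 -exprMn (mulrC (normc z)) divfK ?gt_eqF // sqr_normc_Re_Im.
  by rewrite addrC addKr sqrtr_sqr.
have cplx (n p q : R) : n%:C * (p +i* q) = (n * p) +i* (n * q).
  by apply/eqP; rewrite eq_complex; apply/andP; split; apply/eqP => /=; ring.
have [I0|I0] := leP 0 (Im z).
  exists (acos (Re z / normc z)); first by rewrite acos_lepi // andbT; apply: le_trans (acos_ge0 y1); rewrite oppr_le0 pi_ge0.
  rewrite cplx cE sE ger0_norm //; exact: complexE_.
exists (- acos (Re z / normc z)).
  by rewrite lerN2 acos_lepi //=; apply: (@le_trans _ _ 0); rewrite ?oppr_le0 ?acos_ge0 // pi_ge0.
rewrite cosN sinN cplx mulrN cE sE ltr0_norm // opprK.
exact: complexE_.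
Qed.

(* At time [u] of the homotopy, follow the segment from [g 0] to [g u], then [g]. *)
Lemma straighten_start (A : set (sphere R)) (g : R -> C) (rho : R) : continuous g ->
  (forall t, 0 < t <= 1 -> g t <> g 0) ->
  (forall t, 0 <= t <= 1 -> normc (g t - g 0) < rho) ->
  (forall z, z <> g 0 -> normc (z - g 0) < rho -> A (Some z)) ->
  homot A (fun t => Some (g t)) (segment (g 0) (g 1)).
Proof.
move=> cg gne gr hA.
pose m (x : R * R) := Num.max (clamp x.2) (clamp x.1).
pose h (x : R * R) : C := g 0 + (clamp x.2 / m x)%:C * (g (m x) - g 0).
have c1 : continuous (fun x : R * R => clamp x.1).
  by apply: (@continuous_comp_fun _ _ _ (fun x : R * R => x.1) clamp); [exact: continuous_fst|exact: clamp_continuous].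
have c2 : continuous (fun x : R * R => clamp x.2).
  by apply: (@continuous_comp_fun _ _ _ (fun x : R * R => x.2) clamp); [exact: continuous_snd|exact: clamp_continuous].
have cm : continuous m by exact: continuous_funmax.
have cgm : continuous (fun x => g (m x) - g 0).
  apply: continuous_subc; last exact: cst_continuous.
  by apply: (@continuous_comp_fun _ _ _ m g).
have m0 x : 0 <= m x by rewrite /m le_max; have /andP[-> _] := clamp_itv x.2.
have m1 x : m x <= 1.
  by rewrite /m ge_max; have /andP[_ ->] := clamp_itv x.2; have /andP[_ ->] := clamp_itv x.1.
have lm x : clamp x.2 <= m x by rewrite /m le_max lexx.
have hle x : normc (h x - g 0) <= normc (g (m x) - g 0).
  rewrite /h addrC addKr normcM normc_real ger0_norm; last first.
    by rewrite divr_ge0 //; have /andP[] := clamp_itv x.2.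
  rewrite ler_piMl ?normc_ge0 //.
  have [->|mx] := eqVneq (m x) 0; first by rewrite invr0 mulr0 ler01.
  by rewrite ler_pdivrMr ?mul1r // lt_neqAle eq_sym mx m0.
have ch : continuous h.
  move=> x; have [mx|mx] := eqVneq (m x) 0.
    have hx : h x = g 0.
      by rewrite /h mx subrr mulr0 addr0.
    apply/cvg_normc => e e0; rewrite hx.
    have : \forall y \near x, normc (g (m y) - g 0 - (g (m x) - g 0)) < e.
      exact: (continuous_normcP _).1 cgm x e e0.
    rewrite mx subrr; apply: filterS => y; rewrite subr0.
    by apply: le_lt_trans; exact: hle.
  have cq : {for x, continuous (fun y => clamp y.2 / m y)}.
    by apply: cvgM; [exact: c2|apply: cvgV => //; exact: cm].
  have cq2 : {for x, continuous (fun y => (clamp y.2 / m y)%:C)}.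
    exact: (@continuous_comp _ _ _ (fun y : R * R => clamp y.2 / m y) (fun t : R => t%:C) x cq (@continuous_real_complex R _)).
  exact: (@cvgD C C _ _ _ _ _ _ _ (@cvg_cst _ _ _ _ _) (@cvgM C _ _ _ _ _ _ _ cq2 (cgm x))).
exists (fun x => Some (h x)); split.
- exact: continuous_Some.
- move=> t t01; rewrite /h /m /= clamp0 clamp1 clamp_id //; have /andP[t0 t1] := t01.
  rewrite (max_idPl t0) (max_idPr t1) divr1; split => //.
  have [->|tn] := eqVneq t 0; first by rewrite subrr mulr0 addr0.
  by rewrite divff // mul1r addrC subrK.
- move=> u u01; rewrite /h /m /= clamp0 clamp1 clamp_id //; have /andP[u0 u1] := u01.
  rewrite mul0r mul0r addr0 (max_idPl u1) divr1 mul1r addrC subrK //.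
- move=> u t u01 t01; have /andP[t0 t1] := t01; have t01' := ltW_itv t01.
  have mt : 0 < m (u, t) by apply: lt_le_trans (lm (u, t)); rewrite /= clamp_id.
  apply: hA; last by apply: le_lt_trans (hle _) (gr _ _); rewrite m0 m1.
  move=> E; have /eqP : (clamp t / m (u, t))%:C * (g (m (u, t)) - g 0) = 0 :> C.
    by apply: (addrI (g 0)); rewrite addr0.
  rewrite clamp_id // mulf_eq0.
  rewrite subr_eq0 => /orP[/eqP/complexI/eqP|/eqP].
    by rewrite mulf_eq0 invr_eq0 !gt_eqF.
  by apply: gne; rewrite mt m1.
Qed.

(** The cone over [c] with apex [p] is a square whose lower side is the apex, so [square_start]
    applies. *)
Lemma cone_homot (A : set (sphere R)) (p : C) (c : R -> C) (rho : R) : continuous c ->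
  (forall t, 0 <= t <= 1 -> c t <> p /\ normc (c t - p) < rho) ->
  (forall z, z <> p -> normc (z - p) < rho -> A (Some z)) ->
  homot A (path_cat (segment p (c 0)) (fun t => Some (c t))) (segment p (c 1)).
Proof.
move=> cc hc hA.
pose Q (x : R * R) : sphere R := Some (p + (x.2)%:C * (c (clamp x.1) - p)).
have cQ : continuous Q.
  apply: continuous_Some; apply: continuous_addc; first exact: cst_continuous.
  apply: continuous_mulc.
    apply: (@continuous_comp_fun _ _ _ (fun x : R * R => x.2) (fun t : R => t%:C)).
      exact: continuous_snd.
    exact: continuous_real_complex.
  apply: continuous_subc; last exact: cst_continuous.
  apply: (@continuous_comp_fun _ _ _ (fun x : R * R => x.1) (fun t => c (clamp t))).
    exact: continuous_fst.
  by apply: (@continuous_comp_fun _ _ _ clamp c); [exact: clamp_continuous|].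
have := @square_start _ A Q cQ; rewrite /Q /= clamp0 clamp1 => H.
apply: homot_eq (H _ _) => //.
- move=> t /andP[t0 t1]; rewrite /path_cat; case: ifP => // t2.
  rewrite mul1r clamp_id; first by rewrite addrC subrK.
  by move: t2 => /negbT; rewrite -ltNge => ?; apply/andP; split; lra.
- by move=> x _; rewrite !mul0r.
- move=> x y x01 /andP[y0 y1]; rewrite clamp_id //; have [h1 h2] := hc x x01.
  apply: hA.
    move=> E; have /eqP : y%:C * (c x - p) = 0 by apply: (addrI p); rewrite E addr0.
    rewrite mulf_eq0 subr_eq0; move=> /orP[/eqP/complexI/eqP|/eqP //]; by rewrite gt_eqF.
  rewrite addrC addKr normcM normc_real gtr0_norm //; apply: le_lt_trans h2.
  by rewrite ler_piMl // normc_ge0.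
Qed.

(** The beginning of [g] is straightened to a segment and turned about [g 0] into the horizontal
    direction. After that, the ray and [g] differ by a loop, which has a word. *)
Lemma curve_words_nonempty (V : set C) (g : R -> C) : finite_set V ->
  continuous (fun t : R => g (Num.max 0 t)) -> V (g 0) -> (forall t, 0 < t -> ~ V (g t)) ->
  (exists r : R, forall t, 0 <= t -> r < Re (g t)) ->
  (forall M : R, exists T, forall t, T <= t -> M < normc (g t)) ->
  exists m, curve_words V g m.
Proof.
move=> finV cg Vg gV [r1 hr1] gfar.
have [r2 hr2] := finite_bounded_below finV.
(* The 1 leaves the room on the left that [generic_parameters] asks for. *)
pose r := Num.min r1 (r2 - 1).
have [|e [dl [eta [sr dl01 sep e_eta e_gap]]]] := @generic_parameters _ V finV r.
  move=> w Vw; apply: le_lt_trans (hr2 w Vw).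
  by rewrite -lerBrDr ge_min lexx orbT.
have [e0 sr2 sr3] := sr.
pose X := punctured_half_plane V r; pose w := g 0.
have rg t : 0 <= t -> r < Re (g t) by move=> t0; apply: le_lt_trans (hr1 t t0); rewrite ge_min lexx.
have ball_X z : z <> w -> normc (z - w) < e -> X (Some z).
  move=> zw ze; apply: half_plane_Some.
    have := Re_le_normc (w - z); rewrite normcB ReB => h.
    by have := sr2 w Vg; have := ler_norm (Re w - Re z); lra.
  move=> Vz; have := sr3 w z Vg Vz (not_eq_sym zw); rewrite normcB; lra.
have pg : is_path X (path_to_infty g).
  apply: is_path_to_infty => // t t0; apply: half_plane_Some; first by apply: rg; exact: ltW.
  exact: gV.
have [T T0 hT] : exists2 T, 0 < T & forall t, 0 <= t <= T -> normc (g t - w) < e.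
  have cg0 : \forall t \near (0 : R), normc (g (Num.max 0 t) - g (Num.max 0 0)) < e.
    by have := (continuous_normcP _).1 cg 0 e e0.
  have [d /= d0 hd] := (nbhs_ballP _ _).1 cg0.
  exists (d / 2); first by rewrite divr_gt0.
  move=> t /andP[t0 td]; have := hd t; rewrite /= maxxx (max_idPr t0); apply.
  by rewrite /ball /= sub0r normrN ger0_norm //; lra.
have gne t : 0 < t -> g t <> w by move=> t0 E; apply: (gV t t0); rewrite E.
pose x := g T; pose p0 (t : R) : sphere R := Some (g (t * T)).
pose rest := path_to_infty (fun s => g (T + s)).
have h_split : homot X (path_to_infty g) (path_cat p0 rest) by exact: path_to_infty_split.
have h_p0 : homot X p0 (segment w x).
  have := @straighten_start X (fun t => g (Num.max 0 (t * T))) e.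
  rewrite /= mul0r maxxx mul1r (max_idPr (ltW T0)) -/w -/x => H.
  apply: homot_eq (H _ _ _ ball_X).
  - by move=> t /andP[t0 _]; rewrite /p0 (max_idPr _) // mulr_ge0 // ltW.
  - by [].
  - apply: (@continuous_comp_fun _ _ _ (fun t : R => t * T) (fun t : R => g (Num.max 0 t))).
      by apply: continuous_funM; [exact: continuous_idfun|exact: cst_continuous].
    exact: cg.
  - move=> t /andP[t0 _]; have tT : 0 < t * T by rewrite mulr_gt0.
    by rewrite (max_idPr (ltW tT)); exact: gne.
  - move=> t /andP[t0 t1]; have tT : 0 <= t * T by rewrite mulr_ge0 // ltW.
    by rewrite (max_idPr tT); apply: hT; rewrite tT ler_piMl // ltW.
pose e' := e / 2; have e'0 : 0 < e' by rewrite divr_gt0.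
pose p := w + e'%:C.
have xw : x <> w by exact: gne.
have xw0 : 0 < normc (x - w) by rewrite normc_gt0 subr_eq0; apply/eqP.
have xwe : normc (x - w) < e by apply: hT; rewrite (ltW T0) lexx.
have [th _ hth] := polar (x - w).
(* The curve [c] is a spiral about [w] from [p], to the right of [w], to [x]. Adding a full turn to
   the angle [th] would lead to another word of the same coset. *)
pose mm (s : R) := (1 - s) * e' + s * normc (x - w).
pose c (s : R) : C := w + (mm s)%:C * (cos (s * th) +i* sin (s * th)).
have cnorm s : normc (c s - w) = `|mm s|.
  by rewrite /c addrC addKr normcM normc_real /= cos2Dsin2 sqrtr1 mulr1.
have mm_bd s : 0 <= s <= 1 -> 0 < mm s < e.
  move=> s01; apply/andP; split; last by apply: interp_lt => //; rewrite /e'; lra.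
  have := @interp_lt _ s (- e') (- normc (x - w)) 0 s01; rewrite !oppr_lt0 => /(_ e'0 xw0).
  by rewrite /mm; lra.
have cc : continuous c.
  apply: continuous_addc; first exact: cst_continuous.
  have ca : continuous (fun s : R => s * th).
    by apply: continuous_funM; [exact: continuous_idfun|exact: cst_continuous].
  apply: continuous_mulc.
    apply: (@continuous_comp_fun _ _ _ mm (fun t : R => t%:C)); last exact: continuous_real_complex.
    by apply: continuous_interp; [exact: continuous_idfun|exact: cst_continuous|exact: cst_continuous].
  apply: continuous_complex.
    by apply: (@continuous_comp_fun _ _ _ (fun s : R => s * th) cos) => //; exact: continuous_cos.
  by apply: (@continuous_comp_fun _ _ _ (fun s : R => s * th) sin) => //; exact: continuous_sin.
have c0 : c 0 = p.
  by rewrite /c /mm !mul0r cos0 sin0 subr0 mul1r addr0 /p; congr (_ + _); rewrite mulr1.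
have c1 : c 1 = x.
  by rewrite /c /mm !mul1r subrr mul0r add0r -hth addrC subrK.
have hc s : 0 <= s <= 1 -> c s <> w /\ normc (c s - w) < e.
  move=> s01; have /andP[m0 m1] := mm_bd s s01; rewrite cnorm gtr0_norm //; split => //.
  by move=> E; move: (cnorm s); rewrite E subrr normc0 gtr0_norm // => E2; move: m0; rewrite -E2 ltxx.
have h_cone : homot X (path_cat (segment w p) (fun t => Some (c t))) (segment w x).
  by rewrite -c0 -c1; exact: cone_homot ball_X.
pose T' := path_to_infty (fun s => bypass_ray V e w (e' + s)).
have h_str : homot X (path_to_infty (bypass_ray V e w)) (path_cat (segment w p) T').
  apply: homot_trans (path_to_infty_split e'0 (homot_path_l (bypass_homot finV sr sr Vg))) _.
  have bE t : 0 <= t <= 1 -> bypass_ray V e w (t * e') = w + (t * e')%:C.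
    move=> /andP[t0 t1]; apply: (bypass0 finV sr Vg).
    by rewrite mulr_ge0 ?(ltW e'0) //= /e'; nra.
  have hb := homot_path_r (path_to_infty_split e'0 (homot_path_l (bypass_homot finV sr sr Vg))).
  apply: homot_of_eq hb => t /andP[t0 t1]; rewrite /path_cat; case: ifP => // t2.
  rewrite bE; last by apply/andP; split; lra.
  by rewrite /segment /p (addrC w e'%:C) addrK rmorphM.
have XN : X None by right.
have Xb s : 0 < s -> X (Some (bypass_ray V e w s)) by exact: bypass_in.
have hT' : path_from_to X (Some p) None T'.
  have bp : bypass_ray V e w e' = p.
    by apply: (bypass0 finV sr Vg); rewrite (ltW e'0) /= /e'; lra.
  split => //; last first.
  - by rewrite -bp; exact: Xb.
  - by rewrite /T' path_to_infty1.
  - by rewrite /T' path_to_infty0 addr0 bp.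
  apply: is_path_to_infty.
  - have ce' : continuous (fun t : R => e' + Num.max 0 t).
      apply: continuous_funD; first exact: cst_continuous.
      by apply: continuous_funmax; [exact: cst_continuous|exact: continuous_idfun].
    have ce : continuous (fun _ : R => e) by exact: cst_continuous.
    exact: (continuous_bypass finV ce ce').
  - move=> M; have [S hS] := bypass_far V e w M; exists (S - e') => s hs; apply: hS; lra.
  - by move=> t t0; apply: Xb; lra.
have hrest : path_from_to X (Some x) None rest.
  split => //; rewrite /rest ?path_to_infty0 ?path_to_infty1 ?addr0 //; last first.
    by apply: half_plane_Some; [apply: rg; exact: ltW|exact: gV].
  apply: is_path_to_infty.
  - have cT : continuous (fun t : R => T + Num.max 0 t).
      apply: continuous_funD; first exact: cst_continuous.
      by apply: continuous_funmax; [exact: cst_continuous|exact: continuous_idfun].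
    have -> : (fun t : R => g (T + Num.max 0 t)) = (fun t : R => g (Num.max 0 (T + Num.max 0 t))).
      apply/funext => t; have h : 0 <= T + Num.max 0 t by rewrite addr_ge0 ?(ltW T0) // le_max lexx.
      by rewrite (max_idPr h).
    exact: (@continuous_comp_fun _ _ _ (fun t : R => T + Num.max 0 t) (fun t : R => g (Num.max 0 t)) cT cg).
  - move=> M; have [S hS] := gfar M; exists (S - T) => s hs; apply: hS; lra.
  - by move=> t t0; apply: half_plane_Some; [apply: rg; lra|apply: gV; lra].
pose cp (t : R) : sphere R := Some (c t).
have hcp : path_from_to X (Some p) (Some x) cp.
  have Xc s : 0 <= s <= 1 -> X (Some (c s)) by move=> /hc[? ?]; exact: ball_X.
  split; rewrite /cp ?c0 ?c1 //; last first.
  - by rewrite -c1; apply: Xc; exact: itv1.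
  - by rewrite -c0; apply: Xc; exact: itv0.
  split; last by move=> t /ltW_itv; exact: Xc.
  apply: (@continuous_comp_fun _ _ _ clamp (fun t : R => Some (c t) : sphere R)).
    exact: clamp_continuous.
  exact: continuous_Some.
(* From infinity back along the ray to [p], around to [x], and out along [g]. *)
pose loop := concat None [:: path_rev T'; cp; rest].
have chl : chain X None [:: path_rev T'; cp; rest] None.
  exact: chain_cons (path_from_to_rev hT') (chain_cons hcp (chain1 hrest)).
have hloop : path_from_to X None None loop by exact: chain_path chl.
have E1 : homot X (path_cat T' loop) (path_cat cp rest).
  apply: (@eqv_homot _ X (Some p) None).
  apply: eqv_trans (eqv_path_cat hT' hloop) _; apply: eqv_trans _ (eqv_sym (eqv_path_cat hcp hrest)).
  apply: (@eqv_trans _ _ _ _ _ [:: T'; path_rev T'; cp; rest]).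
    apply: (@eqv_cat _ _ _ None _ [:: _] [:: _]); first exact: eqv_refl (chain1 hT').
    exact: eqv_concat.
  apply: (@eqv_cat _ _ _ (Some p) _ [:: _; _] [::]); first exact: eqv_rev_r hT'.
  exact: eqv_refl (chain_cons hcp (chain1 hrest)).
have [m lm hm] := loop_word finV sr dl01 sep e_eta e_gap hloop.
have [m' fm' hm'] := reduce_word finV sr lm.
have [pT' T'0 T'1 Xp _] := hT'; have [pl l0 l1 _ _] := hloop.
have [pcp cp0 cp1 _ Xx] := hcp; have [pr rest0 _ _ _] := hrest.
have psw : is_path X (segment w p).
  split; first by apply: (@continuous_comp_fun _ _ _ clamp (segment w p)); [exact: clamp_continuous|exact: segment_continuous].
  move=> t /andP[t0 t1]; rewrite /segment /p addrAC subrr add0r -rmorphM /=.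
  have te : 0 < t * e' by rewrite mulr_gt0.
  apply: ball_X.
    by move=> E; have /complexI/eqP : (t * e')%:C = 0 :> C by [apply: (addrI w); rewrite E addr0]; rewrite gt_eqF.
  rewrite addrC addKr normc_real gtr0_norm // /e'; nra.
exists m'; split => //; exists r, e, loop; split => //.
- apply/homotopic_inP.
  apply: homot_trans (cat_hom h_str (homot_refl pl) _ _) _.
  + by rewrite path_to_infty1 l0.
  + by rewrite path_to_infty1.
  apply: homot_trans (cat_assoc psw pT' pl _ _ _ _) _; rewrite ?segment1 ?T'0 ?T'1 ?l0 //.
  apply: homot_trans (cat_hom (homot_refl psw) E1 _ _) _; rewrite ?segment1 ?path_cat0 ?T'0 //.
  apply: homot_trans (homot_sym (cat_assoc psw pcp pr _ _ _ _)) _; rewrite ?segment1 ?cp0 ?cp1 ?rest0 //.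
  apply: homot_trans (cat_hom h_cone (homot_refl pr) _ _) _.
  + by rewrite path_cat1 rest0 c1.
  + by rewrite path_cat1 c1.
  apply: homot_trans _ (homot_sym h_split).
  apply: cat_hom (homot_sym h_p0) (homot_refl pr) _ _; rewrite segment1 ?rest0 //.
- by apply/homotopic_inP; exact: homot_trans hm hm'.
Qed.

End Start.

(** * Isotopies *)

Section Families.
Context {R : realType}.
Local Notation C := R[i].
Implicit Types (K L : R -> C -> C) (S : set C).

Definition homeo_family K :=
  continuous (fun x : R * C => K x.1 x.2) /\ forall u, homeomorphism (K u).

Lemma family_apply (S : topologicalType) K (f : S -> R) (g : S -> C) :
  homeo_family K -> continuous f -> continuous g -> continuous (fun x => K (f x) (g x)).
Proof.
move=> [cK _] cf cg.
apply: (@continuous_comp_fun _ _ _ (fun x => (f x, g x)) (fun x : R * C => K x.1 x.2)).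
  exact: continuous_pair.
exact: cK.
Qed.

Lemma family_inj K u : homeo_family K -> injective (K u).
Proof. by move=> [_ /(_ u)[_ [g [_ gK _]]]]; exact: can_inj gK. Qed.

Lemma family_clamp K : isotopy K -> homeo_family (fun u => K (clamp u)).
Proof.
move=> [cK hK]; split; last by move=> u; apply: hK; exact: clamp_itv.
have cc : continuous (fun x : R * C => (clamp x.1, x.2)).
  apply: continuous_pair; last exact: continuous_snd.
  apply: (@continuous_comp_fun _ _ _ (fun x : R * C => x.1) clamp).
    exact: continuous_fst.
  exact: clamp_continuous.
apply: (within_comp cK cc) => x; split => //=.
by rewrite in_itv /=; exact: clamp_itv.
Qed.

Lemma family_isotopy K : homeo_family K -> isotopy K.
Proof.
move=> [cK hK]; split; last by move=> u _; exact: hK.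
exact: (@continuous_subspaceT _ _ _ (fun x : R * C => K x.1 x.2) cK).
Qed.

Lemma family_glue K L : homeo_family K -> homeo_family L -> K 0 = L 0 ->
  homeo_family (fun u => if u <= 2^-1 then K (1 - 2 * u) else L (2 * u - 1)).
Proof.
move=> fK fL KL; split; last by move=> u; case: ifP => _; [exact: fK.2|exact: fL.2].
have c1 (k l : R) : continuous (fun x : R * C => k * x.1 + l).
  apply: (@continuous_comp_fun _ _ _ (fun x : R * C => x.1) (fun t : R => k * t + l)).
    exact: continuous_fst.
  exact: continuous_scale.
have -> : (fun x : R * C => (if x.1 <= 2^-1 then K (1 - 2 * x.1) else L (2 * x.1 - 1)) x.2) =
  (fun x => if x.1 <= 2^-1 then K (- 2 * x.1 + 1) x.2 else L (2 * x.1 + - 1) x.2).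
  by apply/funext => x; case: ifP => // _; rewrite mulNr addrC.
apply: continuous_if_le.
- by apply: (family_apply fK); [exact: c1|exact: continuous_snd].
- by apply: (family_apply fL); [exact: c1|exact: continuous_snd].
- exact: continuous_fst.
- exact: cst_continuous.
- move=> x ->; have -> : - 2 * 2^-1 + 1 = 0 :> R by rewrite mulNr divff ?addNr // pnatr_eq0.
  by have -> : 2 * 2^-1 + - 1 = 0 :> R; [rewrite divff ?subrr // pnatr_eq0|rewrite KL].
Qed.

(** If [Phi] follows a strand of [K], then composing [K] with the inverse [Psi] brings the strand
    back to its starting point. *)
Lemma family_unpush Phi Psi K : mutual_inverses Phi Psi -> homeo_family K ->
  homeo_family (fun u z => Psi (clamp u) (K u z)).
Proof.
move=> [c1 c2 h] fK; split.
  apply: (continuous_clamp_apply c2); first exact: continuous_fst.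
  by apply: (family_apply fK); [exact: continuous_fst|exact: continuous_snd].
move=> u; have [cK [g [cg Kg gK]]] := fK.2 u.
have [PQ QP] := h _ (clamp_itv u).
have cl (F : R -> C -> C) : continuous (fun x : R * C => F (clamp x.1) x.2) ->
    continuous (F (clamp u)).
  move=> cF; apply: (continuous_clamp_apply cF (f := fun=> u) (g := fun z => z)).
    exact: cst_continuous.
  exact: continuous_idfun.
split; first exact: (continuous_comp_fun cK (cl _ c2)).
exists (fun z => g (Phi (clamp u) z)); split.
- exact: (continuous_comp_fun (cl _ c1) cg).
- by move=> z; rewrite QP Kg.
- by move=> z; rewrite gK PQ.
Qed.

Definition near_identity S K := forall e : R, 0 < e -> exists M : R, forall u z,
  0 <= u <= 1 -> S z -> M < normc z -> normc (K u z - z) < e.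

(** The part of [near_identity] that survives the corrections; bounded displacement is enough to
    keep moved legs in a half-plane and tending to infinity uniformly. *)
Definition tame S K := exists D : R, forall u z,
  0 <= u <= 1 -> S z -> normc (K u z - z) <= D.

Lemma near_identity_tame S K : homeo_family K -> near_identity S K -> tame S K.
Proof.
move=> fK /(_ 1 ltr01)[M hM].
have cf : continuous (fun x : R * C => normc (K x.1 x.2 - x.2)).
  apply: (@continuous_comp_fun _ _ _ (fun x : R * C => K x.1 x.2 - x.2) (@normc R)).
    apply: continuous_subc; last exact: continuous_snd.
    exact: fK.1.
  exact: normc_continuous.
have cpt : compact (`[0, 1] `*` [set z : C | normc z <= M] : set (R * C)).
  by apply: compact_setX; [exact: segment_compact|exact: compact_closed_disc].
have [D hD] := compact_bounded_above cpt cf.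
exists (Num.max 1 D) => u z u01 Sz; rewrite le_max.
have [zM|zM] := leP (normc z) M; last by rewrite (ltW (hM _ _ u01 Sz zM)).
by rewrite (hD (u, z)) ?orbT //; split => //=; rewrite in_itv.
Qed.

Lemma polar_pi (z : C) (rho : R) : normc z = rho -> exists2 x : R, 0 <= x <= 1 &
  z = rho%:C * (cos ((2 * x - 1) * pi) +i* sin ((2 * x - 1) * pi)).
Proof.
move=> zr; have [th th1 hz] := polar z.
have p0 : 0 < (pi : R) by exact: pi_gt0.
exists ((th / pi + 1) / 2).
  have [h1 h2] : - 1 <= th / pi /\ th / pi <= 1.
    by rewrite ler_pdivlMr // ler_pdivrMr // mulN1r mul1r; apply/andP.
  by apply/andP; split; lra.
have -> : 2 * ((th / pi + 1) / 2) - 1 = th / pi by lra.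
rewrite divfK ?(lt0r_neq0 p0) //.
by rewrite -zr.
Qed.

(** For [u] near [t] a large circle around [p] is mapped outside the disc of radius [B0], while [p]
    itself is mapped to [q] in that disc; so no point beyond the circle can enter the disc. Real
    induction makes this uniform in [u]. *)
Lemma family_proper K p q : homeo_family K -> (forall u, 0 <= u <= 1 -> K u p = q) ->
  forall B : R, exists B', forall u z, 0 <= u <= 1 -> B' < normc z -> B < normc (K u z).
Proof.
move=> fK Kpq B; pose B0 := Num.max B (normc q).
have near_t t : 0 <= t <= 1 -> exists e B', 0 < e /\ forall u z, 0 <= u <= 1 -> `|u - t| < e ->
    B' < normc z -> B < normc (K u z).
  move=> t01; have [cKt [g [cg gK Kg]]] := fK.2 t.
  have [M hM] := compact_bounded_above (@compact_closed_disc R (B0 + 1))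
    (continuous_comp_fun cg (@normc_continuous R)).
  pose B' := Num.max M (normc p) + 1.
  have B'M : M < B' by rewrite ltr_pwDr // le_max lexx.
  have B'p : normc p < B' by rewrite ltr_pwDr // le_max lexx orbT.
  have B'0 : 0 < B' by apply: le_lt_trans B'p; exact: normc_ge0.
  have circ z : normc z = B' -> B0 + 1 < normc (K t z).
    move=> zB; rewrite ltNge; apply/negP => /hM /=; rewrite gK zB; lra.
  pose F (x : R * R) := K x.2 (B'%:C * (cos ((2 * x.1 - 1) * pi) +i* sin ((2 * x.1 - 1) * pi))).
  have ca : continuous (fun x : R * R => (2 * x.1 - 1) * pi).
    apply: continuous_funM; last exact: cst_continuous.
    apply: (@continuous_comp_fun _ _ _ (fun x : R * R => x.1) (fun t : R => 2 * t + -1)).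
      exact: continuous_fst.
    exact: continuous_scale.
  have cF : continuous F.
    apply: (family_apply fK); first exact: continuous_snd.
    apply: continuous_mulc; first exact: cst_continuous.
    apply: continuous_complex.
      by apply: (continuous_comp_fun ca); exact: continuous_cos.
    by apply: (continuous_comp_fun ca); exact: continuous_sin.
  have [e e0 he] := uniform_in_first t cF ltr01.
  exists e, B'; split => // u z u01 ut zB.
  have circu y : normc y = B' -> B0 < normc (K u y).
    move=> yB; have := circ _ yB; have [x x01 {1 2}->] := polar_pi yB.
    have := he x u x01 ut; rewrite -/(F (x, u)) -/(F (x, t)) normcB => h1 h2.
    have := ler_dist_normc (F (x, t)) (F (x, u)); rewrite /F /= in h1 h2 *; lra.
  rewrite ltNge; apply/negP => KB.
  have [cKu [gu [cgu guK Kgu]]] := fK.2 u.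
  pose w (s : R) := q + s%:C * (K u z - q).
  have cw : continuous (fun s => normc (gu (w s))).
    apply: (@continuous_comp_fun _ _ _ (fun s => gu (w s)) (@normc R)).
      apply: (@continuous_comp_fun _ _ _ w gu).
        apply: continuous_addc; first exact: cst_continuous.
        by apply: continuous_mulc; [exact: continuous_real_complex|exact: cst_continuous].
      exact: cgu.
    exact: normc_continuous.
  have w0 : gu (w 0) = p by rewrite /w mul0r addr0 -(Kpq u u01) guK.
  have w1 : gu (w 1) = z by rewrite /w mul1r addrC subrK guK.
  have hB : Num.min (normc (gu (w 0))) (normc (gu (w 1))) <= B' <=
            Num.max (normc (gu (w 0))) (normc (gu (w 1))).
    by rewrite w0 w1 ge_min le_max (ltW B'p) (ltW zB) orbT.
  have [s] := @IVT R (fun s => normc (gu (w s))) 0 1 B' ler01 (continuous_subspaceT cw) hB.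
  rewrite in_itv /= => /andP[s0 s1] /circu; rewrite Kgu ltNge => /negP; apply.
  have -> : w s = (1 - s)%:C * q + s%:C * K u z by rewrite /w rmorphB /= rmorph1; ring.
  apply: le_trans (le_normcD _ _) _; rewrite !normcM !normc_real (ger0_norm s0).
  rewrite ger0_norm ?subr_ge0 //.
  have h1 : normc q <= B0 by rewrite le_max lexx orbT.
  have h2 : normc (K u z) <= B0 by rewrite le_max KB.
  nra.
pose P (s : R) := exists B', forall u z, 0 <= u <= s -> u <= 1 -> B' < normc z -> B < normc (K u z).
have P1 : P 1.
  apply: interval_induction.
    have [e [B' [e0 h]]] := near_t 0 itv0; exists B' => u z u0 u1; apply: h.
      by case/andP: u0 => -> _.
    rewrite subr0; case/andP: u0 => u0 u0'; have -> : u = 0 by apply/le_anti/andP.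
    by rewrite normr0.
  move=> t t01; have [e [B1 [e0 h]]] := near_t t t01; exists e => // s s' s0 ss' s'1 se s'e [B2 h2].
  exists (Num.max B1 B2) => u z /andP[u0 us'] u1; rewrite gt_max => /andP[z1 z2].
  have [us|us] := leP u s; first by apply: h2 => //; rewrite u0.
  apply: h => //; first by rewrite u0.
  by move: se s'e; rewrite !ltr_norml => /andP[? ?] /andP[? ?]; apply/andP; split; lra.
by have [B' hB'] := P1; exists B' => u z /andP[u0 u1]; apply: hB'; rewrite ?u0.
Qed.

End Families.

(** * A retraction of the half-plane with infinity to a disc *)

Section Retraction.
Context {R : realType}.
Local Notation C := R[i].
Variables (rho sigma : R).
Hypotheses (rho0 : 0 < rho) (rho_sigma : rho <= sigma).

(* [retract] is the identity on the disc of radius [rho] and the radial projection to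
   its boundary outside; the translation to the right by [pull], effective only beyond
   [sigma], makes it extend continuously to infinity. *)
Definition pull z : C := z + (Num.max 0 (normc z - sigma) * normc z)%:C.
Definition pull_scale z : R := normc (pull z) + Num.max 0 (rho - normc z).
Definition retract (y : sphere R) : C :=
  if y is Some z then (rho / pull_scale z)%:C * pull z else rho%:C.

Lemma retract_id z : normc z <= rho -> retract (Some z) = z.
Proof.
move=> zr; have p : pull z = z.
  by rewrite /pull (max_idPl _) ?mul0r ?addr0 // subr_le0 (le_trans zr).
by rewrite /retract /pull_scale p (max_idPr _) ?subr_ge0 // addrC subrK divff ?mul1r // gt_eqF.
Qed.

(** For [normc z] at least [rho], [pull z = 0] would force [z] onto the negative real axis at
    distance more than [sigma], outside the half-plane. *)
Lemma pull_scale_gt0 z : - sigma < Re z -> 0 < pull_scale z.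
Proof.
move=> zs; have m0 : 0 <= Num.max 0 (rho - normc z) by rewrite le_max lexx.
have := normc_ge0 (pull z); rewrite le_eqVlt => /orP[|n0]; last by rewrite ltr_pwDl.
rewrite eq_sym normc_eq0 => /eqP; rewrite /pull => E.
have [zr|zr] := ltP (normc z) rho.
  by rewrite ltr_pwDr ?normc_ge0 // lt_max subr_gt0 zr orbT.
exfalso; have zn : 0 < normc z by exact: lt_le_trans zr.
have I0 : Im z = 0 by have := congr1 (@complex.Im R) E; rewrite ImD /= addr0.
have := congr1 (@complex.Re R) E; rewrite ReD /= => ER.
have nR : normc z = `|Re z|.
  by apply: le_anti; rewrite Re_le_normc andbT; apply: le_trans (normc_le_Re_Im _) _; rewrite I0 normr0 addr0.
have [R0|R0] := ler0P (Re z).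
  move: nR; rewrite ler0_norm // => nR; move: ER.
  by rewrite (max_idPl _) ?mul0r ?addr0; lra.
by have : 0 <= Num.max 0 (normc z - sigma) * normc z; [rewrite mulr_ge0 ?normc_ge0 // le_max lexx|lra].
Qed.

Lemma normc_retract z : - sigma < Re z -> rho <= normc z -> normc (retract (Some z)) = rho.
Proof.
move=> /pull_scale_gt0; rewrite /retract /pull_scale => s0 zr; move: s0.
rewrite (max_idPl _) ?subr_le0 // addr0 => s0.
by rewrite normcM normc_real ger0_norm ?divr_ge0 ?ltW // divfK // gt_eqF.
Qed.

Lemma continuous_pull : continuous pull.
Proof.
apply: continuous_addc; first exact: continuous_idfun.
apply: (@continuous_comp_fun _ _ _ (fun z : C => Num.max 0 (normc z - sigma) * normc z)
  (fun t : R => t%:C)); last exact: continuous_real_complex.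
apply: continuous_funM; last exact: normc_continuous.
apply: continuous_funmax; first exact: cst_continuous.
apply: (@continuous_comp_fun _ _ _ (@normc R) (fun t : R => t - sigma)).
  exact: normc_continuous.
by apply: continuous_funD; [exact: continuous_idfun|exact: cst_continuous].
Qed.

Lemma continuous_pull_scale : continuous pull_scale.
Proof.
apply: continuous_funD.
  apply: (@continuous_comp_fun _ _ _ pull (@normc R)); first exact: continuous_pull.
  exact: normc_continuous.
apply: continuous_funmax; first exact: cst_continuous.
apply: continuous_funD; first exact: cst_continuous.
by apply: continuous_funN; exact: normc_continuous.
Qed.

(** The translation by [(normc z - sigma) * normc z] grows faster than [normc z], so the direction
    of [pull z] tends to that of the positive real axis. *)
Lemma retract_cvg_None : {for (None : sphere R), continuous retract}.
Proof.
apply: (cvg_normc (nbhs_filter (None : sphere R)) retract rho%:C).2 => e e0.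
apply: (@nbhs_None _ _ (sigma + 1 + 2 * rho / e)); last by rewrite [retract None]/retract subrr normc0.
move=> z hz; set n := normc z in hz.
have q0 : 0 < 2 * rho / e by rewrite divr_gt0 // mulr_gt0.
have nq : sigma + 1 < n by apply: lt_trans hz; rewrite ltrDl.
have n0 : 0 < n by apply: lt_trans nq; rewrite ltr_wpDl // ltW // (lt_le_trans rho0).
pose m := (n - sigma) * n.
have pE : pull z = z + m%:C by rewrite /pull (max_idPr _) // -/n; lra.
pose W := normc (pull z).
have sE : pull_scale z = W by rewrite /pull_scale (max_idPl _) ?addr0 // -/n subr_le0 (le_trans rho_sigma) // ltW // (lt_trans _ nq) // ltrDl.
have m0 : 0 <= m by rewrite mulr_ge0; lra.
have h1 : normc (pull z - m%:C) = n by rewrite pE addrK.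
have h2 : W - m <= n by have := ler_dist_normc (pull z) m%:C; rewrite h1 normc_real (ger0_norm m0).
have h3 : m - W <= n.
  by have := ler_dist_normc m%:C (pull z); rewrite normcB h1 normc_real (ger0_norm m0).
have W0 : 0 < W.
  have : 0 < (n - sigma - 1) * n by rewrite mulr_gt0 // subr_gt0 -subr_gt0; lra.
  have -> : (n - sigma - 1) * n = m - n by rewrite /m; ring.
  by move: h3; lra.
rewrite [retract _]/retract sE.
have -> : (rho / W)%:C * pull z - rho%:C = (rho / W)%:C * (pull z - W%:C).
  rewrite mulrBr; congr (_ - _).
  by rewrite -rmorphM /= divfK // gt_eqF.
rewrite normcM normc_real ger0_norm ?divr_ge0 ?ltW //.
have h4 : normc (pull z - W%:C) <= 2 * n.
  apply: le_trans (normc_triangle _ m%:C _) _; rewrite h1 -rmorphB normc_real.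
  have : `|m - W| <= n by rewrite ler_norml; apply/andP; split; lra.
  by lra.
rewrite mulrAC ltr_pdivrMr //.
apply: (@le_lt_trans _ _ (rho * (2 * n))); first by rewrite ler_pM2l.
have : 2 * rho < e * (n - sigma - 1).
  by rewrite [ltRHS]mulrC -ltr_pdivrMr // !ltrBrDl addrA.
move=> h5.
have h6 : (n - sigma - 1) * n <= W.
  have -> : (n - sigma - 1) * n = m - n by rewrite /m; ring.
  by move: h3; lra.
apply: (@lt_le_trans _ _ (e * ((n - sigma - 1) * n))); last by rewrite ler_pM2l.
by rewrite !mulrA ltr_pM2r // mulrC.
Qed.

Lemma continuous_retract z : - sigma < Re z -> {for (Some z : sphere R), continuous retract}.
Proof.
move=> /pull_scale_gt0 s0.
have [nS cS] := @local_Some R _ (fun y : sphere R => y) (Some z) z (@cvg_id _ _) erefl.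
pose f (w : C) : C := (rho / pull_scale w)%:C * pull w.
have cq : {for z, continuous (fun w => rho / pull_scale w)}.
  have c0 : {for z, continuous (fun _ : C => rho)} by exact: cst_continuous.
  apply: (cvgM c0).
  by apply: cvgV; [exact: lt0r_neq0 s0|exact: continuous_pull_scale].
have cq2 : {for z, continuous (fun w => (rho / pull_scale w)%:C)}.
  exact: (@continuous_comp _ _ _ (fun w => rho / pull_scale w) (fun t : R => t%:C) z cq (@continuous_real_complex R _)).
have cf : {for z, continuous f}.
  exact: (@cvgM C _ _ _ _ _ _ _ cq2 (@continuous_pull z)).
apply: (cvg_normc (nbhs_filter (Some z : sphere R)) retract (f z)).2 => e e0.
have h : \forall w \near z, normc (f w - f z) < e by exact: ((cvg_normc _ _ _).1 cf e e0).
have h' : \forall y \near (Some z : sphere R), normc (f (odflt 0 y) - f z) < e by exact: cS h.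
by apply: filterS2 nS h' => y {2}->.
Qed.

(** The retracted homotopy consists of unmoved points and of points on the circle of radius [rho],
    which contains no point of [V]. *)
Lemma homot_retract (V : set C) (r : R) (l : R -> C) (b : C) :
  - sigma <= r -> (forall z, V z -> normc z <> rho) -> r < Re b ->
  (forall t, 0 <= t <= 1 -> normc (l t) <= rho) -> normc b <= rho ->
  homot (punctured_half_plane V r) (fun t => Some (l t)) (fun=> Some b) ->
  homot [set z | ~ V z /\ normc z <= rho] l (fun=> b).
Proof.
move=> sr Vrho rb lrho brho hl.
pose B : set (sphere R) := [set y | if y is Some z then r < Re z else True].
have [/= [l0] [l1]] := homot_ends hl.
apply: homot_eq (homot_map (B := B) (F := retract) _ _ _ _ _ hl).
- by move=> t t01 /=; rewrite -/(retract (Some _)) retract_id // lrho.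
- by move=> t t01; rewrite /= -/(retract (Some b)) retract_id.
- apply: continuous_in_subspaceT => -[z|]; rewrite inE /= => rz.
    by apply: continuous_retract; exact: le_lt_trans sr rz.
  exact: retract_cvg_None.
- by move=> y [[z [rz _] <-]|->].
- by rewrite /B /= l0.
- by rewrite /B /= l1.
- move=> y [[z [rz Vz] <-]|->]; last first.
    change (~ V rho%:C /\ normc rho%:C <= rho); have nr : normc rho%:C = rho by rewrite normc_real gtr0_norm.
    by rewrite nr; split => // /Vrho; rewrite nr.
  have [zr|zr] := leP (normc z) rho; first by rewrite retract_id.
  have nr := normc_retract (le_lt_trans sr rz) (ltW zr).
  by split; [move=> /Vrho; rewrite nr|rewrite nr].
Qed.

End Retraction.

(** * From equal words to isotopies *)

Section Legs.
Context {R : realType}.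
Local Notation C := R[i].
Variables (S : set C) (a : nat -> C) (leg : nat -> R -> C).

(** What the topological arguments use of the dynamics on the rays. *)
Definition leg_system := [/\
  forall n, continuous (fun t : R => leg n (Num.max 0 t)) /\ leg n 0 = a n,
  forall i n t, (i <= n)%N -> 0 <= t -> (i = n -> 0 < t) -> leg n t != a i,
  forall n t, 0 <= t -> S (leg n t),
  forall n (M : R), exists2 T, 0 <= T & forall t, T <= t -> M < Re (leg n t) &
  (exists N, forall m n, (N <= m)%N -> (m < n)%N -> Re (a m) + 1 <= Re (a n)) /\
  forall M : R, exists N, forall n, (N <= n)%N -> M < normc (a n)].

Hypothesis legs : leg_system.
Implicit Types (K : R -> C -> C) (n : nat).

Lemma leg_cont n : continuous (fun t : R => leg n (Num.max 0 t)).
Proof. by have [/(_ n)[]] := legs. Qed.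

Lemma leg_start n : leg n 0 = a n. Proof. by have [/(_ n)[]] := legs. Qed.

Lemma leg_avoids i n t : (i <= n)%N -> 0 <= t -> (i = n -> 0 < t) -> leg n t != a i.
Proof. by have [_ h _ _ _] := legs; exact: h. Qed.

Lemma leg_S n t : 0 <= t -> S (leg n t).
Proof. by have [_ _ h _ _] := legs; exact: h. Qed.

Lemma leg_right n M : exists2 T, 0 <= T & forall t, T <= t -> M < Re (leg n t).
Proof. by have [_ _ _ h _] := legs; exact: h. Qed.

Lemma a_escapes M : exists N, forall n, (N <= n)%N -> M < normc (a n).
Proof. by have [_ _ _ _ [_ h]] := legs; exact: h. Qed.

Lemma a_S n : S (a n). Proof. by rewrite -leg_start; apply: leg_S. Qed.

Lemma a_inj i j : a i = a j -> i = j.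
Proof.
have h k l : (k < l)%N -> a l != a k.
  by move=> kl; rewrite -leg_start; apply: leg_avoids => //; [exact: ltnW|move=> E; rewrite E ltnn in kl].
by move=> E; case: (ltngtP i j) => // /h; rewrite E eqxx.
Qed.

Lemma tame_far K n : tame S K -> forall M : R, exists2 T, 0 <= T &
  forall u t, 0 <= u <= 1 -> T <= t -> M < normc (K u (leg n t)).
Proof.
move=> [D hD] M; have [T T0 hT] := leg_right n (M + D).
exists T => // u t u01 Tt; have h1 := hD u _ u01 (leg_S n (le_trans T0 Tt)).
have := ler_dist_normc (leg n t) (K u (leg n t)); rewrite normcB.
have := Re_le_normc (leg n t); have := hT t Tt; have := ler_norm (Re (leg n t)); lra.
Qed.

Lemma tame_Re K n : tame S K -> exists r : R,
  forall u t, 0 <= u <= 1 -> 0 <= t -> r < Re (K u (leg n t)).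
Proof.
move=> [D hD]; have [T T0 hT] := leg_right n 0.
have cR : continuous (fun t : R => - Re (leg n (Num.max 0 t))).
  apply: continuous_funN; apply: (continuous_comp_fun (@leg_cont n)).
  exact: Re_continuous.
have [M hM] := compact_bounded_above (@segment_compact R 0 T) cR.
exists (- Num.max M 0 - D - 1) => u t u01 t0.
have h1 := hD u _ u01 (leg_S n t0).
have h2 := Re_le_normc (leg n t - K u (leg n t)); rewrite normcB ReB in h2.
have h3 : - Num.max M 0 <= Re (leg n t).
  have [tT|Tt] := leP t T.
    have := hM t; rewrite /= in_itv /= t0 tT (max_idPr t0) => /(_ isT) h.
    by rewrite lerNl le_max h.
  by apply: (@le_trans _ _ 0); [rewrite oppr_le0 le_max lexx orbT|apply: ltW; apply: hT; exact: ltW].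
have := ler_norm (Re (leg n t) - Re (K u (leg n t))); lra.
Qed.

Lemma tame_orbit K : tame S K ->
  forall M : R, exists N, forall n u, (N <= n)%N -> 0 <= u <= 1 -> M < normc (K u (a n)).
Proof.
move=> [D hD] M; have [N hN] := a_escapes (M + D); exists N => n u Nn u01.
have h1 := hD u _ u01 (a_S n); have h2 := hN n Nn.
by have := ler_dist_normc (a n) (K u (a n)); rewrite normcB; lra.
Qed.

Lemma straighten_far K (phi psi : C -> C) : homeo_family K -> near_identity S K -> K 0 = phi -> K 1 = psi ->
  (forall n, phi (a n) = psi (a n)) ->
  exists K' M, [/\ homeo_family K', tame S K', K' 0 = phi, K' 1 = psi &
    forall m (u : R), (M <= m)%N -> 0 <= u <= 1 -> K' u (a m) = phi (a m)].
Proof.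
move=> fK nK K0 K1 pp.
have [D hD] := near_identity_tame fK nK.
(* The strands stay within 1/24 of [a m], hence within 1/12 of [b m], a quarter of the radius 1/3
   used for [push_separated]. The points [b m] are still 11/12 apart, more than twice that
   radius. *)
have e0 : 0 < 24^-1 :> R by rewrite invr_gt0.
have [B hB] := nK _ e0; have [N1 hN1] := a_escapes B.
have [_ _ _ _ [[N2 hN2] _]] := legs.
pose M := maxn N1 N2; pose b m := phi (a m).
have near_a m (u : R) : (M <= m)%N -> 0 <= u <= 1 -> normc (K u (a m) - a m) < 24^-1.
  by rewrite geq_max => /andP[m1 _] u01; apply: hB => //; [exact: a_S|exact: hN1].
have bn m : (M <= m)%N -> normc (b m - a m) < 24^-1.
  by move=> mM; rewrite /b -K0; apply: near_a => //; exact: itv0.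
have sep m l : (M <= m)%N -> (M <= l)%N -> m != l -> 2 * 3^-1 <= normc (b m - b l).
  move=> mM lM ml.
  have h1 : 1 <= normc (a m - a l).
    wlog lt : m l mM lM {ml} / (m < l)%N.
      by move=> W; case: (ltngtP m l) ml => // h _; [|rewrite normcB]; exact: W.
    have := hN2 m l; rewrite lt (leq_trans _ mM) ?leq_maxr // => /(_ isT isT) h.
    apply: le_trans (Re_le_normc _); rewrite ReB distrC.
    by apply: le_trans (ler_norm _); lra.
  have := bn m mM; have := bn l lM.
  have := normc_triangle (a m) (b m) (a l); have := normc_triangle (b m) (b l) (a l).
  rewrite (normcB (a m) (b m)); lra.
have cb m : continuous (fun u : R => K (clamp u) (a m)).
  by apply: (family_apply fK); [exact: clamp_continuous|exact: cst_continuous].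
have [||Phi [Psi [mi h1 h2 h3]]] := @push_separated R b (fun m (u : R) => K u (a m)) M 3^-1 _ sep cb.
- by rewrite invr_gt0.
- move=> m u mM u01.
  have := near_a m u mM u01; have := bn m mM.
  have := normc_triangle (K u (a m)) (a m) (b m); rewrite (normcB (a m) (b m)); lra.
have [_ _ can] := mi.
(* Used at the two ends, where the correction must not change [phi] and [psi]. *)
have fix_ (u : R) : 0 <= u <= 1 -> (forall m, K u (a m) = b m) -> forall z, Psi u z = z.
  by move=> u01 h z; have [_ PQ] := can u u01; rewrite -[LHS](h2 u) // PQ.
exists (fun u z => Psi (clamp u) (K u z)), M; split.
- exact: (family_unpush mi fK).
- exists (D + 3^-1) => u z u01 Sz; rewrite clamp_id //; have [_ PQ] := can u u01.
  have := h3 u (Psi u (K u z)) u01; rewrite PQ normcB => h4.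
  by have := normc_triangle (Psi u (K u z)) (K u z) z; have := hD u z u01 Sz; lra.
- by apply/funext => z; rewrite clamp0 fix_ ?K0 //; exact: itv0.
- by apply/funext => z; rewrite clamp1 fix_ ?K1 ?itv1 // => m; rewrite -pp.
- move=> m u mM u01; rewrite clamp_id //; have [QP _] := can u u01.
  by rewrite -(h1 m u mM u01) QP.
Qed.


Section Words.
Variables (phi psi : C -> C).
Hypothesis agree : forall n, phi (a n) = psi (a n).
Let V n : set C := [set phi (a i) | i in `I_n].
Hypothesis words : forall n,
  curve_words (V n.+1) (phi \o leg n) = curve_words (V n.+1) (psi \o leg n).

Lemma finite_V n : finite_set (V n).
Proof. by apply: finite_image; exact: finite_II. Qed.

(** Equality of the two cosets yields a common word because the one of [phi] is not empty. *)
Lemma words_homot K n : homeo_family K -> tame S K -> K 0 = phi -> K 1 = psi ->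
  exists r0, forall r, r <= r0 -> homot (punctured_half_plane (V n.+1) r)
    (path_to_infty (phi \o leg n)) (path_to_infty (psi \o leg n)).
Proof.
move=> fK tK K0 K1.
have Vb : V n.+1 ((phi \o leg n) 0) by exists n => //=; rewrite leg_start.
have [m hm] : exists m, curve_words (V n.+1) (phi \o leg n) m.
  apply: curve_words_nonempty.
  - exact: finite_V.
  - have cphi : continuous phi by rewrite -K0; have [] := fK.2 0.
    exact: (continuous_comp_fun (@leg_cont n) cphi).
  - exact: Vb.
  - move=> t t0 [i /= i_n]; rewrite -K0 => /(family_inj fK) E.
    by have := @leg_avoids i n t i_n (ltW t0) (fun _ => t0); rewrite E eqxx.
  - have [r hr] := tame_Re n tK; exists r => t t0; rewrite /= -K0; exact: hr itv0 t0.
  - move=> M; have [T T0 hT] := tame_far n tK M; exists T => t Tt.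
    by rewrite -[X in normc X]/(phi (leg n t)) -K0; exact: hT itv0 Tt.
apply: (common_word _ _ Vb hm); first exact: finite_V.
  by rewrite /= leg_start.
by rewrite -words.
Qed.

Lemma strand_null K n (B : R) : homeo_family K -> tame S K -> K 0 = phi -> K 1 = psi ->
  (forall i (u : R), (i < n)%N -> 0 <= u <= 1 -> K u (a i) = phi (a i)) ->
  exists r : R, [/\ r <= B, r < Re (phi (a n)) &
    homot (punctured_half_plane (V n) r) (fun t => Some (K t (a n))) (fun=> Some (phi (a n)))].
Proof.
move=> fK tK K0 K1 fixK.
have [r0 hr0] := words_homot n fK tK K0 K1; have [r1 hr1] := tame_Re n tK.
pose r := Num.min B (Num.min r0 r1).
have rB : r <= B by rewrite ge_min lexx.
have rr0 : r <= r0 by rewrite !ge_min lexx orbT.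
have rr1 : r <= r1 by rewrite !ge_min lexx !orbT.
have rK (u t : R) : 0 <= u <= 1 -> 0 <= t -> r < Re (K u (leg n t)).
  by move=> u01 t0; apply: le_lt_trans rr1 _; exact: hr1.
pose X := punctured_half_plane (V n) r.
have XK (u t : R) : 0 <= u <= 1 -> 0 <= t -> X (Some (K u (leg n t))).
  move=> u01 t0; apply: half_plane_Some; first exact: rK.
  move=> [i /= i_n]; rewrite -(fixK i u) // => /(family_inj fK) E.
  have : leg n t != a i.
    by apply: leg_avoids => //; [exact: ltnW|move=> E'; rewrite E' ltnn in i_n].
  by rewrite E eqxx.
pose G (x : R * R) := K x.1 (leg n (Num.max 0 x.2)).
have cG : continuous G.
  apply: (family_apply fK); first exact: continuous_fst.
  apply: (@continuous_comp_fun _ _ _ (fun x : R * R => x.2) (fun t : R => leg n (Num.max 0 t))).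
    exact: continuous_snd.
  exact: leg_cont.
pose Q (x : R * R) := path_to_infty (fun s => G (clamp x.1, s)) (clamp x.2).
have cQ : continuous Q.
  apply: continuous_to_infinity cG _ => M; have [T T0 hT] := tame_far n tK M.
  by exists T => u s u01 Ts; rewrite /G /= (max_idPr (le_trans T0 Ts)); exact: hT.
have s0 (s : R) : 0 <= s <= 1 -> s < 1 -> 0 <= s / (1 - s).
  by move=> /andP[? _] ?; rewrite divr_ge0 // subr_ge0 ltW.
have QE (u s : R) : 0 <= u <= 1 -> 0 <= s <= 1 -> Q (u, s) = path_to_infty (K u \o leg n) s.
  move=> u01 s01; rewrite /Q /= !clamp_id // /path_to_infty; case: ifP => // s1.
  by rewrite /G /= (max_idPr (s0 _ s01 s1)).
have hsq : homot X (path_cat (fun t => Q (t, 0)) (fun t => Q (1, t))) (fun t => Q (0, t)).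
  apply: square_end cQ _ _.
    by move=> x x01; rewrite !QE ?itv0 ?itv1 // !path_to_infty1.
  move=> x y x01 y01; rewrite QE // /path_to_infty; case: ifP => y1; last exact: half_plane_None.
  by apply: XK => //; exact: s0.
pose la (t : R) : sphere R := Some (K t (a n)).
have {}hsq : homot X (path_cat la (path_to_infty (psi \o leg n))) (path_to_infty (phi \o leg n)).
  apply: homot_eq hsq.
    move=> t t01; rewrite /path_cat; case: ifP => t2.
      rewrite QE ?path_to_infty0 /= ?leg_start ?itv0 //.
      by case/andP: t01 => ? ?; apply/andP; split; lra.
    rewrite QE ?K1 ?itv1 //; move: t2 => /negbT; rewrite -ltNge => ?.
    by case/andP: t01 => ? ?; apply/andP; split; lra.
  by move=> t t01; rewrite QE ?K0 ?itv0.
(* The strand of [a n] starts at [phi (a n)], so this puncture is filled in before comparing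
   loops. *)
have VV : punctured_half_plane (V n.+1) r `<=` X.
  move=> y [[z [rz Vz] <-]|->]; last exact: half_plane_None.
  apply: half_plane_Some => // -[i /= i_n E]; apply: Vz; exists i => //=; exact: ltnW.
have hw := homot_subset VV (hr0 r rr0).
have Xb : X (Some (phi (a n))) by rewrite -K0 -leg_start; apply: XK => //; exact: itv0.
have pla : path_from_to X (Some (phi (a n))) (Some (phi (a n))) la.
  split; rewrite /la ?K0 ?K1 ?agree -?agree //; split.
    apply: continuous_Some; apply: (family_apply fK); first exact: clamp_continuous.
    exact: cst_continuous.
  by move=> t /ltW_itv t01; rewrite -leg_start; apply: XK.
have ppsi : path_from_to X (Some (phi (a n))) None (path_to_infty (psi \o leg n)).
  split; [exact: homot_path_r hw| | |exact: Xb|exact: half_plane_None].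
    by rewrite path_to_infty0 /= leg_start agree.
  by rewrite path_to_infty1.
exists r; split => //; first by rewrite -K0 -leg_start; apply: rK => //; exact: itv0.
apply: (eqv_nil_loop pla); apply: (eqv_cancel_r (l := [:: la]) (m := [::]) ppsi).
- exact: chain1.
- by split.
- apply: eqv_trans (eqv_sym (eqv_path_cat pla ppsi)) _.
  apply: eqv_homot1; first exact: path_from_to_cat pla ppsi.
  exact: homot_trans hsq hw.
Qed.

Lemma finite_uniform (n : nat) (P : nat -> R -> Prop) :
  (forall i d d', P i d -> 0 < d' -> d' <= d -> P i d') ->
  (forall i, (i < n)%N -> exists2 d, 0 < d & P i d) ->
  exists2 d, 0 < d & forall i, (i < n)%N -> P i d.
Proof.
move=> mono; elim: n => [|n ih] h; first by exists 1.
have [d d0 hd] := ih (fun i i_n => h i (ltnW i_n)); have [d' d'0 hd'] := h n (ltnSn n).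
have m0 : 0 < Num.min d d' by rewrite lt_min d0.
exists (Num.min d d') => // i; rewrite ltnS leq_eqVlt => /orP[/eqP ->|i_n].
  by apply: mono hd' m0 _; rewrite ge_min lexx orbT.
by apply: mono (hd i i_n) m0 _; rewrite ge_min lexx.
Qed.

(** The disc of radius [rho] contains the strands still to be straightened. All pushes are supported
    in it and preserve it, so the strands outside remain fixed. *)
Definition straightened K (rho : R) n := [/\ homeo_family K /\ tame S K, K 0 = phi /\ K 1 = psi,
  forall m (u : R), 0 <= u <= 1 -> rho <= normc (phi (a m)) -> K u (a m) = phi (a m),
  forall m (u : R), 0 <= u <= 1 -> normc (phi (a m)) < rho -> normc (K u (a m)) < rho &
  forall i (u : R), (i < n)%N -> 0 <= u <= 1 -> K u (a i) = phi (a i)].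

(* The null-homotopy [H] of the strand of [a n] moves inside the disc of radius [rho']
   and away from the points already fixed: push along it. *)
Lemma straightened_push K rho n (d rho' : R) (H : R * R -> C) : 0 < d -> d <= rho - rho' ->
  straightened K rho n -> continuous H ->
  (forall t, 0 <= t <= 1 -> H (0, t) = K t (a n) /\ H (1, t) = phi (a n)) ->
  (forall u, 0 <= u <= 1 -> H (u, 0) = phi (a n) /\ H (u, 1) = phi (a n)) ->
  (forall u t, 0 <= u <= 1 -> 0 <= t <= 1 -> normc (H (u, t)) <= rho') ->
  (forall i, (i < n)%N ->
     forall u t, 0 <= u <= 1 -> 0 <= t <= 1 -> d <= normc (phi (a i) - H (u, t))) ->
  exists K', straightened K' rho n.+1.
Proof.
move=> d0 dr [[fK [D hD]] [K0 K1] I1 I2 I3] cH H1 H2 Hr Hd.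
(* Time is reversed: [push_along] needs a homotopy that begins with the constant path and ends with
   the strand. *)
pose L (x : R * R) := H (1 - x.2, x.1).
have cL : continuous L.
  apply: (@continuous_comp_fun _ _ _ (fun x : R * R => (1 - x.2, x.1)) H) cH.
  apply: continuous_pair; last exact: continuous_fst.
  by apply: continuous_funD; [exact: cst_continuous|apply: continuous_funN; exact: continuous_snd].
have rev01 (t : R) : 0 <= t <= 1 -> 0 <= 1 - t <= 1.
  by move=> /andP[? ?]; apply/andP; split; lra.
have [||Phi [Psi [mi P1 P2 P3]]] := @push_along R L (phi (a n)) d d0 cL.
- by move=> u u01; rewrite /L /= subr0; have [] := H1 u u01.
- by move=> s /rev01 s01; rewrite /L /=; exact: H2.
have [_ _ can] := mi.
have Pfix u z : 0 <= u <= 1 ->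
    (forall u' s, 0 <= u' <= 1 -> 0 <= s <= 1 -> d <= normc (z - H (u', s))) -> Psi u z = z.
  move=> u01 h; have [PQ _] := can u u01; rewrite -[in LHS](P3 u z u01) ?PQ //.
  by move=> u' s u'01 /rev01 s01; exact: h.
have Pfar u z : 0 <= u <= 1 -> rho <= normc z -> Psi u z = z.
  move=> u01 zr; apply: Pfix => // u' s u'01 s01.
  by have := Hr u' s u'01 s01; have := ler_dist_normc z (H (u', s)); lra.
(* A bijection that is the identity outside the disc preserves the disc. *)
have Pball u z : 0 <= u <= 1 -> normc z < rho -> normc (Psi u z) < rho.
  move=> u01 zr; rewrite ltNge; apply/negP => h.
  have [PQ QP] := can u u01.
  have E : Psi u z = z by apply: (can_inj QP); rewrite Pfar.
  by move: h; rewrite E leNgt zr.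
exists (fun u z => Psi (clamp u) (K u z)); split.
- split; first exact: (family_unpush mi fK).
  exists (D + 2 * `|rho|) => u z u01 Sz; rewrite clamp_id //.
  have h1 := hD u z u01 Sz; have h2 := normr_ge0 rho; have h3 := ler_norm rho.
  have [zr|zr] := leP rho (normc (K u z)); first by rewrite Pfar //; lra.
  have h4 := Pball u _ u01 zr.
  have := normc_triangle (Psi u (K u z)) (K u z) z.
  have := normc_triangle (Psi u (K u z)) 0 (K u z); rewrite subr0 sub0r normcN; lra.
- split; apply/funext => z.
    rewrite clamp0 K0; have [QP _] := can 0 itv0; have [P00 _] := P2 z.
    by rewrite -{1}(P2 (phi z)).1 QP.
  rewrite clamp1 K1; have [QP _] := can 1 itv1.
  by rewrite -{1}(P2 (psi z)).2 QP.
- by move=> m u u01 mr; rewrite clamp_id // (I1 m u u01 mr) Pfar.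
- by move=> m u u01 mr; rewrite clamp_id //; apply: Pball => //; exact: I2.
- move=> i u; rewrite ltnS leq_eqVlt => /orP[/eqP ->|i_n] u01; rewrite clamp_id //.
    have [QP _] := can u u01; have [<- _] := H1 u u01.
    by have := P1 u u01; rewrite /L /= subrr => <-; rewrite QP.
  by rewrite (I3 i u i_n u01); apply: Pfix => // u' s u'01 s01; exact: Hd.
Qed.

Lemma straightened_next K rho n : 0 < rho -> straightened K rho n ->
  exists K', straightened K' rho n.+1.
Proof.
move=> rho0 sK; have [[fK tK] [K0 K1] I1 I2 I3] := sK.
have [b_far|b_near] := leP rho (normc (phi (a n))).
  exists K; split => // i u; rewrite ltnS leq_eqVlt => /orP[/eqP ->|i_n] u01; last exact: I3.
  exact: I1.
have cK : continuous (fun t : R => K t (a n)).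
  by apply: (family_apply fK); [exact: continuous_idfun|exact: cst_continuous].
have [u0 u001 hu0] : exists2 u0, 0 <= u0 <= 1 &
    forall u, 0 <= u <= 1 -> normc (K u (a n)) <= normc (K u0 (a n)).
  have cn : continuous (fun t : R => - normc (K t (a n))).
    by apply: continuous_funN; apply: (continuous_comp_fun cK); exact: normc_continuous.
  have ne : (`[(0 : R), 1] : set R) !=set0 by exists 0; rewrite /= in_itv /= lexx ler01.
  have [u0 /=] := compact_min (@segment_compact R 0 1) ne cn; rewrite in_itv /= => u001 h.
  exists u0 => // u u01; have := h u; rewrite /= in_itv /= u01 => /(_ isT); rewrite lerN2; exact.
have [||g g0 hg] := @finite_uniform n
    (fun i g => normc (phi (a i)) < rho -> normc (phi (a i)) <= rho - g).
- by move=> i g g' h g'0 g'g /h; move: (normc _) => x; lra.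
- move=> i _; have [br|br] := ltP (normc (phi (a i))) rho; last by exists 1.
  exists (rho - normc (phi (a i))); first by rewrite subr_gt0.
  by move=> _; rewrite opprB addrCA subrr addr0.
pose top := normc (K u0 (a n)).
have top_rho : top < rho by exact: I2.
have top0 : 0 <= top by exact: normc_ge0.
(* A radius below [rho] that exceeds the strand and every [phi (a i)], [i < n], inside the disc, so
   that its circle carries none of these points and leaves a margin for the push. *)
pose rho' := Num.max ((top + rho) / 2) (rho - g / 2).
have r0 : 0 < rho' by rewrite lt_max; apply/orP; left; lra.
have r1 : rho' < rho by rewrite gt_max; apply/andP; split; lra.
have r2 : top < rho' by rewrite lt_max; apply/orP; left; lra.
have r3 i : (i < n)%N -> normc (phi (a i)) <> rho'.
  move=> i_n E; have := hg i i_n; rewrite E r1 => /(_ isT).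
  rewrite leNgt => /negP; apply; rewrite lt_max; apply/orP; right; lra.
have bn : normc (phi (a n)) <= rho'.
  by rewrite -K0; apply: le_trans (ltW r2); apply: hu0; exact: itv0.
have Kn t : 0 <= t <= 1 -> normc (K t (a n)) <= rho'.
  by move=> t01; apply: le_trans (ltW r2); exact: hu0.
have [r [_ rb hnull]] := strand_null 0 fK tK K0 K1 I3.
(* At least [rho'] for the retraction to fix the disc, and at least [- r] for it to be continuous on
   H_r. *)
pose sigma := Num.max rho' (- r).
have s1 : rho' <= sigma by rewrite le_max lexx.
have s2 : - sigma <= r by rewrite lerNl le_max lexx orbT.
have Vr z : V n z -> normc z <> rho' by move=> [i /= i_n <-]; exact: r3.
have [H [cH H1 H2 HA]] := homot_retract r0 s1 s2 Vr rb Kn bn hnull.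
have bV : ~ V n (phi (a n)).
  move=> [i /= i_n]; rewrite -K0 => /(family_inj fK) /a_inj E.
  by rewrite E ltnn in i_n.
have {}H2 u : 0 <= u <= 1 -> H (u, 0) = phi (a n) /\ H (u, 1) = phi (a n).
  by move=> u01; have [-> ->] := H2 u u01; rewrite K0 K1 -agree.
have {}HA u t : 0 <= u <= 1 -> 0 <= t <= 1 -> ~ V n (H (u, t)) /\ normc (H (u, t)) <= rho'.
  move=> u01 /andP[]; have [h0 h1] := H2 u u01.
  rewrite le_eqVlt => /orP[/eqP <- _|t0]; first by rewrite h0.
  rewrite le_eqVlt => /orP[/eqP ->|t1]; first by rewrite h1.
  by apply: HA; rewrite ?t0.
have [||d d0 hd] := @finite_uniform n (fun i d => forall u t, 0 <= u <= 1 -> 0 <= t <= 1 ->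
    d <= normc (phi (a i) - H (u, t))).
- by move=> i d d' h _ dd u t u01 t01; apply: le_trans dd _; exact: h.
- move=> i i_n.
  have cn : continuous (fun x : R * R => normc (phi (a i) - H x)).
    apply: (@continuous_comp_fun _ _ _ (fun x : R * R => phi (a i) - H x) (@normc R)).
      by apply: continuous_subc; [exact: cst_continuous|exact: cH].
    exact: normc_continuous.
  have ne : (`[(0 : R), 1] `*` `[(0 : R), 1] : set (R * R)) !=set0.
    by exists (0, 0); split; rewrite /= in_itv /= lexx ler01.
  have [[u1 t1] [/=]] := compact_min (@compact_square R) ne cn.
  rewrite !in_itv /= => u101 t101 h; exists (normc (phi (a i) - H (u1, t1))).
    rewrite normc_gt0 subr_eq0; apply/eqP => E.
    by have [Vn _] := HA u1 t1 u101 t101; apply: Vn; exists i.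
  by move=> u t u01 t01; apply: (h (u, t)); split; rewrite /= in_itv.
apply: (@straightened_push K rho n (Num.min d (rho - rho')) rho' H) => //.
- by rewrite lt_min d0 subr_gt0.
- by rewrite ge_min lexx orbT.
- by move=> u t u01 t01; have [] := HA u t u01 t01.
- by move=> i i_n u t u01 t01; rewrite ge_min hd.
Qed.

Lemma words_isotopic K : homeo_family K -> near_identity S K -> K 0 = phi -> K 1 = psi ->
  isotopic_rel (range a) phi psi.
Proof.
move=> fK nK K0 K1.
have [K' [M [fK' tK' K'0 K'1 hM]]] := straighten_far fK nK K0 K1 agree.
have [D hD] := tK'.
(* The disc contains every strand of index below [M]; the remaining ones are straight already. *)
pose rho := 1 + `|D| + \sum_(i < M) normc (a i).
have sum0 : 0 <= \sum_(i < M) normc (a i) by apply: sumr_ge0 => i _; exact: normc_ge0.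
have rho0 : 0 < rho by rewrite /rho; have := normr_ge0 D; lra.
have small m u : (m < M)%N -> 0 <= u <= 1 -> normc (K' u (a m)) < rho.
  move=> mM u01; have := hD u _ u01 (a_S m); have := ler_dist_normc (K' u (a m)) (a m).
  have : normc (a m) <= \sum_(i < M) normc (a i).
    by rewrite (bigD1 (Ordinal mM)) //= lerDl; apply: sumr_ge0 => i _; exact: normc_ge0.
  by have := ler_norm D; rewrite /rho; lra.
have s0 : straightened K' rho 0.
  split => // m u u01; have [mM|mM] := leqP M m.
  - by move=> _; exact: hM.
  - by rewrite -K'0 leNgt small ?itv0.
  - by rewrite hM.
  - by move=> _; exact: small.
have sn n : exists K1, straightened K1 rho n.
  by elim: n => [|n [K2 /(straightened_next rho0)]] //; exists K'.
(* From index [N] on, the points [phi (a m)] lie outside the disc, so [N] corrections are enough. *)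
have [N hN] := tame_orbit tK' rho.
have [L [[fL tL] [L0 L1] I1 I2 I3]] := sn N.
exists L; split => //; first exact: family_isotopy.
move=> u _ u01 [m _ <-]; have [mN|mN] := ltnP m N; first exact: I3.
by apply: I1 => //; rewrite -K'0; apply: ltW; apply: hN => //; exact: itv0.
Qed.

End Words.

End Legs.

(** * From isotopies to equal words *)

Section FreeHomotopy.
Context {R : realType}.
Local Notation C := R[i].
Implicit Types (A : set C) (p q : R -> C) (L : R -> C -> C) (x y z : C).

Definition free_homot A p q := exists Q : R * R -> C,
  [/\ continuous Q,
      forall t, 0 <= t <= 1 -> Q (t, 0) = p t /\ Q (t, 1) = q t,
      forall s, 0 <= s <= 1 -> Q (0, s) = Q (1, s) &
      forall t s, 0 <= t <= 1 -> 0 <= s <= 1 -> A (Q (t, s))].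

Lemma free_homot_trans A p q q' : free_homot A p q -> free_homot A q q' -> free_homot A p q'.
Proof.
move=> [Q [cQ Q1 Q2 QA]] [P [cP P1 P2 PA]].
pose f (F : R * R -> C) (k l : R) (x : R * R) := F (clamp x.1, clamp (k * x.2 + l)).
have cf F k l : continuous F -> continuous (f F k l).
  move=> cF; apply: (@continuous_comp_fun _ _ _ (fun x : R * R => (clamp x.1, clamp (k * x.2 + l))) F) cF.
  apply: continuous_pair.
    apply: (@continuous_comp_fun _ _ _ (fun x : R * R => x.1) clamp).
      exact: continuous_fst.
    exact: clamp_continuous.
  apply: (@continuous_comp_fun _ _ _ (fun x : R * R => x.2) (fun t : R => clamp (k * t + l))).
    exact: continuous_snd.
  exact: continuous_clamp_scale.
exists (fun v : R * R => if v.2 <= 2^-1 then f Q 2 0 v else f P 2 (-1) v); split.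
- apply: continuous_if_le; [exact: cf|exact: cf|exact: continuous_snd|exact: cst_continuous|].
  move=> x /= E; rewrite /f E; have -> : 2 * 2^-1 + 0 = 1 :> R by lra.
  have -> : 2 * 2^-1 + -1 = 0 :> R by lra.
  rewrite clamp0 clamp1; have c01 := clamp_itv x.1.
  by have [_ ->] := Q1 _ c01; have [-> _] := P1 _ c01.
- move=> t t01; rewrite /f /=; have -> : (0 : R) <= 2^-1 by rewrite invr_ge0.
  rewrite one_le_half mulr0 addr0 clamp0 clamp_id // mulr1 two_sub1 clamp1.
  by have [-> _] := Q1 _ t01; have [_ ->] := P1 _ t01.
- move=> s s01; rewrite /f /= clamp0 clamp1; case: ifP => _; [apply: Q2|apply: P2]; exact: clamp_itv.
- move=> t s t01 s01; rewrite /f /=; case: ifP => _; [apply: QA|apply: PA]; exact: clamp_itv.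
Qed.

Lemma free_homot_null A p z : free_homot A p (fun=> z) -> homot A p (fun=> p 0).
Proof.
move=> [Q [cQ Q1 Q2 QA]]; have [q0 _] := Q1 _ itv0.
apply: homot_eq (null_loop (A := A) cQ _ _ QA).
- by move=> t t01; have [] := Q1 t t01.
- by [].
- exact: Q2.
- by move=> t t01; have [_ ->] := Q1 t t01; have [_ ->] := Q1 _ itv0.
Qed.

(** The segment from [x] to [x0], or, if its line passes through [y], a parabolic arc, which meets
    that line only at [x] and [x0]. *)
Lemma avoiding_path x x0 y : x <> y -> x0 <> y -> exists c : R -> C,
  [/\ continuous c, c 0 = x, c 1 = x0 & forall s, 0 <= s <= 1 -> c s <> y].
Proof.
move=> xy x0y.
have cont (f : R -> R) : continuous f ->
    continuous (fun s : R => x + (s +i* f s) * (x0 - x)).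
  move=> cf; apply: continuous_addc; first exact: cst_continuous.
  apply: continuous_mulc; last exact: cst_continuous.
  by apply: continuous_complex; [exact: continuous_idfun|exact: cf].
have end0 : x + (0 +i* 0) * (x0 - x) = x by rewrite mul0r addr0.
have end1 : x + (1 +i* 0) * (x0 - x) = x0 by rewrite mul1r addrC subrK.
have [[s' E]|no] := pselect (exists s' : R, x + (s' +i* 0) * (x0 - x) = y); last first.
  exists (fun s => x + (s +i* 0) * (x0 - x)); split => //.
    by apply: (cont (fun=> 0)); exact: cst_continuous.
  by move=> s _ E; apply: no; exists s.
have x0x : x0 - x != 0.
  by apply/eqP => E0; apply: xy; rewrite -E E0 mulr0 addr0.
exists (fun s => x + (s +i* (s * (1 - s))) * (x0 - x)); split => //.
- apply: (cont (fun s => s * (1 - s))); apply: continuous_funM; first exact: continuous_idfun.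
  by apply: continuous_funD; [exact: cst_continuous|apply: continuous_funN; exact: continuous_idfun].
- by rewrite mul0r.
- by rewrite subrr mulr0.
- move=> s _ Es; have /addrI/(mulIf x0x)[_ /eqP] := etrans Es (esym E).
  rewrite mulf_eq0 subr_eq0 => /orP[]/eqP s_e; move: Es.
    by rewrite s_e mul0r end0.
  by rewrite -s_e subrr mulr0 end1.
Qed.

(* As [L u z - L u y] never vanishes for [z <> y], the loop [L u x] is freely homotopic
   in the punctured plane to [L u x - L u y], hence to [L u x0 - L u y] and to [- L u y],
   which stays close to [- y]. *)
Lemma loop_null L x x0 y (D : R) : homeo_family L -> L 0 = L 1 -> x0 <> y -> D < normc y ->
  (forall u, 0 <= u <= 1 -> normc (L u y - y) <= D) ->
  (forall u, 0 <= u <= 1 -> normc (L u x0) < normc (L u y)) ->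
  (forall u, 0 <= u <= 1 -> normc (L u y) < normc (L u x)) ->
  homot [set z | z <> 0] (fun u => L u x) (fun=> L 0 x).
Proof.
move=> fL L01 x0y Dy hD h0 hx.
have xy : x <> y by move=> E; have := hx 0 itv0; rewrite E ltxx.
have [c [cc c0 c1 cy]] := avoiding_path xy x0y.
have cL (f : R -> C) : continuous f -> continuous (fun v : R * R => L v.1 (f v.2)).
  move=> cf; apply: (family_apply fL); first exact: continuous_fst.
  apply: (@continuous_comp_fun _ _ _ (fun v : R * R => v.2) f); last exact: cf.
  exact: continuous_snd.
have cLz z : continuous (fun v : R * R => L v.1 z).
  by apply: (cL (fun=> z)); exact: cst_continuous.
have cs : continuous (fun v : R * R => (v.2)%:C).
  apply: (@continuous_comp_fun _ _ _ (fun v : R * R => v.2) (fun t : R => t%:C)).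
    exact: continuous_snd.
  exact: continuous_real_complex.
have lt_ne (z w : C) (s : R) : 0 <= s <= 1 -> normc w < normc z -> z - s%:C * w <> 0.
  move=> /andP[s0 s1] wz /eqP; rewrite subr_eq0 => /eqP E; move: wz.
  rewrite E normcM normc_real (ger0_norm s0) ltNge ler_piMl ?normc_ge0 //.
apply: (@free_homot_null _ _ (- y)).
apply: (@free_homot_trans _ _ (fun u => L u x - L u y)).
  exists (fun v => L v.1 x - (v.2)%:C * L v.1 y); split.
  - by apply: continuous_subc; [exact: cLz|apply: continuous_mulc; [exact: cs|exact: cLz]].
  - by move=> t _ /=; rewrite mul0r subr0 mul1r.
  - by move=> s _ /=; rewrite L01.
  - by move=> t s t01 s01 /=; apply: lt_ne => //; exact: hx.
apply: (@free_homot_trans _ _ (fun u => L u x0 - L u y)).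
  exists (fun v => L v.1 (c v.2) - L v.1 y); split.
  - by apply: continuous_subc; [exact: cL|exact: cLz].
  - by move=> t _ /=; rewrite c0 c1.
  - by move=> s _ /=; rewrite L01.
  - move=> t s t01 s01 /= /eqP; rewrite subr_eq0 => /eqP /(family_inj fL); exact: cy.
apply: (@free_homot_trans _ _ (fun u => - L u y)).
  exists (fun v => - (L v.1 y - (1 - v.2)%:C * L v.1 x0)); split.
  - apply: continuous_comp_fun (@continuous_funN _ _ _ (fun z : C => z) (@continuous_idfun C)).
    apply: continuous_subc; first exact: cLz.
    apply: continuous_mulc; last exact: cLz.
    apply: (@continuous_comp_fun _ _ _ (fun v : R * R => v.2) (fun t : R => (1 - t)%:C)).
      exact: continuous_snd.
    apply: (@continuous_comp_fun _ _ _ (fun t : R => 1 - t) (fun t : R => t%:C)).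
      by apply: continuous_funD; [exact: cst_continuous|apply: continuous_funN; exact: continuous_idfun].
    exact: continuous_real_complex.
  - by move=> t _ /=; rewrite subr0 mul1r opprB subrr mul0r subr0.
  - by move=> s _ /=; rewrite L01.
  - move=> t s t01 /andP[s0 s1] /= /eqP; rewrite oppr_eq0 => /eqP; apply: lt_ne.
      by apply/andP; split; lra.
    exact: h0.
exists (fun v => - (y - (1 - v.2)%:C * (y - L v.1 y))); split.
- apply: continuous_comp_fun (@continuous_funN _ _ _ (fun z : C => z) (@continuous_idfun C)).
  apply: continuous_subc; first exact: cst_continuous.
  apply: continuous_mulc; last by apply: continuous_subc; [exact: cst_continuous|exact: cLz].
  apply: (@continuous_comp_fun _ _ _ (fun v : R * R => v.2) (fun t : R => (1 - t)%:C)).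
    exact: continuous_snd.
  apply: (@continuous_comp_fun _ _ _ (fun t : R => 1 - t) (fun t : R => t%:C)).
    by apply: continuous_funD; [exact: cst_continuous|apply: continuous_funN; exact: continuous_idfun].
  exact: continuous_real_complex.
- by move=> t _ /=; rewrite subr0 mul1r subKr subrr mul0r subr0.
- by move=> s _ /=; rewrite L01.
- move=> t s t01 /andP[s0 s1] /= /eqP; rewrite oppr_eq0 => /eqP; apply: lt_ne.
    by apply/andP; split; lra.
  by rewrite normcB; apply: le_lt_trans Dy; exact: hD.
Qed.

(** A homotopy in the plane without the origin can be rescaled radially to modulus at least [rho],
    which leaves the loop fixed and avoids [V]. Its image is bounded, hence contained in a
    half-plane for all small [r]. *)
Lemma homot_push_out (p : R -> C) z (rho : R) : 0 < rho ->
  (forall t, 0 <= t <= 1 -> rho <= normc (p t)) -> homot [set w : C | w <> 0] p (fun=> z) ->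
  exists r0 : R, forall (V : set C) r, (forall v, V v -> normc v < rho) -> r <= r0 ->
    homot (punctured_half_plane V r) (fun t => Some (p t)) (fun=> Some z).
Proof.
move=> rho0 hp hh; have [p0z p1z] := homot_ends hh; move: hh => [H [cH H1 H2 HA]].
pose Hc (v : R * R) := H (clamp v.1, clamp v.2).
have cHc : continuous Hc.
  apply: (@continuous_comp_fun _ _ _ (fun v : R * R => (clamp v.1, clamp v.2)) H) cH.
  apply: continuous_pair.
    apply: (@continuous_comp_fun _ _ _ (fun x : R * R => x.1) clamp).
      exact: continuous_fst.
    exact: clamp_continuous.
  apply: (@continuous_comp_fun _ _ _ (fun x : R * R => x.2) clamp).
    exact: continuous_snd.
  exact: clamp_continuous.
have cn : continuous (fun v => normc (Hc v)) by apply: (continuous_comp_fun cHc); exact: normc_continuous.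
have n0 v : normc (Hc v) != 0.
  rewrite normc_eq0; apply/eqP; rewrite /Hc.
  have := clamp_itv v.1; have := clamp_itv v.2; move: (clamp v.1) (clamp v.2) => u t t01 u01.
  have nz : forall t, 0 <= t <= 1 -> p t <> 0.
    by move=> t' t'01 E; have := hp t' t'01; rewrite E normc0 leNgt rho0.
  case/andP: t01; rewrite le_eqVlt => /orP[/eqP <- _|t0].
    by have [-> _] := H2 u u01; apply: nz; exact: itv0.
  rewrite le_eqVlt => /orP[/eqP ->|t1]; first by have [_ ->] := H2 u u01; apply: nz; exact: itv1.
  by apply: HA; rewrite ?t0.
have [N hN] := compact_bounded_above (@compact_square R) cn.
pose m (v : R * R) := Num.max 1 (rho / normc (Hc v)).
have m1 v : 1 <= m v by rewrite le_max lexx.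
have F_norm v : normc ((m v)%:C * Hc v) = Num.max (normc (Hc v)) rho.
  have h0 : 0 < normc (Hc v) by rewrite lt_neqAle eq_sym n0 normc_ge0.
  rewrite normcM normc_real ger0_norm; last exact: le_trans (m1 v).
  by rewrite /m maxr_pMl ?ltW // mul1r divfK // gt_eqF.
have F_id v : rho <= normc (Hc v) -> (m v)%:C * Hc v = Hc v.
  move=> h; have h0 : 0 < normc (Hc v) by exact: lt_le_trans h.
  by rewrite /m (max_idPl _) ?mul1r // ler_pdivrMr ?mul1r.
have Hc01 u t : 0 <= u <= 1 -> 0 <= t <= 1 -> Hc (u, t) = H (u, t).
  by move=> u01 t01; rewrite /Hc /= !clamp_id.
exists (- Num.max N rho - 1) => V r hV hr.
exists (fun v => Some ((m v)%:C * Hc v)); split.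
- apply: continuous_Some; apply: continuous_mulc; last exact: cHc.
  apply: (@continuous_comp_fun _ _ _ m (fun t : R => t%:C)); last exact: continuous_real_complex.
  apply: continuous_funmax; first exact: cst_continuous.
  by apply: continuous_funM; [exact: cst_continuous|exact: continuous_funV].
- move=> t t01; have [h0 h1] := H1 t t01.
  rewrite !F_id ?Hc01 ?itv0 ?itv1 ?h0 ?h1 //; last exact: hp.
  by rewrite -p1z; apply: hp; exact: itv1.
- move=> u u01; have [h0 h1] := H2 u u01.
  by rewrite !F_id ?Hc01 ?itv0 ?itv1 ?h0 ?h1 //; apply: hp; rewrite ?itv0 ?itv1.
- move=> u t u01 /ltW_itv t01; apply: half_plane_Some; last first.
    by move=> /hV; rewrite F_norm gt_max ltxx andbF.
  have h1 : normc ((m (u, t))%:C * Hc (u, t)) <= Num.max N rho.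
    rewrite F_norm ge_max [in X in _ && X]le_max lexx orbT andbT le_max.
    by rewrite (hN (u, t)) //; split; rewrite /= in_itv.
  have := Re_le_normc ((m (u, t))%:C * Hc (u, t)); rewrite ler_norml => /andP[h2 _].
  by move: h1 h2; move: (normc _) => q h1 h2; lra.
Qed.

End FreeHomotopy.

(** * Comparison of the legs of isotopic spiders *)

Section IsotopicLegs.
Context {R : realType}.
Local Notation C := R[i].
Variables (S : set C) (a : nat -> C) (leg : nat -> R -> C).
Hypothesis legs : leg_system S a leg.
Implicit Types (K J : R -> C -> C) (n : nat).

Lemma square_Re (f : R * R -> C) : continuous f ->
  exists r : R, forall u t, 0 <= u <= 1 -> 0 <= t <= 1 -> r < Re (f (u, t)).
Proof.
move=> cf; have cR : continuous (fun v => - Re (f v)).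
  by apply: continuous_funN; apply: (continuous_comp_fun cf); exact: Re_continuous.
have [M hM] := compact_bounded_above (@compact_square R) cR.
exists (- M - 1) => u t u01 t01; have := hM (u, t); rewrite /= !in_itv /= => /(_ (conj u01 t01)).
lra.
Qed.

Lemma continuous_leg_arg J n (f g : R * R -> R) : homeo_family J -> continuous f -> continuous g ->
  continuous (fun v => J (f v) (leg n (Num.max 0 (g v)))).
Proof.
move=> fJ cf cg; apply: (@family_apply _ _ J f (fun v => leg n (Num.max 0 (g v))) fJ cf).
exact: (@continuous_comp_fun _ _ _ g (fun t : R => leg n (Num.max 0 t)) cg (@leg_cont _ _ _ _ legs n)).
Qed.

(** The leg is divided at a point so far out that its tracks under [J] and [K], and the tracks of
    the rest of the leg under [K], avoid a disc containing [V]. *)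
Lemma isotopic_legs_homot K J (phi psi : C -> C) n : homeo_family K -> tame S K ->
  K 0 = phi -> K 1 = psi -> homeo_family J -> J 0 = phi -> J 1 = psi ->
  (forall u m, 0 <= u <= 1 -> J u (a m) = phi (a m)) ->
  exists r0, forall r, r <= r0 ->
    homot (punctured_half_plane [set phi (a i) | i in `I_n.+1] r)
      (path_to_infty (phi \o leg n)) (path_to_infty (psi \o leg n)).
Proof.
move=> fK tK K0 K1 fJ J0 J1 Ja.
set V := [set phi (a i) | i in `I_n.+1].
(* At double speed: [J] forwards, then [K] backwards, hence a loop based at [phi]. *)
pose L u := if u <= 2^-1 then J (1 - (1 - 2 * u)) else K (1 - (2 * u - 1)).
have fL : homeo_family L.
  have frev (M : R -> C -> C) : homeo_family M -> homeo_family (fun u => M (1 - u)).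
    move=> fM; split; last by move=> u; exact: fM.2.
    apply: (family_apply fM); last exact: continuous_snd.
    by apply: continuous_funD; [exact: cst_continuous|apply: continuous_funN; exact: continuous_fst].
  have E : J (1 - 0) = K (1 - 0) by rewrite subr0 J1 K1.
  exact: family_glue (frev _ fJ) (frev _ fK) E.
have Lcase u : 0 <= u <= 1 -> exists2 w : R, 0 <= w <= 1 & L u = J w \/ L u = K w.
  move=> /andP[u0 u1]; rewrite /L; case: ifP => [h|/negbT]; last rewrite -ltNge => h.
    by exists (1 - (1 - 2 * u)); [apply/andP; split; lra|left].
  by exists (1 - (2 * u - 1)); [apply/andP; split; lra|right].
have L0 : L 0 = phi by rewrite /L invr_ge0 ler0n mulr0 subr0 subrr J0.
have L1 : L 1 = phi by rewrite /L one_le_half mulr1 two_sub1 subrr K0.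
have [D hD] := tK.
have D0 : 0 <= D by apply: le_trans (hD 0 (a 0) itv0 (a_S legs 0)); exact: normc_ge0.
have [B hB] : exists B, forall u, 0 <= u <= 1 -> normc (L u 0) <= B.
  have cL0 : continuous (fun u => normc (L u 0)).
    apply: (@continuous_comp_fun _ _ _ (fun u => L u 0) (@normc R)); last exact: normc_continuous.
    by apply: (family_apply fL); [exact: continuous_idfun|exact: cst_continuous].
  have [B hB] := compact_bounded_above (@segment_compact R 0 1) cL0.
  by exists B => u u01; apply: hB; rewrite /= in_itv.
(* For [loop_null] with [y = a m] and [x0 = 0]: the strand of [a m] under [L] must stay away from
   the origin and have larger modulus than that of [0]. *)
have [m hm] : exists m, Num.max D (B + D) < normc (a m).
  by have [m hm] := a_escapes legs (Num.max D (B + D)); exists m; exact: hm.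
have [Dm Bm] : D < normc (a m) /\ B + D < normc (a m) by apply/andP; rewrite -gt_max.
have Lm u : 0 <= u <= 1 -> normc (L u (a m) - a m) <= D.
  move=> /Lcase[w w01 [->|->]]; last exact: hD (a_S legs m).
  by rewrite Ja // -K0; apply: hD itv0 (a_S legs m).
have LB u : 0 <= u <= 1 -> normc (L u 0) < normc (L u (a m)).
  move=> u01; have := hB u u01; have := Lm u u01; have := ler_dist_normc (a m) (L u (a m)).
  by rewrite normcB; lra.
have [rho [rho0 hrho hrho2]] : exists rho : R,
    [/\ 0 < rho, forall v, V v -> normc v < rho & normc (a m) + D < rho].
  have [||d d0 hd] := @finite_uniform R n.+1 (fun i d => normc (phi (a i)) < d^-1).
  - move=> i d d' h d'0 dd'; apply: lt_le_trans h _; rewrite lef_pV2 // posrE.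
    exact: lt_le_trans d'0 dd'.
  - move=> i _; exists (normc (phi (a i)) + 1)^-1; rewrite ?invr_gt0 ?invrK ?ltrDl //.
    by apply: ltr_wpDl => //; exact: normc_ge0.
  exists (d^-1 + (normc (a m) + D)); split.
  - by apply: ltr_pwDl; [rewrite invr_gt0|rewrite addr_ge0 // normc_ge0].
  - move=> v [i /= i_n <-]; apply: lt_le_trans (hd i i_n) _.
    by rewrite lerDl addr_ge0 // normc_ge0.
  - by rewrite ltrDr invr_gt0.
(* The displacement by [J] may be unbounded; that [J] keeps the image of [a 0] fixed makes it proper
   uniformly in time. *)
have [Jfar hJ] := family_proper fJ (fun u u01 => Ja u 0%N u01) rho.
have [T1 T10 hT1] := leg_right legs n Jfar.
have [T2 T20 hT2] := tame_far legs n tK rho.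
pose T := Num.max T1 T2 + 1.
have T0 : 0 < T by rewrite ltr_wpDl // le_max T10.
have T1T : T1 <= T by rewrite /T; have : T1 <= Num.max T1 T2 by [rewrite le_max lexx]; lra.
have T2T : T2 <= T by rewrite /T; have : T2 <= Num.max T1 T2 by [rewrite le_max lexx orbT]; lra.
pose x := leg n T.
have Jx u : 0 <= u <= 1 -> rho < normc (J u x).
  move=> u01; apply: hJ => //; apply: lt_le_trans (hT1 T T1T) _.
  exact: le_trans (ler_norm _) (Re_le_normc _).
have Kx u t : 0 <= u <= 1 -> 0 <= t -> rho < normc (K u (leg n (T + t))).
  by move=> u01 t0; apply: hT2 => //; apply: le_trans T2T _; rewrite lerDl.
have Lx u : 0 <= u <= 1 -> rho < normc (L u x).
  move=> /Lcase[w w01 [->|->]]; first exact: Jx.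
  by have := Kx w 0 w01 (lexx _); rewrite addr0.
have Lmx u : 0 <= u <= 1 -> normc (L u (a m)) < normc (L u x).
  move=> u01; apply: le_lt_trans (Lx u u01); apply: ltW; apply: le_lt_trans hrho2.
  by have := Lm u u01; have := ler_dist_normc (L u (a m)) (a m); lra.
have m0 : 0 <> a m.
  by move=> E; move: Dm; rewrite -E normc0; lra.
have hnull := loop_null fL (etrans L0 (esym L1)) m0 Dm Lm LB Lmx.
have [r1 hr1] := homot_push_out rho0 (fun u u01 => ltW (Lx u u01)) hnull.
have [r2 hr2] := tame_Re legs n tK.
pose G (v : R * R) := J v.1 (leg n (Num.max 0 (T * v.2))).
have cG : continuous G.
  apply: (@continuous_leg_arg J n (fun v => v.1) (fun v => T * v.2) fJ); first exact: continuous_fst.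
  by apply: continuous_funM; [exact: cst_continuous|exact: continuous_snd].
have [r3 hr3] := square_Re cG.
exists (Num.min r1 (Num.min r2 r3)) => r; rewrite !le_min => /andP[rr1 /andP[rr2 rr3]].
pose X := punctured_half_plane V r.
have XJ u t : 0 <= u <= 1 -> 0 < t <= 1 -> X (Some (G (u, t))).
  move=> u01 /andP[t0 t1]; apply: half_plane_Some.
    by apply: le_lt_trans rr3 _; apply: hr3 => //; rewrite ltW.
  have Tt : 0 < T * t by rewrite mulr_gt0.
  move=> [i /= i_n]; rewrite -(Ja u i u01) /G /= (max_idPr (ltW Tt)) => /(family_inj fJ) E.
  have : leg n (T * t) != a i by apply: (leg_avoids legs) => //; exact: ltW.
  by rewrite E eqxx.
have XK u t : 0 <= u <= 1 -> 0 <= t -> X (Some (K u (leg n (T + t)))).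
  move=> u01 t0; apply: half_plane_Some.
    by apply: le_lt_trans rr2 _; apply: hr2 => //; rewrite addr_ge0 // ltW.
  by move=> /hrho; rewrite ltNge (ltW (Kx u t u01 t0)).
pose j (u : R) : sphere R := Some (J u x).
pose k (u : R) : sphere R := Some (K u x).
have XJx u : 0 <= u <= 1 -> X (j u).
  by move=> u01; have := XJ u 1 u01; rewrite /G /= mulr1 (max_idPr (ltW T0)) ltr01 lexx; apply.
have XKx u : 0 <= u <= 1 -> X (k u).
  by move=> u01; have := XK u 0 u01 (lexx _); rewrite addr0.
have path_strand M : homeo_family M -> (forall u, 0 <= u <= 1 -> X (Some (M u x))) ->
    M 0 = phi -> M 1 = psi ->
    path_from_to X (Some (phi x)) (Some (psi x)) (fun u => Some (M u x)).
  move=> fM XM M0 M1; split; rewrite -?M0 -?M1 //; [|exact: XM itv0|exact: XM itv1].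
  split; last by move=> t /ltW_itv; exact: XM.
  apply: continuous_Some; apply: (family_apply fM); first exact: clamp_continuous.
  exact: cst_continuous.
have pj := path_strand J fJ XJx J0 J1; have pk := path_strand K fK XKx K0 K1.
(* The null-homotopic loop [L u x] is [j] followed by the reverse of [k]. *)
have hkj : homot X k j.
  apply: (@eqv_homot _ X (Some (phi x)) (Some (psi x))).
  apply: (eqv_cancel_r (p := path_rev k) (path_from_to_rev pk)); [exact: chain1|exact: chain1|].
  apply: eqv_trans (eqv_rev_r pk) (eqv_sym _).
  apply: eqv_trans (eqv_sym (eqv_path_cat pj (path_from_to_rev pk))) _.
  apply: eqv_trans (eqv_cst _); last by rewrite -J0; exact: XJx itv0.
  apply: eqv_homot1; first exact: path_from_to_cat pj (path_from_to_rev pk).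
  apply: homot_eq (hr1 V r hrho rr1).
    move=> t /andP[t0 t1]; rewrite /path_cat /path_rev /L; case: ifP => t2.
      by rewrite subKr.
    by [].
  by move=> t _; rewrite L0.
pose p M (t : R) : sphere R := Some (M (leg n (t * T)) : C).
pose q M := path_to_infty (fun s => M (leg n (T + s)) : C).
have split_leg M : is_path X (path_to_infty (M \o leg n)) ->
    homot X (path_to_infty (M \o leg n)) (path_cat (p M) (q M)).
  exact: path_to_infty_split.
have path_leg M u : 0 <= u <= 1 -> K u = M -> J u = M -> is_path X (path_to_infty (M \o leg n)).
  move=> u01 KM JM; apply: is_path_to_infty.
  - have cM : continuous M by rewrite -KM; have [] := fK.2 u.
    exact: (@continuous_comp_fun _ _ _ (fun t : R => leg n (Num.max 0 t)) M (@leg_cont _ _ _ _ legs n) cM).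
  - move=> N; have [T3 T30 hT3] := tame_far legs n tK N; exists T3 => s Ts.
    by rewrite -[X in normc X]/(M (leg n s)) -KM; exact: hT3.
  - move=> t t0; apply: half_plane_Some.
      by rewrite /= -KM; apply: le_lt_trans rr2 _; apply: hr2 => //; exact: ltW.
    move=> [i /= i_n]; rewrite -(Ja u i u01) JM => E.
    have {}E : leg n t = a i by apply: (family_inj (u := u) fJ); rewrite JM.
    have : leg n t != a i by apply: (leg_avoids legs) => //; exact: ltW.
    by rewrite E eqxx.
have pphi := path_leg phi 0 itv0 K0 J0; have ppsi := path_leg psi 1 itv1 K1 J1.
(* Under [J] the first part of the leg sweeps a square whose lower side is the fixed point
   [phi (a n)]. *)
have hp : homot X (path_cat (p phi) j) (p psi).
  have cG' : continuous (fun v => Some (G v) : sphere R) by exact: continuous_Some.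
  apply: homot_eq (square_start (A := X) cG' _ _).
  - move=> t /andP[t0 t1]; rewrite /path_cat; case: ifP => [t2|/negbT].
      have t20 : 0 <= T * (2 * t) by rewrite mulr_ge0 ?(ltW T0) // mulr_ge0.
      by rewrite /G /p /= J0 (max_idPr t20) mulrC.
    by rewrite -ltNge => t2; rewrite /G /j /= mulr1 (max_idPr (ltW T0)).
  - move=> t /andP[t0 t1]; have t20 : 0 <= T * t by rewrite mulr_ge0 ?(ltW T0).
    by rewrite /G /p /= J1 (max_idPr t20) mulrC.
  - move=> u u01; rewrite /G /= mulr0 maxxx (leg_start legs) (Ja u) //.
    by rewrite Ja //; exact: itv0.
  - by move=> u t u01 t01; exact: XJ.
(* Under [K] the rest of the leg sweeps a square whose upper side is infinity; it is continuous
   there because [K] is tame. *)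
have [hq path_q] : homot X (path_cat k (q psi)) (q phi) /\ is_path X (q psi).
  pose G2 (v : R * R) := K v.1 (leg n (Num.max 0 (T + Num.max 0 v.2))).
  have pos (s : R) : 0 <= s -> Num.max 0 (T + Num.max 0 s) = T + s.
    by move=> s0; rewrite (max_idPr s0) (max_idPr _) // addr_ge0 // ltW.
  have cG2 : continuous G2.
    apply: (@continuous_leg_arg K n (fun v => v.1) (fun v => T + Num.max 0 v.2) fK).
      exact: continuous_fst.
    apply: continuous_funD; first exact: cst_continuous.
    by apply: continuous_funmax; [exact: cst_continuous|exact: continuous_snd].
  pose Q (v : R * R) := path_to_infty (fun s => G2 (clamp v.1, s)) (clamp v.2).
  have cQ : continuous Q.
    apply: continuous_to_infinity cG2 _ => N; have [T3 T30 hT3] := tame_far legs n tK N.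
    exists T3 => u s u01 Ts; rewrite /G2 /= pos ?(le_trans T30) //.
    by apply: hT3 => //; apply: le_trans Ts _; rewrite lerDr ltW.
  have QE (u s : R) : 0 <= u <= 1 -> 0 <= s <= 1 -> Q (u, s) = q (K u) s.
    move=> u01 s01; rewrite /Q /= !clamp_id // /q /path_to_infty; case: ifP => // s1.
    rewrite /G2 /= pos //; case/andP: s01 => s0 _.
    by rewrite divr_ge0 // subr_ge0 ltW.
  have XQ u t : 0 <= u <= 1 -> 0 <= t <= 1 -> X (Q (u, t)).
    move=> u01 t01; rewrite QE // /q /path_to_infty; case: ifP => t1; last exact: half_plane_None.
    by apply: XK => //; case/andP: t01 => t0 _; rewrite divr_ge0 // subr_ge0 ltW.
  split.
    apply: homot_eq (square_end (A := X) cQ _ XQ).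
    - move=> t /andP[t0 t1]; rewrite /path_cat; case: ifP => [t2|/negbT].
        rewrite QE ?itv0 //; last by apply/andP; split; lra.
        by rewrite /q path_to_infty0 addr0.
      rewrite -ltNge => t2; rewrite QE ?itv1 ?K1 //.
      by apply/andP; split; lra.
    - by move=> t t01; rewrite QE ?itv0 // K0.
    - by move=> u u01; rewrite !QE ?itv0 ?itv1 // /q !path_to_infty1.
  apply: (@is_path_eq _ _ _ (fun t => Q (1, t))).
    by move=> t t01; rewrite QE ?itv1 // K1.
  split; last by move=> t /ltW_itv; exact: XQ itv1.
  apply: (@continuous_comp_fun _ _ _ (fun t : R => ((1 : R), clamp t)) Q); last exact: cQ.
  by apply: continuous_pair; [exact: cst_continuous|exact: clamp_continuous].
have p1 M : p M 1 = Some (M x) by rewrite /p mul1r.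
have q0 M : q M 0 = Some (M x) by rewrite /q path_to_infty0 addr0.
have hphi := split_leg phi pphi; have hpsi := split_leg psi ppsi.
have [ppj pqk] := (homot_path_l hp, homot_path_l hq).
have XA : X (Some (phi x)) by rewrite -J0; exact: XJx itv0.
have XB : X (Some (psi x)) by rewrite -J1; exact: XJx itv1.
have pathj : is_path X j by have [] := pj.
have j0 : j 0 = Some (phi x) by rewrite /j J0.
have j1 : j 1 = Some (psi x) by rewrite /j J1.
have path_p : is_path X (p phi).
  split.
    apply: continuous_Some; have cphi : continuous phi by rewrite -K0; have [] := fK.2 0.
    have -> : (fun t : R => phi (leg n (clamp t * T))) = (fun t => phi (leg n (Num.max 0 (clamp t * T)))).
      apply/funext => t; rewrite (max_idPr _) // mulr_ge0 ?(ltW T0) //.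
      by have /andP[] := clamp_itv t.
    apply: (@continuous_comp_fun _ _ _ (fun t : R => leg n (Num.max 0 (clamp t * T))) phi); last exact: cphi.
    apply: (@continuous_comp_fun _ _ _ (fun t : R => clamp t * T) (fun t : R => leg n (Num.max 0 t))).
      by apply: continuous_funM; [exact: clamp_continuous|exact: cst_continuous].
    exact: (@leg_cont _ _ _ _ legs n).
  move=> t /andP[t0 t1]; have := XJ 0 t itv0; rewrite t0 (ltW t1) /G /= J0 => /(_ isT).
  by rewrite /p (mulrC T) (max_idPr _) // mulr_ge0 ?(ltW t0) ?(ltW T0).
have hpj : homot X (path_cat (path_cat (p phi) j) (q psi)) (path_cat (p psi) (q psi)).
  by apply: cat_hom hp (homot_refl path_q) _ _; rewrite path_cat1 j1 ?q0.
suff h : homot X (path_cat (path_cat (p phi) j) (q psi)) (path_cat (p phi) (q phi)).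
  exact: homot_trans hphi (homot_trans (homot_sym h) (homot_trans hpj (homot_sym hpsi))).
apply: homot_trans (cat_assoc path_p pathj path_q _ _ _ _) _.
- by rewrite p1 j0.
- by rewrite j1 q0.
- by rewrite p1.
- by rewrite j1.
apply: cat_hom (homot_refl path_p) _ _ _.
- apply: homot_trans (cat_hom (homot_sym hkj) (homot_refl path_q) _ _) hq.
  + by rewrite j1 q0.
  + by rewrite j1.
- by rewrite p1 path_cat0 j0.
- by rewrite p1.
Qed.

End IsotopicLegs.

(** * Spiders *)

Section Spiders.
Context {R : realType}.
Local Notation C := R[i].
Implicit Types (V S : set C) (phi psi : C -> C).

(** The same loop and word serve for [g'] once [r] is lowered to make room for it. *)
Lemma curve_words_homot V (g g' : R -> C) : g 0 = g' 0 ->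
  (exists r1 : R, forall t, 0 <= t -> r1 < Re (g' t)) ->
  (exists r0 : R, forall r, r <= r0 ->
    homot (punctured_half_plane V r) (path_to_infty g) (path_to_infty g')) ->
  curve_words V g `<=` curve_words V g'.
Proof.
move=> gg' [r1 hr1] [r0 hr0] m [fm [r [e [loop [_ sr l01 h1 h2]]]]]; split => //.
pose r' := Num.min r (Num.min r1 r0).
have rr : r' <= r by rewrite ge_min lexx.
have rr1 : r' <= r1 by rewrite !ge_min lexx orbT.
have rr0 : r' <= r0 by rewrite !ge_min lexx !orbT.
have sub := @half_plane_subset _ V _ _ rr.
move: h1 h2 => /homotopic_inP h1 /homotopic_inP h2.
exists r', e, loop; split => //.
- by move=> t t0; apply: le_lt_trans rr1 _; exact: hr1.
- exact: small_radius_le rr sr.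
- by apply/homotopic_inP; rewrite -gg'; exact: homot_trans (homot_subset sub h1) (hr0 _ rr0).
- by apply/homotopic_inP; exact: homot_subset sub h2.
Qed.

Lemma id_type_family S phi psi : id_type S phi -> id_type S psi -> exists K : R -> C -> C,
  [/\ homeo_family K, near_identity S K, K 0 = phi & K 1 = psi].
Proof.
move=> [_ [H [iH H0 H1 nH]]] [_ [H' [iH' H'0 H'1 nH']]].
have E : H (clamp 0) = H' (clamp 0) by rewrite clamp0 H0 H'0.
have fK := family_glue (family_clamp iH) (family_clamp iH') E.
exists (fun u => if u <= 2^-1 then H (clamp (1 - 2 * u)) else H' (clamp (2 * u - 1))); split.
- exact: fK.
- move=> e e0; have [M hM] := nH e e0; have [M' hM'] := nH' e e0.
  exists (Num.max M M') => u z _ Sz; rewrite gt_max => /andP[zM zM'].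
  by case: ifP => _; [apply: hM|apply: hM'] => //; exact: clamp_itv.
- by rewrite invr_ge0 ler0n mulr0 subr0 clamp1.
- by rewrite one_le_half mulr1 two_sub1 clamp1.
Qed.

(** The values [(alpha - 1) * a n + beta] tend to 0. The difference of two consecutive ones gives
    [alpha = 1], and then [beta = 0]. *)
Lemma near_identity_affine S (a : nat -> C) phi psi (alpha beta : C) :
  (forall n, S (a n)) ->
  (exists N, forall m n, (N <= m)%N -> (m < n)%N -> Re (a m) + 1 <= Re (a n)) ->
  (forall M : R, exists N, forall n, (N <= n)%N -> M < normc (a n)) ->
  id_type S phi -> id_type S psi -> (forall n, alpha * phi (a n) + beta = psi (a n)) ->
  alpha = 1 /\ beta = 0.
Proof.
move=> aS [N hN] a_esc iphi ipsi E.
have close chi : id_type S chi -> forall e : R, 0 < e ->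
    exists N, forall n, (N <= n)%N -> normc (chi (a n) - a n) < e.
  move=> [_ [H [_ _ <- nH]]] e e0; have [M hM] := nH e e0; have [N' hN'] := a_esc M.
  by exists N' => n Nn; apply: hM => //; [exact: itv1|exact: hN'].
have A0 : 0 <= normc alpha := normc_ge0 alpha.
have main (e : R) : 0 < e ->
    exists N, forall n, (N <= n)%N -> normc ((alpha - 1) * a n + beta) < e.
  move=> e0; pose e' := e / (normc alpha + 1).
  have e'0 : 0 < e' by rewrite divr_gt0 // ltr_wpDl.
  have [N1 h1] := close _ iphi e' e'0; have [N2 h2] := close _ ipsi e' e'0.
  exists (maxn N1 N2) => n; rewrite geq_max => /andP[n1 n2].
  have -> : (alpha - 1) * a n + beta = (psi (a n) - a n) - alpha * (phi (a n) - a n).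
    by rewrite -E; ring.
  apply: le_lt_trans (le_normcD _ _) _; rewrite normcN normcM.
  have := h1 n n1; have := h2 n n2; have : e = e' * normc alpha + e'.
    by rewrite /e' -[X in _ = _ + X]mulr1 -mulrDr divfK // gt_eqF // ltr_wpDl.
  by move=> -> ? ?; nra.
have alpha1 : alpha = 1.
  apply/eqP; rewrite -subr_eq0 -normc_eq0; apply/eqP/le_anti; rewrite normc_ge0 andbT.
  rewrite leNgt; apply/negP => q0.
  have [|N1 h1] := main (normc (alpha - 1) / 2); first by rewrite divr_gt0.
  pose n := maxn N N1.
  have := h1 n (leq_maxr _ _); have := h1 n.+1 (leqW (leq_maxr _ _)).
  have := normc_triangle ((alpha - 1) * a n.+1 + beta) 0 ((alpha - 1) * a n + beta).
  rewrite subr0 sub0r normcN.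
  have -> : (alpha - 1) * a n.+1 + beta - ((alpha - 1) * a n + beta) =
    (alpha - 1) * (a n.+1 - a n) by ring.
  rewrite normcM => h2 h3 h4.
  have h5 : 1 <= normc (a n.+1 - a n).
    apply: le_trans (Re_le_normc _); rewrite ReB; apply: le_trans (ler_norm _).
    by have := hN n n.+1 (leq_maxl _ _) (ltnSn n); lra.
  by nra.
split => //; apply/eqP; rewrite -normc_eq0; apply/eqP/le_anti; rewrite normc_ge0 andbT.
rewrite leNgt; apply/negP => b0; have [N1 h1] := main _ b0.
by have := h1 N1 (leqnn _); rewrite alpha1 subrr mul0r add0r ltxx.
Qed.

End Spiders.

Theorem theorem6p28 (R : realType) (kappa : R[i])
    (a : nat -> R[i]) (rays : nat -> R -> R[i]) (tau : nat -> R)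
    (r : R) (s : nat -> int) (U : set R[i]) (c : R -> R[i] -> R[i])
    (phi psi : R[i] -> R[i])
    (v_not_escaping : ~ escaping (exp_map kappa) kappa)
    (a_orbit : forall n, a n.+1 = exp_map kappa (a n))
    (rays_dynamic : forall n, dynamic_ray (exp_map kappa) (rays n))
    (a_on_rays : forall n, 0 < tau n /\ rays n (tau n) = a n)
    (a0_address : external_address kappa r (a 0%N) s)
    (s_not_preperiodic : ~ preperiodic s)
    (U_jordan : jordan_domain U)
    (U_avoids_rays : U `<=`
       ~` \bigcup_(n in [set n | (0 < n)%N])
            (ray_part (rays n) (tau n) @` `[0, +oo[))
    (U_v : U kappa) (U_a0 : U (a 0%N))
    (c_isotopy : isotopy c)
    (c_qc : forall u : R, 0 <= u <= 1 -> quasiconformal (c u))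
    (c_0 : c 0 = id)
    (c_off_U : forall (u : R) z, 0 <= u <= 1 -> ~ U z -> c u z = z)
    (c_1 : c 1 kappa = a 0%N)
    (phi_id_type : id_type (standard_spider rays tau) phi)
    (psi_id_type : id_type (standard_spider rays tau) psi) :
  (projectively_equivalent a rays tau phi psi <->
     teichmuller_equiv (range a) phi psi) /\
  (teichmuller_equiv (range a) phi psi <-> isotopic_rel (range a) phi psi).
Proof.
pose leg n := ray_part (rays n) (tau n); pose S := standard_spider rays tau.
have legs : leg_system S a leg.
  split; last by split; [exact: orbit_growth_le a_orbit rays_dynamic a_on_rays
                        |exact: orbit_escapes a_orbit rays_dynamic a_on_rays].
  - move=> n; split; last exact: leg0.
    by apply: ray_tail_cont; exact: leg_tail rays_dynamic a_on_rays _.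
  - move=> i n t; rewrite leq_eqVlt => /orP[/eqP -> _ t0|i_n t0 _].
      by apply: (leg_neq rays_dynamic a_on_rays); exact: t0.
    exact: (orbit_notin_leg a_orbit rays_dynamic a_on_rays).
  - by move=> n t t0; exists n => //; exists t => //; rewrite /= in_itv /= t0.
  - by move=> n M; exact: (leg_Re rays_dynamic a_on_rays n M).
have [K [fK nK K0 K1]] := id_type_family phi_id_type psi_id_type.
have tK := near_identity_tame fK nK.
have words_iso : projectively_equivalent a rays tau phi psi -> isotopic_rel (range a) phi psi.
  move=> pe; have agree n : phi (a n) = psi (a n) by have [] := pe n.
  apply: (words_isotopic legs agree _ fK nK K0 K1) => n.
  have [_] := pe n; rewrite /leg_word => ->; congr (curve_words _ _).
  by apply: eq_imagel => i _; rewrite agree.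
have iso_words : isotopic_rel (range a) phi psi -> projectively_equivalent a rays tau phi psi.
  move=> [J0 [iJ J00 J01 hJ]]; pose J u := J0 (clamp u).
  have fJ : homeo_family J := family_clamp iJ.
  have JE0 : J 0 = phi by rewrite /J clamp0.
  have JE1 : J 1 = psi by rewrite /J clamp1.
  have Ja u m : 0 <= u <= 1 -> J u (a m) = phi (a m).
    by move=> u01; rewrite /J clamp_id // hJ //; exists m.
  have agree n : phi (a n) = psi (a n) by rewrite -JE1 Ja //; exact: itv1.
  move=> n; split => //; rewrite /leg_word.
  have -> : [set psi (a i) | i in `I_n.+1] = [set phi (a i) | i in `I_n.+1].
    by apply: eq_imagel => i _; rewrite agree.
  have [r0 hr0] := isotopic_legs_homot legs n fK tK K0 K1 fJ JE0 JE1 Ja.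
  have [r1 hr1] := tame_Re legs n tK.
  have start : (phi \o leg n) 0 = (psi \o leg n) 0.
    by rewrite /= (leg_start legs) agree.
  apply/seteqP; split; apply: curve_words_homot => //.
  - by exists r1 => t t0; rewrite -K1; exact: hr1 itv1 t0.
  - by exists r0.
  - by exists r1 => t t0; rewrite -K0; exact: hr1 itv0 t0.
  - by exists r0 => r' rr'; exact/homot_sym/hr0.
have iso_teich : isotopic_rel (range a) phi psi -> teichmuller_equiv (range a) phi psi.
  move=> h; exists 1, 0; split; first exact: oner_neq0.
  by have -> : (fun z => 1 * phi z + 0) = phi by apply/funext => z; rewrite mul1r addr0.
have teich_iso : teichmuller_equiv (range a) phi psi -> isotopic_rel (range a) phi psi.
  move=> [alpha [beta [_ h]]].
  have E n : alpha * phi (a n) + beta = psi (a n).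
    by have [H [_ _ <- ->]] := h; [|rewrite lexx ler01|exists n].
  have [a1 b0] := near_identity_affine (a_S legs)
    (orbit_growth_le a_orbit rays_dynamic a_on_rays)
    (orbit_escapes a_orbit rays_dynamic a_on_rays) phi_id_type psi_id_type E.
  have e : (fun z => alpha * phi z + beta) = phi by apply/funext => z; rewrite a1 b0 mul1r addr0.
  by rewrite e in h.
split; split.
- by move=> /words_iso.
- by move=> /teich_iso.
- exact: teich_iso.
- exact: iso_teich.
Qed.
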